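(* Consider the following problem: given a positive integer $q$, a point $f\in\operatorname{vert}(\mathcal{P}_q)$ with $f\notin\mathbb{Z}^2$, and a minimal valid function $\pi$ for $R_f(\mathbb{R}^2,\mathbb{Z}^2)$ that is continuous piecewise linear over $\mathcal{P}_q$ and diagonally constrained, decide whether $\pi$ is extreme for $R_f(\mathbb{R}^2,\mathbb{Z}^2)$. There exists an algorithm for this problem that takes a number of elementary operations over the reals that is bounded by a polynomial in $q$.
   Context: **Group problem.** For an abelian group $G$, a subgroup $S\subseteq G$ and $f\in G\setminus S$, $R_f(G,S)$ is the convex hull of all finitely supported functions $s\colon G\to\mathbb{Z}_{\ge0}$ with $\sum_{r\in G} r\,s(r)\in f+S$. A valid function for $R_f(G,S)$ is a function $\pi\colon G\to\mathbb{R}$, $\pi\ge0$, such that $\sum_{r\in G}\pi(r)s(r)\ge1$ for all $s\in R_f(G,S)$. A valid function $\pi$ is minimal if there is no valid function $\pi'\ne\pi$ with $\pi'(r)\le\pi(r)$ for all $r\in G$. A valid function $\pi$ is extreme if $\pi=\frac12(\pi^1+\pi^2)$ with $\pi^1,\pi^2$ valid implies $\pi=\pi^1=\pi^2$. **Triangulation $\mathcal{P}_q$.** For a positive integer $q$, $\mathcal{P}_q$ is the triangulation of $\mathbb{R}^2$ consisting of the triangles $\frac1q\operatorname{conv}\{(0,0),(1,0),(0,1)\}$ and $\frac1q\operatorname{conv}\{(1,0),(0,1),(1,1)\}$, all their translates by elements of $\frac1q\mathbb{Z}^2$, together with all edges and vertices of these triangles and the empty set. Its vertex set is $\operatorname{vert}(\mathcal{P}_q)=\frac1q\mathbb{Z}^2$.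 Edges parallel to $(-1,1)$ are called diagonal edges. A function $\pi\colon\mathbb{R}^2\to\mathbb{R}$ is continuous piecewise linear over $\mathcal{P}_q$ if it is affine over each triangle of $\mathcal{P}_q$. **Diagonally constrained.** Let $\Delta\pi(x,y)=\pi(x)+\pi(y)-\pi(x+y)$. For $I,J,K\subseteq\mathbb{R}^2$ let $F(I,J,K)=\{(x,y)\in\mathbb{R}^2\times\mathbb{R}^2 : x\in I,\ y\in J,\ x+y\in K\}$, and let $\Delta\mathcal{P}_q=\{F(I,J,K): I,J,K\in\mathcal{P}_q\}$. Let $E(\pi,\mathcal{P}_q)=\{F\in\Delta\mathcal{P}_q : \Delta\pi|_F=0\}$ and let $E_{\max}(\pi,\mathcal{P}_q)$ be the set of inclusion-maximal elements of $E(\pi,\mathcal{P}_q)$. Let $p_1(x,y)=x$, $p_2(x,y)=y$, $p_3(x,y)=x+y$. The function $\pi$ is diagonally constrained if for every $F\in E_{\max}(\pi,\mathcal{P}_q)$ and each $i=1,2,3$, $p_i(F)$ is a vertex, a diagonal edge, or a triangle of $\mathcal{P}_q$ (i.e., not a horizontal or vertical edge). **Input and computation model.** A minimal valid function for $R_f(\mathbb{R}^2,\mathbb{Z}^2)$ is periodic modulo $\mathbb{Z}^2$, so $\pi$ is uniquely determined by its finitely many real values on $\frac1q\mathbb{Z}^2\cap[0,1)^2$, and is given by these values. Elementary operations over the reals are arithmetic operations and comparisons of real numbers, each counted as one step. *)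

(* Defs.v *)
From HB Require Import structures.
From mathcomp Require Import all_boot all_order all_algebra.
From mathcomp Require Import all_classical all_reals all_analysis.

Set Implicit Arguments.
Unset Strict Implicit.
Unset Printing Implicit Defensive.

Import Order.TTheory GRing.Theory Num.Theory.

Local Open Scope classical_set_scope.
Local Open Scope ring_scope.

Definition convex_hull (R : realType) (E : lmodType R) (A : set E) : set E :=
  smallest (@convex_set R E) A.

(* The group problem. Sums over the whole group are finitely supported sums:
   every element of [group_problem S f] has finite support. *)
Section GroupProblem.
Context {R : realType} {G : zmodType}.
Implicit Types (S : set G) (f : G) (pi : G -> R).

Definition feasible S f : set (G -> nat) :=
  [set s | finite_set [set r | s r != 0%N] /\
           exists2 y, S y & \sum_(r \in [set: G]) r *+ s r = f + y].

Definition group_problem S f : set (G -> R^o) :=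
  convex_hull [set (fun r => (s r)%:R) | s in feasible S f].

Definition valid S f pi : Prop :=
  (forall r, 0 <= pi r) /\
  (forall s, group_problem S f s -> 1 <= \sum_(r \in [set: G]) pi r * s r).

Definition minimal S f pi : Prop :=
  valid S f pi /\
  ~ exists pi', [/\ valid S f pi', pi' <> pi & forall r, pi' r <= pi r].

Definition extreme S f pi : Prop :=
  valid S f pi /\
  forall pi1 pi2, valid S f pi1 -> valid S f pi2 ->
    (forall r, pi r = 2^-1 * (pi1 r + pi2 r)) -> pi = pi1 /\ pi = pi2.

End GroupProblem.

Notation plane R := (R^o * R^o)%type.

Section Complex.
Context {R : realType}.
Implicit Types (q : nat) (z d : int * int) (I J K : set (plane R)).

Definition Z2 : set (plane R) :=
  [set x | x.1 \is a Num.int /\ x.2 \is a Num.int].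

Definition gridpt q z : plane R := (z.1%:~R / q%:R, z.2%:~R / q%:R).

Definition vert q : set (plane R) := range (gridpt q).

Definition is_vertex q I : Prop := exists z, I = [set gridpt q z].

Definition is_edge_along q d I : Prop :=
  exists z, I = convex_hull [set gridpt q z; gridpt q (z + d)].

Definition is_diagonal q I : Prop := is_edge_along q (-1, 1) I.

Definition is_edge q I : Prop :=
  [\/ is_edge_along q (1, 0) I, is_edge_along q (0, 1) I | is_diagonal q I].

Definition is_triangle q I : Prop :=
  exists z,
    I = convex_hull [set gridpt q z; gridpt q (z + (1, 0));
                         gridpt q (z + (0, 1))] \/
    I = convex_hull [set gridpt q (z + (1, 0)); gridpt q (z + (0, 1));
                         gridpt q (z + (1, 1))].

Definition triangulation q : set (set (plane R)) :=
  [set I | [\/ I = set0, is_vertex q I, is_edge q I | is_triangle q I]].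

Definition pwl q (pi : plane R -> R) : Prop :=
  forall T, is_triangle q T ->
    exists a b c : R, forall x, T x -> pi x = a * x.1 + b * x.2 + c.

Definition Delta (pi : plane R -> R) (xy : plane R * plane R) : R :=
  pi xy.1 + pi xy.2 - pi (xy.1 + xy.2).

Definition Fset I J K : set (plane R * plane R) :=
  [set xy | [/\ I xy.1, J xy.2 & K (xy.1 + xy.2)]].

Definition DeltaP q : set (set (plane R * plane R)) :=
  [set F | exists I J K, [/\ triangulation q I, triangulation q J,
                             triangulation q K & F = Fset I J K]].

Definition additive_faces q (pi : plane R -> R) :
    set (set (plane R * plane R)) :=
  [set F | DeltaP q F /\ forall xy, F xy -> Delta pi xy = 0].

Definition max_additive_faces q (pi : plane R -> R) :
    set (set (plane R * plane R)) :=
  [set F | additive_faces q pi F /\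
           forall F', additive_faces q pi F' -> F `<=` F' -> F' = F].

Definition vertex_diagonal_or_triangle q I : Prop :=
  [\/ is_vertex q I, is_diagonal q I | is_triangle q I].

Definition diagonally_constrained q (pi : plane R -> R) : Prop :=
  forall F, max_additive_faces q pi F ->
    [/\ vertex_diagonal_or_triangle q [set xy.1 | xy in F],
        vertex_diagonal_or_triangle q [set xy.2 | xy in F] &
        vertex_diagonal_or_triangle q [set xy.1 + xy.2 | xy in F]].

End Complex.

(* A real random access machine, as a structured imperative language with two
   indirectly addressable memories, one of naturals (for indices) and one of
   reals. A program contains no real constants other than naturals, so it
   cannot carry non-uniform advice, and there is no integer division or
   rounding. Subtraction of naturals is truncated, and division of reals by
   zero yields zero. *)
Inductive iexpr :=
  | ICell of iexpr
  | ICst of nat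
  | IAdd of iexpr & iexpr
  | ISub of iexpr & iexpr
  | IMul of iexpr & iexpr.

Inductive rexpr :=
  | RCell of iexpr
  | RCst of nat
  | RAdd of rexpr & rexpr
  | RSub of rexpr & rexpr
  | RMul of rexpr & rexpr
  | RDiv of rexpr & rexpr.

Inductive bexpr :=
  | BIle of iexpr & iexpr
  | BRle of rexpr & rexpr
  | BNot of bexpr
  | BAnd of bexpr & bexpr.

Inductive cmd :=
  | Skip
  | ISet of iexpr & iexpr
  | RSet of iexpr & rexpr
  | Seq of cmd & cmd
  | If of bexpr & cmd & cmd
  | While of bexpr & cmd.

(* Every operation, constant and memory access costs one step, including those
   on indices, so that costs bound in particular the operations on reals. *)
Fixpoint icost (e : iexpr) : nat :=
  match e with
  | ICell a => (icost a).+1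
  | ICst _ => 1
  | IAdd a b | ISub a b | IMul a b => (icost a + icost b).+1
  end.

Fixpoint rcost (e : rexpr) : nat :=
  match e with
  | RCell a => (icost a).+1
  | RCst _ => 1
  | RAdd a b | RSub a b | RMul a b | RDiv a b => (rcost a + rcost b).+1
  end.

Fixpoint bcost (e : bexpr) : nat :=
  match e with
  | BIle a b => (icost a + icost b).+1
  | BRle a b => (rcost a + rcost b).+1
  | BNot a => (bcost a).+1
  | BAnd a b => (bcost a + bcost b).+1
  end.

Section Machine.
Context {R : realType}.

Record state := State { imem : nat -> nat; rmem : nat -> R }.

Definition upd {T : Type} (m : nat -> T) (k : nat) (v : T) : nat -> T :=
  fun j => if j == k then v else m j.

Fixpoint ieval (s : state) (e : iexpr) : nat :=
  match e with
  | ICell a => imem s (ieval s a)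
  | ICst n => n
  | IAdd a b => (ieval s a + ieval s b)%N
  | ISub a b => (ieval s a - ieval s b)%N
  | IMul a b => (ieval s a * ieval s b)%N
  end.

Fixpoint reval (s : state) (e : rexpr) : R :=
  match e with
  | RCell a => rmem s (ieval s a)
  | RCst n => n%:R
  | RAdd a b => reval s a + reval s b
  | RSub a b => reval s a - reval s b
  | RMul a b => reval s a * reval s b
  | RDiv a b => reval s a / reval s b
  end.

Fixpoint beval (s : state) (e : bexpr) : bool :=
  match e with
  | BIle a b => (ieval s a <= ieval s b)%N
  | BRle a b => reval s a <= reval s b
  | BNot a => ~~ beval s a
  | BAnd a b => beval s a && beval s b
  end.

(* [exec c s t s']: started in [s], [c] halts in [s'] after [t] steps. *)
Inductive exec : cmd -> state -> nat -> state -> Prop :=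
  | exec_skip s : exec Skip s 1 s
  | exec_iset s a e :
      exec (ISet a e) s (icost a + icost e).+1
        (State (upd (imem s) (ieval s a) (ieval s e)) (rmem s))
  | exec_rset s a e :
      exec (RSet a e) s (icost a + rcost e).+1
        (State (imem s) (upd (rmem s) (ieval s a) (reval s e)))
  | exec_seq c1 c2 s t1 s1 t2 s2 :
      exec c1 s t1 s1 -> exec c2 s1 t2 s2 -> exec (Seq c1 c2) s (t1 + t2) s2
  | exec_if b c1 c2 s t s' :
      exec (if beval s b then c1 else c2) s t s' ->
      exec (If b c1 c2) s (bcost b + t).+1 s'
  | exec_while_false b c s :
      ~~ beval s b -> exec (While b c) s (bcost b).+1 s
  | exec_while_true b c s t1 s1 t2 s2 :
      beval s b -> exec c s t1 s1 -> exec (While b c) s1 t2 s2 ->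
      exec (While b c) s (bcost b + t1 + t2).+1 s2.

Lemma exec_deterministic c s t1 s1 t2 s2 :
  exec c s t1 s1 -> exec c s t2 s2 -> t1 = t2 /\ s1 = s2.
Proof.
move=> H; elim: H t2 s2 => {c s t1 s1}
  [s|s a e|s a e|c1 c2 s t1 s1 t2 s2 _ IH1 _ IH2|b c1 c2 s t s' _ IH
  |b c s nb|b c s t1 s1 t2 s2 hb _ IH1 _ IH2] u v H; inversion H; subst => //.
- match goal with h1 : exec c1 _ _ _, h2 : exec c2 _ _ _ |- _ =>
    have [? ?] := IH1 _ _ h1; subst; by have [-> ->] := IH2 _ _ h2 end.
- match goal with h : exec (if _ then _ else _) _ _ _ |- _ =>
    by have [-> ->] := IH _ _ h end.
- match goal with h : is_true (beval _ _) |- _ => by rewrite h in nb end.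
- match goal with h : is_true (~~ beval _ _) |- _ => by rewrite hb in h end.
- match goal with h1 : exec c _ _ _, h2 : exec (While _ _) _ _ _ |- _ =>
    have [? ?] := IH1 _ _ h1; subst; by have [-> ->] := IH2 _ _ h2 end.
Qed.

(* The integer memory holds [q] in cell 0; the real memory holds the two
   coordinates of [f] in cells 0 and 1, and [pi (i / q, j / q)], for
   [i, j < q], in cell [2 + i * q + j]. All other cells are zero. *)
Definition input (q : nat) (f : plane R) (pi : plane R -> R) : state :=
  State
    (fun k => if k == 0%N then q else 0%N)
    (fun k => if k == 0%N then f.1
              else if k == 1%N then f.2
              else if (k - 2 < q * q)%N
              then pi (gridpt q (Posz ((k - 2) %/ q), Posz ((k - 2) %% q)))
              else 0).

Definition accepting (s : state) : Prop := imem s 0 <> 0%N.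

End Machine.

(* Main.v *)
(** Call phi a grid solution if it is a nonzero periodic function on the grid
    (1/3q) Z^2 that vanishes at f and is additive at every pair of grid points
    where pi is. Then pi is extreme if and only if it has no grid solution.

    A grid solution phi is interpolated linearly over P_(3q). For small c the
    functions pi + c phi and pi - c phi are valid: a function that is affine on
    the triangles is subadditive once it is so on the vertices.

    Conversely let pi = (pi1 + pi2) / 2 be not extreme. Then h = pi1 - pi is
    Lipschitz, antisymmetric under x -> f - x, and additive on the additive
    faces of pi. If h is nonzero at some vertex of P_q, it restricts to a grid
    solution. Otherwise consider a maximal additive face F(I,J,K). If one of
    I, J, K is a vertex, then h is the same on the other two up to a translation
    or a reflection. If they are triangles, or if one is a diagonal edge and no
    one a vertex, then h is constant along (-1,1) on each of them; if they are
    triangles, h even vanishes there. Suppose h is not constant along (-1,1) on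
    some triangle T, so that h p <> h p' for some p, p' in T on a line parallel
    to (-1,1). Then h p - h p', with p and p' transported to every triangle, is
    a grid solution when placed at the barycentres. If h is constant along
    (-1,1) on all triangles, then h x = psi (x1 + x2) and psi (k/q + s) <> 0 for
    some k and 0 < s < 1/q; moving the values of psi at k/q + s and at
    (k + 1)/q - s to k/q + 1/3q and k/q + 2/3q, for all k, gives a grid solution.

    The grid solutions together with 0 are the solutions of polynomially many
    linear equations in 9 q^2 unknowns. If phi is periodic and additive where pi
    is, it vanishes at f if and only if it vanishes wherever pi = 1, so f need
    not be known. Elimination keeps a spanning list of 9 q^2 vectors, at first
    the standard basis, and moves it into the kernel of one equation after the
    other. *)

(* The factor 3 comes from two needs. Every triangle must have a grid point in its interior, to
   carry a value of its own; its barycentre is the coarsest choice. And a profile in x1 + x2 needs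
   two free positions between consecutive multiples of 1/q, since x -> f - x exchanges s and 1/q -
   s. The perturbation h is merely Lipschitz, so no finite set of its values determines it. What an
   additive face yields is an increment along a direction d that is the same for all short steps in
   the three projections; as h vanishes at the vertices, an edge in direction d forces this
   increment to be negligible. The hypothesis that no projection is a horizontal or vertical edge
   ensures that a face without a vertex has room for steps along (-1,1) in all three projections.
   Subadditivity passes from the vertices to the plane because [Delta] is affine on each F(I,J,K)
   and the extreme points of F(I,J,K) are grid points: the bounds on x, y and x + y in the three
   directions are those of a 3 x 3 transportation problem. *)
Require Import Defs.
From mathcomp Require Import all_boot all_order all_algebra.
From mathcomp Require Import all_classical all_reals all_analysis.
From mathcomp Require Import ring lra zify.

Set Implicit Arguments.
Unset Strict Implicit.
Unset Printing Implicit Defensive.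

Import Order.TTheory GRing.Theory Num.Theory.

Local Open Scope classical_set_scope.
Local Open Scope ring_scope.

(** * Valid and minimal functions *)

Section ConvexHull.
Context {R : realType} {E : lmodType R}.
Implicit Types A C : set E.

Lemma convex_setP C :
  @convex_set R E C <->
  forall x y (t : R), 0 <= t -> t <= 1 -> C x -> C y ->
    C (t *: x + (1 - t) *: y).
Proof.
split=> [cC x y t t0 t1 Cx Cy|cC x y t /set_mem Cx /set_mem Cy].
  by have /set_mem := cC x y (Itv01 t0 t1) (mem_set Cx) (mem_set Cy).
by apply/mem_set; apply: cC.
Qed.

Lemma sub_convex_hull A : A `<=` convex_hull A.
Proof. exact: sub_gen_smallest. Qed.

Lemma convex_hull_min A C : @convex_set R E C -> A `<=` C -> convex_hull A `<=` C.
Proof. exact: smallest_sub. Qed.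

Lemma convex_hull_convex A x y (t : R) : 0 <= t -> t <= 1 ->
  convex_hull A x -> convex_hull A y -> convex_hull A (t *: x + (1 - t) *: y).
Proof.
move=> t0 t1 Ax Ay C [cC AC].
by apply: (convex_setP C).1 => //; [exact: Ax|exact: Ay].
Qed.

End ConvexHull.

Section GroupProblemTheory.
Context {R : realType} {G : zmodType}.
Implicit Types (S : set G) (f : G) (pi : G -> R) (l : seq G).

(* Finitely supported multiplicity functions are traded for sequences, in
   which the exchange arguments are elementary. *)
Lemma sum_of_multiplicity (V : zmodType) (s : G -> nat) (F : G -> V) :
    finite_set [set r | s r != 0%N] ->
  exists l, \sum_(r \in [set: G]) F r *+ s r = \sum_(r <- l) F r /\
            \sum_(r \in [set: G]) r *+ s r = \sum_(r <- l) r.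
Proof.
move=> /finite_seqP[e0 e0P]; set e := undup e0.
have ue : uniq e by exact: undup_uniq.
have eP r : r \notin e -> s r = 0%N.
  rewrite mem_undup => re; apply/eqP/negPn/negP => sr.
  by have : [set` e0] r by [rewrite -e0P]; rewrite /= (negPf re).
have fsE (W : zmodType) (H : G -> W) :
    \sum_(r \in [set: G]) H r *+ s r = \sum_(r <- e) H r *+ s r.
  rewrite (fsbigE e) //; last by move=> r _ /eP ->.
  by apply: eq_bigl => r; rewrite in_setT.
exists (flatten [seq nseq (s r) r | r <- e]); rewrite !fsE.
by split; rewrite big_flatten big_map; apply: eq_bigr => r _;
  rewrite big_nseq iter_addr addr0.
Qed.

Lemma sum_count_mem (V : zmodType) l (F : G -> V) :
  \sum_(r \in [set: G]) F r *+ count_mem r l = \sum_(r <- l) F r.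
Proof.
rewrite (fsbigE (undup l)) ?undup_uniq //; last first.
  by move=> r _; rewrite mem_undup => /count_memPn ->.
under eq_bigl do rewrite in_setT.
rewrite -[RHS]big_undup_iterop_count; apply: eq_bigr => r _.
by rewrite Monoid.iteropE iter_addr addr0.
Qed.

Lemma count_mem_finite l : finite_set [set r | count_mem r l != 0%N].
Proof.
apply: (@sub_finite_set _ _ [set` l]); last exact: finite_seq.
by move=> r /=; rewrite -lt0n -has_count has_pred1.
Qed.

(** A linear inequality survives convex combinations, so it suffices to test it on the generators of
    the hull. *)
Lemma validP S f pi :
  valid S f pi <->
  (forall r, 0 <= pi r) /\
  (forall l, (exists2 y, S y & \sum_(r <- l) r = f + y) ->
     1 <= \sum_(r <- l) pi r).
Proof.
split=> -[pi0 H]; split=> //.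
  move=> l Sl; have := H (fun r => (count_mem r l)%:R).
  under eq_fsbigr do rewrite mulr_natr; rewrite sum_count_mem; apply.
  apply: sub_convex_hull; exists (fun r => count_mem r l) => //.
  by split; [exact: count_mem_finite|rewrite sum_count_mem].
(* Finite support is part of the convex set: a sum with infinite support has a default value, and
   the sum would not be linear in s. *)
move=> s Ss; pose C : set (G -> R^o) := [set s |
  finite_set [set r | s r != 0] /\ 1 <= \sum_(r \in [set: G]) pi r * s r].
suff : C s by case.
apply: convex_hull_min Ss; last first.
  move=> _ [t [tfin tS] <-]; split.
    apply: sub_finite_set tfin => r /=.
    by apply: contraNN => /eqP ->.
  have [l [lE lE']] := sum_of_multiplicity pi tfin.
  under eq_fsbigr do rewrite mulr_natr.
  by rewrite lE; apply: H; rewrite -lE'.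
apply/convex_setP => x y t t0 t1 [xf x1] [yf y1].
have [e0 e0P] : exists e0 : seq G,
    [set r | x r != 0] `|` [set r | y r != 0] = [set` e0].
  by apply/finite_seqP; rewrite finite_setU.
set e := undup e0.
have fsE (z : G -> R^o) : (forall r, x r = 0 -> y r = 0 -> z r = 0) ->
    \sum_(r \in [set: G]) pi r * z r = \sum_(r <- e) pi r * z r.
  move=> z0; rewrite (fsbigE e) ?undup_uniq // => [|r _].
    by apply: eq_bigl => r; rewrite in_setT.
  rewrite mem_undup => re; rewrite z0 ?mulr0 //; apply/eqP/negPn/negP => nz.
    by have : [set` e0] r; [rewrite -e0P; left|rewrite /= (negPf re)].
  by have : [set` e0] r; [rewrite -e0P; right|rewrite /= (negPf re)].
have zE r : (t *: x + (1 - t) *: y) r = t * x r + (1 - t) * y r by [].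
split.
  apply: (@sub_finite_set _ _ [set` e0]); last exact: finite_seq.
  rewrite -e0P => r /= zr; have [xr|] := eqVneq (x r) 0; last by left.
  right; apply: contraNneq zr => yr.
  by rewrite zE xr yr !mulr0 addr0.
rewrite fsE => [|r xr yr]; last by rewrite zE xr yr !mulr0 addr0.
have -> : \sum_(r <- e) pi r * (t *: x + (1 - t) *: y) r =
    t * \sum_(r <- e) pi r * x r + (1 - t) * \sum_(r <- e) pi r * y r.
  rewrite !mulr_sumr -big_split; apply: eq_bigr => r _ /=.
  by rewrite zE; ring.
by rewrite fsE // in x1; rewrite fsE // in y1; nra.
Qed.

Lemma subadditive_sum pi l : pi 0 = 0 ->
  (forall x y, pi (x + y) <= pi x + pi y) ->
  pi (\sum_(r <- l) r) <= \sum_(r <- l) pi r.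
Proof.
move=> pi0 pisub; elim: l => [|x l IH]; first by rewrite !big_nil pi0.
by rewrite !big_cons (le_trans (pisub _ _)) // lerD2l.
Qed.

Lemma subadditive_valid S f pi : (forall r, 0 <= pi r) -> pi 0 = 0 ->
  (forall x y, pi (x + y) <= pi x + pi y) ->
  (forall y, S y -> 1 <= pi (f + y)) -> valid S f pi.
Proof.
move=> pige0 pi0 pisub pif; apply/validP; split=> // l [y Sy lE].
by rewrite (le_trans (pif y Sy)) // -lE subadditive_sum.
Qed.

Lemma minimal_eq S f pi pi' : minimal S f pi -> valid S f pi' ->
  (forall r, pi' r <= pi r) -> pi' = pi.
Proof. by move=> [_ H] v le; apply: contrapT => ne; apply: H; exists pi'. Qed.

Section Minimal.
Variables (S : set G) (f : G) (pi : G -> R).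
Hypothesis (S0 : S 0) (SD : forall x y, S x -> S y -> S (x + y)).
Hypothesis (SN : forall x, S x -> S (- x)).
Hypothesis pi_min : minimal S f pi.

Lemma minimal_ge0 r : 0 <= pi r. Proof. by case: pi_min => -[]. Qed.

Lemma minimal_sum_ge1 l y : S y -> \sum_(r <- l) r = f + y ->
  1 <= \sum_(r <- l) pi r.
Proof. by case: pi_min => /validP[_ H] _ Sy lE; apply: H; exists y. Qed.

(** Replacing pi by 0 on S keeps it valid: omitting the entries in S from a list changes its sum
    only by an element of S. *)
Lemma minimal_subgroup0 z : S z -> pi z = 0.
Proof.
move=> Sz; pose pi' r := if `[< S r >] then 0 else pi r.
suff /(congr1 (fun p => p z)) : pi' = pi by rewrite /pi' asboolT.
apply: minimal_eq pi_min _ _ => [|r]; last first.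
  by rewrite /pi'; case: ifP; rewrite ?minimal_ge0.
apply/validP; split=> [r|l [y Sy lE]].
  by rewrite /pi'; case: ifP; rewrite ?minimal_ge0.
pose l' := [seq r <- l | ~~ `[< S r >]].
have -> : \sum_(r <- l) pi' r = \sum_(r <- l') pi r.
  by rewrite big_filter [RHS]big_mkcond /=; apply: eq_bigr => r _; rewrite /pi' if_neg.
have [w Sw lw] : exists2 w, S w & \sum_(r <- l) r = \sum_(r <- l') r + w.
  rewrite /l'; elim: l {lE l'} => [|x l [w Sw IH]].
    by exists 0 => //; rewrite !big_nil addr0.
  rewrite big_cons /= IH; case: (boolP `[< S x >]) => /asboolP Sx /=.
    by exists (x + w); [exact: SD|rewrite addrCA].
  by exists w => //; rewrite big_cons addrA.
apply: (@minimal_sum_ge1 l' (y - w)); first by apply: SD => //; exact: SN.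
by rewrite addrA -lE lw addrK.
Qed.

(** Otherwise the value at x + y can be lowered to pi x + pi y, because each entry x + y of a list
    may be split into x and y. *)
Lemma minimal_subadditive x y : pi (x + y) <= pi x + pi y.
Proof.
rewrite leNgt; apply/negP => lt.
pose pi' r := if r == x + y then pi x + pi y else pi r.
suff /(congr1 (fun p => p (x + y))) : pi' = pi.
  by rewrite /pi' eqxx => e; rewrite e ltxx in lt.
apply: minimal_eq pi_min _ _ => [|r]; last first.
  by rewrite /pi'; case: eqP => [->|//]; exact: ltW.
apply/validP; split=> [r|l [w Sw lE]].
  by rewrite /pi'; case: ifP; rewrite ?addr_ge0 ?minimal_ge0.
pose l' := flatten [seq if r == x + y then [:: x; y] else [:: r] | r <- l].
have sumE (V : zmodType) (F : G -> V) : \sum_(r <- l') F r =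
    \sum_(r <- l) if r == x + y then F x + F y else F r.
  rewrite big_flatten big_map; apply: eq_bigr => r _.
  by case: ifP; rewrite !big_cons big_nil /= addr0.
rewrite -sumE; apply: minimal_sum_ge1 Sw _.
by rewrite sumE -lE; apply: eq_bigr => r _; case: eqP.
Qed.

(** If c = pi u + pi (f - u) exceeds 1, the value at u can be divided by c. A list that contains u
    has total at least c, by subadditivity on its other entries, and the change lowers the total at
    most by the factor c. *)
Lemma minimal_symmetric r : pi r + pi (f - r) = 1.
Proof.
have ge1 u : 1 <= pi u + pi (f - u).
  have := @minimal_sum_ge1 [:: u; f - u] 0 S0.
  by rewrite !big_cons !big_nil !addr0 subrKC; apply.
(* The rescaling changes pi only if pi u is positive. If pi r = 0, then pi (f - r) is positive and f
   - r takes the place of r. *)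
suff le1 u : 0 < pi u -> pi u + pi (f - u) <= 1.
  apply/eqP; rewrite eq_le ge1 andbT.
  have [/le1//|r_le0] := ltP 0 (pi r).
  have r0 : pi r = 0 by apply/eqP; rewrite eq_le r_le0 minimal_ge0.
  have := le1 (f - r); rewrite subKr r0 addr0 add0r; apply.
  by have := ge1 r; rewrite r0 add0r; apply: lt_le_trans.
move=> u0; rewrite leNgt; apply/negP => gt1.
set c := pi u + pi (f - u) in gt1.
have c0 : 0 < c by apply: lt_trans gt1.
pose pi' w := if w == u then pi u / c else pi w.
suff /(congr1 (fun p => p u)) : pi' = pi.
  rewrite /pi' eqxx => /eqP; rewrite eq_sym -subr_eq0 => /eqP e.
  have : pi u / c < pi u by rewrite ltr_pdivrMr // ltr_pMr.
  by lra.
have pi'_le w : pi' w <= pi w.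
  rewrite /pi'; case: eqP => [->|//].
  by rewrite ler_pdivrMr // ler_peMr ?minimal_ge0 // ltW.
have pi'_ge w : pi w / c <= pi' w.
  rewrite /pi'; case: eqP => [->//|_].
  by rewrite ler_pdivrMr // ler_peMr ?minimal_ge0 // ltW.
apply: minimal_eq pi_min _ pi'_le.
apply/validP; split=> [w|l [y Sy lE]].
  by apply: le_trans (pi'_ge _); rewrite divr_ge0 ?minimal_ge0 ?ltW.
have [ul|ul] := boolP (u \in l); last first.
  rewrite (eq_big_seq pi); first exact: minimal_sum_ge1 Sy lE.
  by move=> w wl; rewrite /pi'; case: eqP => // e; rewrite -e wl in ul.
apply: (@le_trans _ _ (\sum_(w <- l) pi w / c)); last by apply: ler_sum.
rewrite -mulr_suml ler_pdivlMr // mul1r.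
rewrite (perm_big _ (perm_to_rem ul)) big_cons lerD2l /=.
have : \sum_(w <- rem u l) w = f - u + y.
  apply: (addrI u); rewrite addrA subrKC -lE.
  by rewrite (perm_big _ (perm_to_rem ul)) big_cons.
move=> E; apply: le_trans (subadditive_sum _ _ minimal_subadditive); last first.
  exact: minimal_subgroup0.
rewrite E; have := minimal_subadditive (f - u + y) (- y).
by rewrite addrK (minimal_subgroup0 (SN Sy)) addr0.
Qed.

Lemma minimal_periodic x z : S z -> pi (x + z) = pi x.
Proof.
move=> Sz; apply/eqP; rewrite eq_le; apply/andP; split.
  by rewrite (le_trans (minimal_subadditive _ _)) // (minimal_subgroup0 Sz) addr0.
have := minimal_subadditive (x + z) (- z).
by rewrite addrK (minimal_subgroup0 (SN Sz)) addr0.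
Qed.

(** A valid function below pi1, averaged with pi2, is a valid function below pi. *)
Lemma minimal_half pi1 pi2 : valid S f pi1 -> valid S f pi2 ->
  (forall r, pi r = 2^-1 * (pi1 r + pi2 r)) -> minimal S f pi1.
Proof.
move=> v1 v2 piE; split=> // -[pi' [v' ne le]]; apply: ne.
have : (fun r => 2^-1 * (pi' r + pi2 r)) = pi.
  apply: minimal_eq pi_min _ _ => [|r]; last first.
    by rewrite piE ler_pM2l ?lerD2r ?invr_gt0.
  move: v' v2 => /validP[v'0 v'1] /validP[v20 v21].
  apply/validP; split=> [r|l Sl]; first by rewrite mulr_ge0 ?invr_ge0 ?addr_ge0.
  rewrite -mulr_sumr big_split /=.
  by have := v'1 l Sl; have := v21 l Sl; lra.
move=> E; apply/funext => r; have := congr1 (fun p => p r) E.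
by rewrite /= piE; lra.
Qed.

End Minimal.
End GroupProblemTheory.

(** * Additivity on a face forces constancy along lines *)

Section ConstantAlong.
Context {R : realType}.
Implicit Types (x y u t : R) (X : R -> R -> Prop).

Lemma arithmetic_progression (F : nat -> R) (A : R) (m : nat) :
  (forall k, (k < m)%N -> F k.+1 = F k + A) -> F m = F 0%N + m%:R * A.
Proof.
elim: m => [|m IH] H; first by rewrite mul0r addr0.
rewrite H // IH => [|k km]; last by apply: H; exact: ltnW.
by rewrite -[m.+1]addn1 natrD; ring.
Qed.

Lemma locally_constant_segment (T : Type) (F : R -> T) (e : R) : 0 < e ->
  (forall s d, 0 <= s -> 0 <= d <= e -> s + d <= 1 -> F (s + d) = F s) ->
  forall s, 0 <= s <= 1 -> F s = F 0.
Proof.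
move=> e0 H s /andP[s0 s1].
pose n := (Num.truncn (s / e)).+1.
have n0 : (0 : R) < n%:R by rewrite ltr0n.
have sn : s / n%:R <= e.
  rewrite ler_pdivrMr // mulrC -ler_pdivrMr //.
  by apply/ltW/truncnS_gt; rewrite ?divr_ge0 // ltW.
suff K k : (k <= n)%N -> F (k%:R * (s / n%:R)) = F 0.
  by rewrite -(K n) //; congr F; field; rewrite gt_eqF.
elim: k => [|k IH] kn; first by rewrite mul0r.
have kn' : (k.+1)%:R <= n%:R :> R by rewrite ler_nat.
have sn0 : 0 <= s / n%:R by rewrite divr_ge0 // ltW.
rewrite -IH; last exact: ltnW.
rewrite -[k.+1]addn1 natrD mulrDl mul1r; apply: H.
- by rewrite mulr_ge0.
- by rewrite sn0.
rewrite -[X in _ + X]mul1r -mulrDl -(natrD _ k 1) addn1.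
apply: le_trans s1; rewrite mulrA ler_pdivrMr // mulrC.
by rewrite ler_wpM2l.
Qed.

Lemma vanishing_bound (a C : R) (n0 : R) :
  (forall n : nat, n0 <= n%:R -> `|a| <= C / n%:R) -> a = 0.
Proof.
move=> H; apply/eqP; rewrite -normr_eq0 eq_le normr_ge0 andbT leNgt.
apply/negP => a0.
pose m := Num.max (Num.max n0 1) (C / `|a|).
pose n := (Num.truncn m).+1.
have m0 : 0 <= m by rewrite !le_max ler01 orbT.
have mn : m < n%:R by apply: truncnS_gt.
have n0n : n0 <= n%:R.
  by apply: ltW; apply: le_lt_trans mn; rewrite !le_max lexx.
have np : (0 : R) < n%:R by rewrite ltr0n.
have := H n n0n; apply/negP; rewrite -ltNge ltr_pdivrMr // mulrC -ltr_pdivrMr //.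
by apply: le_lt_trans mn; rewrite !le_max lexx orbT.
Qed.

Definition convex2 X := forall x y x' y' t, 0 <= t <= 1 -> X x y -> X x' y' ->
  X (x + t * (x' - x)) (y + t * (y' - y)).

Lemma convex2_segment X x y d1 d2 u s : convex2 X -> 0 <= s <= u ->
  X x y -> X (x + u * d1) (y + u * d2) -> X (x + s * d1) (y + s * d2).
Proof.
move=> cX /andP[s0 su] Xp Xq.
have [u0|u0] := eqVneq u 0.
  by have -> : s = 0; [apply/eqP; rewrite eq_le s0 -u0 su|rewrite !mul0r !addr0].
have up : 0 < u by rewrite lt_neqAle eq_sym u0 (le_trans s0).
have t01 : 0 <= s / u <= 1 by rewrite divr_ge0 ?(ltW up) //= ler_pdivrMr ?mul1r.
have := cX _ _ _ _ _ t01 Xp Xq.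
have -> : x + s / u * (x + u * d1 - x) = x + s * d1 by field.
by have -> : y + s / u * (y + u * d2 - y) = y + s * d2 by field.
Qed.

Definition lipschitz2 (L : R) (g : R -> R -> R) :=
  forall x y x' y', `|g x y - g x' y'| <= L * (`|x - x'| + `|y - y'|).

Variables (g : R -> R -> R) (L d1 d2 : R).
Hypotheses (L0 : 0 <= L) (lipg : lipschitz2 L g).
Hypotheses (d1_le1 : `|d1| <= 1) (d2_le1 : `|d2| <= 1).

(* Contracting towards an interior point by the factor 1 - t, with t of order
   1/n, turns the increments of g over steps of length about 1/n into one and
   the same number A. *)
Lemma small_increments X c1 c2 p1 p2 u t A (n : nat) : convex2 X ->
  0 <= t <= 1 -> (0 < n)%N -> 0 <= u ->
  (forall x y, X x y ->
     g (x + t * (c1 - x) + (1 - t) / n%:R * d1)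
       (y + t * (c2 - y) + (1 - t) / n%:R * d2) =
     g (x + t * (c1 - x)) (y + t * (c2 - y)) + A) ->
  X p1 p2 -> X (p1 + u * d1) (p2 + u * d2) ->
  `|g (p1 + u * d1) (p2 + u * d2) - g p1 p2 -
    (Num.truncn (u * n%:R))%:R * A| <=
  L * (2 * t * (`|c1 - p1| + `|c2 - p2| + u * 2) + 2 / n%:R).
Proof.
move=> cX /andP[t0 t1] n0 u0 step Xp Xq.
have np : (0 : R) < n%:R by rewrite ltr0n.
have ni : (0 : R) < n%:R^-1 by rewrite invr_gt0.
set m := Num.truncn _.
have [mu um] : m%:R <= u * n%:R /\ u * n%:R < m%:R + 1.
  have un0 : 0 <= u * n%:R by rewrite mulr_ge0 // ltW.
  split; first by rewrite /m; have := truncn_itv un0; case/andP.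
  by rewrite -[1]/(1%:R) -natrD addn1; have := truncn_itv un0; case/andP.
pose w k : R := k%:R / n%:R.
have w0 k : 0 <= w k by rewrite divr_ge0 // ltW.
have wu k : (k <= m)%N -> w k <= u.
  move=> km; rewrite ler_pdivrMr //; apply: le_trans mu.
  by rewrite ler_nat.
(* The points p + (k / n) d, once contracted, are (1 - t) / n apart along d, so their values form an
   arithmetic progression with difference A. *)
pose F (k : nat) := g (p1 + w k * d1 + t * (c1 - (p1 + w k * d1)))
                      (p2 + w k * d2 + t * (c2 - (p2 + w k * d2))).
have FS : F m = F 0%N + m%:R * A.
  apply: arithmetic_progression => k km; rewrite /F.
  have Xk : X (p1 + w k * d1) (p2 + w k * d2).
    by apply: (convex2_segment cX _ Xp Xq); rewrite w0 wu // ltnW.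
  rewrite -(step _ _ Xk); congr (g _ _); rewrite /w -[k.+1]addn1 natrD;
    by field; rewrite gt_eqF.
have F0 : F 0%N = g (p1 + t * (c1 - p1)) (p2 + t * (c2 - p2)).
  by rewrite /F /w !mul0r !addr0.
rewrite F0 /F in FS.
have mun : 0 <= u - w m <= n%:R^-1.
  rewrite subr_ge0 wu //= lerBlDr -[X in X + _]mul1r -mulrDl.
  by rewrite ler_pdivlMr // addrC ltW.
have wm := wu m (leqnn _); have wm0 := w0 m.
set wm' := w m in FS mun wm wm0; clearbody wm'.
have B1 := lipg (p1 + t * (c1 - p1)) (p2 + t * (c2 - p2)) p1 p2.
have B2 := lipg (p1 + u * d1) (p2 + u * d2)
  (p1 + wm' * d1 + t * (c1 - (p1 + wm' * d1)))
  (p2 + wm' * d2 + t * (c2 - (p2 + wm' * d2))).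
have E1 : p1 + t * (c1 - p1) - p1 = t * (c1 - p1) by ring.
have E2 : p2 + t * (c2 - p2) - p2 = t * (c2 - p2) by ring.
rewrite E1 E2 !normrM (ger0_norm t0) in B1.
have D (p d c : R) : `|d| <= 1 ->
  `|p + u * d - (p + wm' * d + t * (c - (p + wm' * d)))| <=
    n%:R^-1 + t * (`|c - p| + u).
  move=> d_le1.
  have -> : p + u * d - (p + wm' * d + t * (c - (p + wm' * d))) =
    (u - wm') * d - t * (c - p) + t * wm' * d by ring.
  case/andP: mun => mun0 mun1.
  have H1 : `|(u - wm') * d| <= n%:R^-1.
    by rewrite normrM (ger0_norm mun0) -[leRHS]mulr1 ler_pM.
  have H2 : `|t * (c - p)| = t * `|c - p| by rewrite normrM (ger0_norm t0).
  have H3 : `|t * wm' * d| <= t * u.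
    rewrite !normrM (ger0_norm t0) (ger0_norm wm0) -mulrA ler_wpM2l //.
    by rewrite -[leRHS]mulr1 ler_pM.
  apply: le_trans (ler_normD _ _) _; rewrite [t * (_ + u)]mulrDr addrA.
  apply: lerD => //.
  by apply: le_trans (ler_normB _ _) _; rewrite H2 lerD2r.
have {}B2 := le_trans B2 (ler_wpM2l L0 (lerD (D p1 d1 c1 d1_le1) (D p2 d2 c2 d2_le1))).
rewrite FS in B2.
have -> : g (p1 + u * d1) (p2 + u * d2) - g p1 p2 - m%:R * A =
  (g (p1 + u * d1) (p2 + u * d2) -
     (g (p1 + t * (c1 - p1)) (p2 + t * (c2 - p2)) + m%:R * A)) +
  (g (p1 + t * (c1 - p1)) (p2 + t * (c2 - p2)) - g p1 p2) by ring.
apply: le_trans (ler_normD _ _) _; apply: le_trans (lerD B2 B1) _.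
have tu0 : 0 <= t * u by rewrite mulr_ge0.
by rewrite -mulrDr; apply: ler_wpM2l => //; lra.
Qed.

Variables (I J K : R -> R -> Prop).
Hypotheses (cI : convex2 I) (cJ : convex2 J) (cK : convex2 K).
Hypothesis ontoI : forall x1 x2, I x1 x2 ->
  exists y1 y2, J y1 y2 /\ K (x1 + y1) (x2 + y2).
Hypothesis ontoJ : forall y1 y2, J y1 y2 ->
  exists x1 x2, I x1 x2 /\ K (x1 + y1) (x2 + y2).
Hypothesis ontoK : forall z1 z2, K z1 z2 ->
  exists x1 x2, I x1 x2 /\ J (z1 - x1) (z2 - x2).
Hypothesis addg : forall x1 x2 y1 y2, I x1 x2 -> J y1 y2 ->
  K (x1 + y1) (x2 + y2) -> g x1 x2 + g y1 y2 = g (x1 + y1) (x2 + y2).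
(** The pair (a, b) serves as a relative interior point of the face with margin r. In K only
    differences of points of I are allowed besides d, since only x is moved while y stays fixed. *)
Variables (a1 a2 b1 b2 r : R).
Hypothesis r0 : 0 < r.
Hypothesis intI : forall x1 x2 x1' x2' l u, I x1 x2 -> I x1' x2' ->
  `|l| <= r -> `|u| <= r ->
  I (a1 + l * (x1' - x1) + u * d1) (a2 + l * (x2' - x2) + u * d2).
Hypothesis intK : forall x1 x2 x1' x2' l u, I x1 x2 -> I x1' x2' ->
  `|l| <= r -> `|u| <= r ->
  K (a1 + b1 + l * (x1' - x1) + u * d1) (a2 + b2 + l * (x2' - x2) + u * d2).
Hypothesis intJ : forall u, `|u| <= r -> J (b1 + u * d1) (b2 + u * d2).

(** Displacing a contracted point by w amounts to displacing the centre by w / t, so the margin at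
    the centre becomes t times that margin everywhere. *)
Lemma contract_mem X c1 c2 x1 x2 t w1 w2 : convex2 X -> 0 < t <= 1 -> X x1 x2 ->
  X (c1 + t^-1 * w1) (c2 + t^-1 * w2) ->
  X (x1 + t * (c1 - x1) + w1) (x2 + t * (c2 - x2) + w2).
Proof.
move=> cX /andP[t0 t1] Xx Xc.
have := cX _ _ _ _ t _ Xx Xc; rewrite (ltW t0) t1 => /(_ isT).
have -> : x1 + t * (c1 + t^-1 * w1 - x1) = x1 + t * (c1 - x1) + w1.
  by field; rewrite gt_eqF.
have -> // : x2 + t * (c2 + t^-1 * w2 - x2) = x2 + t * (c2 - x2) + w2.
by field; rewrite gt_eqF.
Qed.

(* After contraction there is room to move x a short way while y stays fixed, so
   the increment of g over the step h d is locally constant in x, and equal to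
   the increments at y and at x + y. *)
Lemma contracted_increments t h : 0 < t <= 1 -> 0 <= h <= r * t ->
  exists A,
  [/\ forall x y, I x y ->
        g (x + t * (a1 - x) + h * d1) (y + t * (a2 - y) + h * d2) =
        g (x + t * (a1 - x)) (y + t * (a2 - y)) + A,
      forall x y, J x y ->
        g (x + t * (b1 - x) + h * d1) (y + t * (b2 - y) + h * d2) =
        g (x + t * (b1 - x)) (y + t * (b2 - y)) + A &
      forall x y, K x y ->
        g (x + t * (a1 + b1 - x) + h * d1) (y + t * (a2 + b2 - y) + h * d2) =
        g (x + t * (a1 + b1 - x)) (y + t * (a2 + b2 - y)) + A].
Proof.
move=> t01 h0r; have /andP[t0 t1] := t01; have /andP[h0 hr] := h0r.
have ht : `|t^-1 * h| <= r.
  by rewrite ger0_norm ?mulr_ge0 ?invr_ge0 ?(ltW t0) // mulrC ler_pdivrMr.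
have z0 : `|(0 : R)| <= r by rewrite normr0 ltW.
have memI x1 x2 x1' x2' w1 w2 l u : I x1 x2 -> I w1 w2 -> I x1' x2' ->
    `|l| <= r * t -> (u = 0 \/ u = h) ->
    I (x1 + t * (a1 - x1) + (l * (x1' - w1) + u * d1))
      (x2 + t * (a2 - x2) + (l * (x2' - w2) + u * d2)).
  move=> Ix Iw Ix' lr uh; apply: contract_mem => //.
  have lr' : `|t^-1 * l| <= r.
    by rewrite normrM ger0_norm ?invr_ge0 ?(ltW t0) // mulrC ler_pdivrMr.
  have ur : `|t^-1 * u| <= r by case: uh => ->; rewrite ?mulr0.
  by have := intI Iw Ix' lr' ur; congr (I _ _); ring.
have memK z1 z2 x1' x2' w1 w2 l u : K z1 z2 -> I w1 w2 -> I x1' x2' ->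
    `|l| <= r * t -> (u = 0 \/ u = h) ->
    K (z1 + t * (a1 + b1 - z1) + (l * (x1' - w1) + u * d1))
      (z2 + t * (a2 + b2 - z2) + (l * (x2' - w2) + u * d2)).
  move=> Kz Iw Ix' lr uh; apply: contract_mem => //.
  have lr' : `|t^-1 * l| <= r.
    by rewrite normrM ger0_norm ?invr_ge0 ?(ltW t0) // mulrC ler_pdivrMr.
  have ur : `|t^-1 * u| <= r by case: uh => ->; rewrite ?mulr0.
  by have := intK Iw Ix' lr' ur; congr (K _ _); ring.
have memJ y1 y2 u : J y1 y2 -> (u = 0 \/ u = h) ->
    J (y1 + t * (b1 - y1) + u * d1) (y2 + t * (b2 - y2) + u * d2).
  move=> Jy uh; apply: contract_mem => //.
  by rewrite !mulrA; apply: intJ; case: uh => ->; rewrite ?mulr0.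
have rt0 : 0 < r * t by rewrite mulr_gt0.
(* Additivity holds at (x + h d, y) and at (x, y + h d); both pairs have the same sum, so the
   increments at x and at y agree. *)
have incr x1 x2 y1 y2 w1 w2 w1' w2' l : I x1 x2 -> J y1 y2 ->
    K (x1 + y1) (x2 + y2) -> I w1 w2 -> I w1' w2' -> `|l| <= r * t ->
    g (x1 + t * (a1 - x1) + l * (w1' - w1) + h * d1)
      (x2 + t * (a2 - x2) + l * (w2' - w2) + h * d2) -
    g (x1 + t * (a1 - x1) + l * (w1' - w1))
      (x2 + t * (a2 - x2) + l * (w2' - w2)) =
    g (y1 + t * (b1 - y1) + h * d1) (y2 + t * (b2 - y2) + h * d2) -
    g (y1 + t * (b1 - y1)) (y2 + t * (b2 - y2)).
  move=> Ix Jy Kz Iw Iw' lr.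
  have I1 := memI _ _ _ _ _ _ l h Ix Iw Iw' lr (or_intror erefl).
  have I0 := memI _ _ _ _ _ _ l 0 Ix Iw Iw' lr (or_introl erefl).
  have J1 := memJ _ _ h Jy (or_intror erefl).
  have J0 := memJ _ _ 0 Jy (or_introl erefl).
  have K1 := memK _ _ _ _ _ _ l h Kz Iw Iw' lr (or_intror erefl).
  rewrite !mul0r !addr0 in I0 J0; rewrite !addrA in I0 I1 K1.
  have S1 : x1 + t * (a1 - x1) + l * (w1' - w1) + h * d1 +
            (y1 + t * (b1 - y1)) =
    x1 + y1 + t * (a1 + b1 - (x1 + y1)) + l * (w1' - w1) + h * d1 by ring.
  have S2 : x2 + t * (a2 - x2) + l * (w2' - w2) + h * d2 +
            (y2 + t * (b2 - y2)) =
    x2 + y2 + t * (a2 + b2 - (x2 + y2)) + l * (w2' - w2) + h * d2 by ring.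
  have T1 : x1 + t * (a1 - x1) + l * (w1' - w1) +
            (y1 + t * (b1 - y1) + h * d1) =
    x1 + y1 + t * (a1 + b1 - (x1 + y1)) + l * (w1' - w1) + h * d1 by ring.
  have T2 : x2 + t * (a2 - x2) + l * (w2' - w2) +
            (y2 + t * (b2 - y2) + h * d2) =
    x2 + y2 + t * (a2 + b2 - (x2 + y2)) + l * (w2' - w2) + h * d2 by ring.
  have := addg I1 J0; rewrite S1 S2 => /(_ K1).
  have := addg I0 J1; rewrite T1 T2 => /(_ K1).
  by move=> <-; lra.
have incr0 x1 x2 y1 y2 : I x1 x2 -> J y1 y2 -> K (x1 + y1) (x2 + y2) ->
    g (x1 + t * (a1 - x1) + h * d1) (x2 + t * (a2 - x2) + h * d2) -
    g (x1 + t * (a1 - x1)) (x2 + t * (a2 - x2)) =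
    g (y1 + t * (b1 - y1) + h * d1) (y2 + t * (b2 - y2) + h * d2) -
    g (y1 + t * (b1 - y1)) (y2 + t * (b2 - y2)).
  move=> Ix Jy Kz; have := incr _ _ _ _ _ _ _ _ 0 Ix Jy Kz Ix Ix.
  by rewrite !mul0r !addr0 normr0 (ltW rt0); apply.
have incrK x1 x2 y1 y2 : I x1 x2 -> J y1 y2 -> K (x1 + y1) (x2 + y2) ->
    g (x1 + y1 + t * (a1 + b1 - (x1 + y1)) + h * d1)
      (x2 + y2 + t * (a2 + b2 - (x2 + y2)) + h * d2) -
    g (x1 + y1 + t * (a1 + b1 - (x1 + y1)))
      (x2 + y2 + t * (a2 + b2 - (x2 + y2))) =
    g (x1 + t * (a1 - x1) + h * d1) (x2 + t * (a2 - x2) + h * d2) -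
    g (x1 + t * (a1 - x1)) (x2 + t * (a2 - x2)).
  move=> Ix Jy Kz; have zr : `|0 : R| <= r * t by rewrite normr0 ltW.
  have I1 := memI _ _ _ _ _ _ 0 h Ix Ix Ix zr (or_intror erefl).
  have I0 := memI _ _ _ _ _ _ 0 0 Ix Ix Ix zr (or_introl erefl).
  have J0 := memJ _ _ 0 Jy (or_introl erefl).
  have K1 := memK _ _ _ _ _ _ 0 h Kz Ix Ix zr (or_intror erefl).
  have K0 := memK _ _ _ _ _ _ 0 0 Kz Ix Ix zr (or_introl erefl).
  rewrite !mul0r !addr0 ?add0r in I0 I1 J0 K0 K1.
  have S1 : x1 + t * (a1 - x1) + h * d1 + (y1 + t * (b1 - y1)) =
    x1 + y1 + t * (a1 + b1 - (x1 + y1)) + h * d1 by ring.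
  have S2 : x2 + t * (a2 - x2) + h * d2 + (y2 + t * (b2 - y2)) =
    x2 + y2 + t * (a2 + b2 - (x2 + y2)) + h * d2 by ring.
  have T1 : x1 + t * (a1 - x1) + (y1 + t * (b1 - y1)) =
    x1 + y1 + t * (a1 + b1 - (x1 + y1)) by ring.
  have T2 : x2 + t * (a2 - x2) + (y2 + t * (b2 - y2)) =
    x2 + y2 + t * (a2 + b2 - (x2 + y2)) by ring.
  have := addg I1 J0; rewrite S1 S2 => /(_ K1) <-.
  have := addg I0 J0; rewrite T1 T2 => /(_ K0) <-.
  by ring.
(* Along the segment from x to x' there is at each point a partner y in the face; a move of x
   shorter than [r * t] keeps this partner, hence the increment. *)
have same x1 x2 x1' x2' : I x1 x2 -> I x1' x2' ->
    g (x1' + t * (a1 - x1') + h * d1) (x2' + t * (a2 - x2') + h * d2) -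
    g (x1' + t * (a1 - x1')) (x2' + t * (a2 - x2')) =
    g (x1 + t * (a1 - x1) + h * d1) (x2 + t * (a2 - x2) + h * d2) -
    g (x1 + t * (a1 - x1)) (x2 + t * (a2 - x2)).
  move=> Ix Ix'; have [y1 [y2 [Jy Ky]]] := ontoI Ix.
  have [y1' [y2' [Jy' Ky']]] := ontoI Ix'.
  pose X s (x x' a : R) := x + s * (x' - x) + t * (a - (x + s * (x' - x))).
  pose F s := g (X s x1 x1' a1 + h * d1) (X s x2 x2' a2 + h * d2) -
              g (X s x1 x1' a1) (X s x2 x2' a2).
  have := @locally_constant_segment _ F (r * t) rt0 _ 1.
  rewrite ler01 lexx => /(_ _ isT).
  have E (x x' : R) : x + 1 * (x' - x) = x' by ring.
  have E0 (x x' : R) : x + 0 * (x' - x) = x by ring.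
  rewrite /F /X !E !E0; apply=> s d s0 /andP[d0 dr] sd1.
  have s01 : 0 <= s <= 1 by rewrite s0; lra.
  have Is := cI s01 Ix Ix'; have Js := cJ s01 Jy Jy'; have Ks := cK s01 Ky Ky'.
  have Ks' : K (x1 + s * (x1' - x1) + (y1 + s * (y1' - y1)))
               (x2 + s * (x2' - x2) + (y2 + s * (y2' - y2))).
    move: Ks; congr (K _ _); ring.
  have lr : `|(1 - t) * d| <= r * t.
    rewrite ger0_norm; last by rewrite mulr_ge0 // subr_ge0.
    by apply: le_trans dr; rewrite ler_piMl //; lra.
  have := incr _ _ _ _ _ _ _ _ _ Is Js Ks' Ix Ix' lr.
  rewrite -(incr0 _ _ _ _ Is Js Ks') => <-.
  by congr (g _ _ - g _ _); ring.
have [x1 [x2 Ix]] : exists x1 x2, I x1 x2.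
  have := intJ z0; rewrite !mul0r !addr0 => /ontoJ [x1 [x2 [Ix _]]].
  by exists x1, x2.
exists (g (x1 + t * (a1 - x1) + h * d1) (x2 + t * (a2 - x2) + h * d2) -
    g (x1 + t * (a1 - x1)) (x2 + t * (a2 - x2))); split=> [y1 y2 Iy|y1 y2 Jy|z1 z2 Kz].
- by rewrite -(same _ _ _ _ Ix Iy); ring.
- have [w1 [w2 [Iw Kw]]] := ontoJ Jy.
  by rewrite -(same _ _ _ _ Ix Iw) (incr0 _ _ _ _ Iw Jy Kw); ring.
have [w1 [w2 [Iw Jw]]] := ontoK Kz.
rewrite -(same _ _ _ _ Ix Iw).
have Kw : K (w1 + (z1 - w1)) (w2 + (z2 - w2)) by rewrite !subrKC.
by rewrite -(incrK _ _ _ _ Iw Jw Kw) !subrKC; ring.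
Qed.

Variables (v1 v2 : R).
Hypotheses (Iv : I v1 v2) (Iv' : I (v1 + d1) (v2 + d2)).
Hypothesis gv : g (v1 + d1) (v2 + d2) = g v1 v2.

(** From v to v + d there are n steps with common increment A and total change 0, so n A is of order
    1 / n. Another segment of length u has at most u n steps with the same A, so the change along it
    is also of order 1 / n, for every large n. *)
Lemma constant_along :
  [/\ forall x y u, I x y -> I (x + u * d1) (y + u * d2) ->
        g (x + u * d1) (y + u * d2) = g x y,
      forall x y u, J x y -> J (x + u * d1) (y + u * d2) ->
        g (x + u * d1) (y + u * d2) = g x y &
      forall x y u, K x y -> K (x + u * d1) (y + u * d2) ->
        g (x + u * d1) (y + u * d2) = g x y].
Proof.
have gen X c1 c2 : convex2 X ->
    (forall t h, 0 < t <= 1 -> 0 <= h <= r * t -> exists A,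
      (forall x y, I x y ->
        g (x + t * (a1 - x) + h * d1) (y + t * (a2 - y) + h * d2) =
        g (x + t * (a1 - x)) (y + t * (a2 - y)) + A) /\
      (forall x y, X x y ->
        g (x + t * (c1 - x) + h * d1) (y + t * (c2 - y) + h * d2) =
        g (x + t * (c1 - x)) (y + t * (c2 - y)) + A)) ->
    forall x y u, X x y -> X (x + u * d1) (y + u * d2) ->
      g (x + u * d1) (y + u * d2) = g x y.
  move=> cX HA; suff pos x y u : 0 <= u -> X x y -> X (x + u * d1) (y + u * d2) ->
      g (x + u * d1) (y + u * d2) = g x y.
    move=> x y u Xx Xu; have [u0|/ltW u0] := leP 0 u; first exact: pos.
    have E (p d : R) : p = p + u * d + (- u) * d by ring.
    rewrite {2}(E x d1) {2}(E y d2); apply/esym; apply: pos => //.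
      by rewrite oppr_ge0.
    by rewrite -!E.
  move=> u0 Xx Xu; apply/eqP; rewrite -subr_eq0; apply/eqP.
  pose C1 := `|a1 - v1| + `|a2 - v2|; pose C2 := `|c1 - x| + `|c2 - y|.
  pose C := L * (2 * (2 / r) * (C1 + 2) + 2) * u +
            L * (2 * (2 / r) * (C2 + u * 2) + 2).
  apply: (@vanishing_bound _ C (2 / r + 1)) => n n_ge.
  have r2 : 0 < 2 / r by rewrite divr_gt0.
  have np : (0 : R) < n%:R by lra.
  have n0 : (0 < n)%N by rewrite -(ltr0n R).
  (* This makes the margin r t = 2 / n of contracted points cover the step h, while the contraction
     itself costs an error of order 1 / n only. *)
  pose t := 2 / r / n%:R; pose h := (1 - t) / n%:R.
  have t0 : 0 < t by rewrite divr_gt0.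
  have t1 : t <= 1 by rewrite ler_pdivrMr //; lra.
  have h0 : 0 <= h <= r * t.
    rewrite divr_ge0 ?subr_ge0 ?(ltW np) //=.
    have -> : r * t = 2 / n%:R by rewrite /t; field; rewrite !gt_eqF.
    by rewrite ler_pM2r ?invr_gt0 //; lra.
  have t01 : 0 < t <= 1 by rewrite t0.
  have t01' : 0 <= t <= 1 by rewrite ltW.
  have [A [AI AX]] := HA t h t01 h0.
  have Iv1 : I (v1 + 1 * d1) (v2 + 1 * d2) by rewrite !mul1r.
  have B1 := small_increments cI t01' n0 ler01 AI Iv Iv1.
  have B2 := small_increments cX t01' n0 u0 AX Xx Xu.
  rewrite !mul1r gv subrr sub0r normrN (natrK n) in B1.
  set m := Num.truncn _ in B2.
  have mu : m%:R <= u * n%:R.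
    by have /truncn_itv/andP[] : 0 <= u * n%:R by rewrite mulr_ge0 // ltW.
  have B3 : `|m%:R * A| <= u * `|n%:R * A|.
    rewrite !normrM (ger0_norm (ler0n _ m)) (ger0_norm (ltW np)) mulrA.
    by rewrite ler_wpM2r.
  have -> : g (x + u * d1) (y + u * d2) - g x y =
    (g (x + u * d1) (y + u * d2) - g x y - m%:R * A) + m%:R * A by ring.
  apply: le_trans (ler_normD _ _) _; apply: le_trans (lerD B2 B3) _.
  apply: (le_trans (lerD (lexx _) (ler_wpM2l u0 B1))).
  rewrite -/C1 -/C2; suff -> : C / n%:R = L * (2 * t * (C2 + u * 2) + 2 / n%:R) +
    u * (L * (2 * t * (C1 + 2) + 2 / n%:R)) by [].
  by rewrite /C /t; field; rewrite !gt_eqF.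
split.
- apply: gen cI _ => t h t01 h0; have [A [AI _ _]] := contracted_increments t01 h0.
  by exists A; split; [exact: AI|exact: AI].
- apply: gen cJ _ => t h t01 h0; have [A [AI AJ _]] := contracted_increments t01 h0.
  by exists A; split; [exact: AI|exact: AJ].
apply: gen cK _ => t h t01 h0; have [A [AI _ AK]] := contracted_increments t01 h0.
by exists A; split; [exact: AI|exact: AK].
Qed.

End ConstantAlong.

(** * Cells of the triangulation *)

Section Cells.
Context {R : realType}.
Implicit Types (x y t : R) (q : nat) (z : int * int).

Definition scaled q x y : plane R := (x / q%:R, y / q%:R).

Lemma scaledK q (p : plane R) : (0 < q)%N ->
  scaled q (p.1 * q%:R) (p.2 * q%:R) = p.
Proof. by move=> q0; rewrite /scaled !mulfK ?pnatr_eq0 -?lt0n //; case: p. Qed.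

Lemma scaledD q x y x' y' :
  scaled q x y + scaled q x' y' = scaled q (x + x') (y + y').
Proof. by rewrite /scaled !mulrDl. Qed.

Lemma scaled_conv q x y x' y' t :
  t *: scaled q x y + (1 - t) *: scaled q x' y' =
  scaled q (t * x + (1 - t) * x') (t * y + (1 - t) * y').
Proof. by apply: (@f_equal2 _ _ _ pair); rewrite /= /GRing.scale /=; ring. Qed.

Lemma convex_hull2 (E : lmodType R) (a b : E) t : 0 <= t <= 1 ->
  convex_hull [set a; b] (t *: a + (1 - t) *: b).
Proof.
by case/andP=> t0 t1; apply: convex_hull_convex => //; apply: sub_convex_hull;
  [left|right].
Qed.

Lemma convex_hull3 (E : lmodType R) (a b c : E) (s t u : R) :
  0 <= s -> 0 <= t -> 0 <= u -> s + t + u = 1 ->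
  convex_hull [set a; b; c] (s *: a + t *: b + u *: c).
Proof.
move=> s0 t0 u0 stu.
have hC : convex_hull [set a; b; c] c by apply: sub_convex_hull; right.
have [st0|st0] := eqVneq (s + t) 0.
  have [-> ->] : s = 0 /\ t = 0 by split; lra.
  rewrite !scale0r !add0r; have -> : u = 1 by lra.
  by rewrite scale1r.
have st : 0 < s + t by rewrite lt_neqAle eq_sym st0 addr_ge0.
have := @convex_hull_convex R E [set a; b; c] (s / (s + t) *: a + (1 - s / (s + t)) *: b) c (s + t).
rewrite addr_ge0 // scalerDr !scalerA.
have -> : (s + t) * (s / (s + t)) = s by field.
have -> : (s + t) * (1 - s / (s + t)) = t by field.
have -> : 1 - (s + t) = u by lra.
apply=> //; first by lra.
apply: convex_hull_convex.
- by rewrite divr_ge0 // ltW.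
- by rewrite ler_pdivrMr // mul1r lerDl.
- by apply: sub_convex_hull; left; left.
by apply: sub_convex_hull; left; right.
Qed.

(* Every cell of the triangulation is, in coordinates scaled by q, cut out by
   its extent in the three directions x, y and x + y. *)
Definition box (l1 l2 l3 : int) (e1 e2 e3 : bool) x y : Prop :=
  [/\ l1%:~R <= x <= l1%:~R + e1%:R, l2%:~R <= y <= l2%:~R + e2%:R &
      l3%:~R <= x + y <= l3%:~R + e3%:R].

Lemma box_convex2 l1 l2 l3 e1 e2 e3 : convex2 (box l1 l2 l3 e1 e2 e3).
Proof.
move=> x y x' y' t t01 [x1 y1 s1] [x2 y2 s2].
have H (l a b : R) (e : bool) : l <= a <= l + e%:R -> l <= b <= l + e%:R ->
    l <= a + t * (b - a) <= l + e%:R.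
  by move=> la lb; apply/andP; split; nra.
split; [exact: H|exact: H|].
have -> : x + t * (x' - x) + (y + t * (y' - y)) =
  x + y + t * (x' + y' - (x + y)) by ring.
exact: H.
Qed.

Lemma box_convex_set q l1 l2 l3 e1 e2 e3 : (0 < q)%N ->
  @convex_set R _ [set p : plane R | box l1 l2 l3 e1 e2 e3 (p.1 * q%:R) (p.2 * q%:R)].
Proof.
move=> q0; apply/convex_setP => p p' t t0 t1 /= bp bp'.
have t01 : 0 <= 1 - t <= 1 by lra.
have := box_convex2 t01 bp bp'.
by congr (box _ _ _ _ _ _ _ _); rewrite /= /GRing.scale /=; ring.
Qed.

Definition has_shape q (I : set (plane R)) l1 l2 l3 e1 e2 e3 : Prop :=
  forall x y, I (scaled q x y) <-> box l1 l2 l3 e1 e2 e3 x y.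

Lemma has_shape_hull q (A : set (plane R)) l1 l2 l3 e1 e2 e3 : (0 < q)%N ->
  (forall p, A p -> box l1 l2 l3 e1 e2 e3 (p.1 * q%:R) (p.2 * q%:R)) ->
  (forall x y, box l1 l2 l3 e1 e2 e3 x y -> convex_hull A (scaled q x y)) ->
  has_shape q (convex_hull A) l1 l2 l3 e1 e2 e3.
Proof.
move=> q0 AB BA x y; split; last exact: BA.
move=> /(convex_hull_min (@box_convex_set q l1 l2 l3 e1 e2 e3 q0) AB) /=.
by rewrite !divfK // pnatr_eq0 -lt0n.
Qed.

Ltac int_cast :=
  rewrite ?intrD ?intrB ?mulr1z ?mulr0z ?mulrN1z ?mulrNz /=.
Ltac box_lra := rewrite /box /=; int_cast; split; apply/andP; split; lra.

Lemma vertex_shape q z : (0 < q)%N ->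
  has_shape q [set gridpt q z] z.1 z.2 (z.1 + z.2) false false false.
Proof.
move=> q0 x y; have qn : q%:R != 0 :> R by rewrite pnatr_eq0 -lt0n.
split=> [[/(divIf qn) -> /(divIf qn) ->]|]; first by box_lra.
rewrite /box intrD !addr0 => -[x1 y1 _].
have -> : x = z.1%:~R by lra.
by have -> : y = z.2%:~R by lra.
Qed.

Lemma gridpt_scale q z : (0 < q)%N ->
  (@gridpt R q z).1 * q%:R = z.1%:~R /\ (@gridpt R q z).2 * q%:R = z.2%:~R.
Proof. by move=> q0; rewrite /= !divfK // pnatr_eq0 -lt0n. Qed.

Lemma edge_shape q z d (l1 l2 l3 : int) (e1 e2 e3 : bool) : (0 < q)%N ->
  box l1 l2 l3 e1 e2 e3 (z.1%:~R : R) z.2%:~R ->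
  box l1 l2 l3 e1 e2 e3 ((z + d).1%:~R : R) (z + d).2%:~R ->
  (forall x y, box l1 l2 l3 e1 e2 e3 x y -> exists2 t, 0 <= t <= 1 &
     x = t * z.1%:~R + (1 - t) * (z + d).1%:~R /\
     y = t * z.2%:~R + (1 - t) * (z + d).2%:~R) ->
  has_shape q (convex_hull [set gridpt q z; gridpt q (z + d)]) l1 l2 l3 e1 e2 e3.
Proof.
move=> q0 bz bd H; apply: has_shape_hull => // [p|x y /H[t t01 [-> ->]]].
  by case=> ->; rewrite !(gridpt_scale _ q0).1 !(gridpt_scale _ q0).2.
by rewrite -scaled_conv; exact: convex_hull2.
Qed.

Lemma horizontal_shape q z : (0 < q)%N ->
  has_shape q (convex_hull [set gridpt q z; gridpt q (z + (1, 0))])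
    z.1 z.2 (z.1 + z.2) true false true.
Proof.
move=> q0; apply: edge_shape => //; [box_lra|box_lra|].
move=> x y; rewrite /box /=; int_cast => -[x1 y1 s1].
by exists (z.1%:~R + 1 - x); [apply/andP; split; lra|split; lra].
Qed.

Lemma vertical_shape q z : (0 < q)%N ->
  has_shape q (convex_hull [set gridpt q z; gridpt q (z + (0, 1))])
    z.1 z.2 (z.1 + z.2) false true true.
Proof.
move=> q0; apply: edge_shape => //; [box_lra|box_lra|].
move=> x y; rewrite /box /=; int_cast => -[x1 y1 s1].
by exists (z.2%:~R + 1 - y); [apply/andP; split; lra|split; lra].
Qed.

Lemma diagonal_shape q z : (0 < q)%N ->
  has_shape q (convex_hull [set gridpt q z; gridpt q (z + (-1, 1))])
    (z.1 - 1) z.2 (z.1 + z.2) true true false.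
Proof.
move=> q0; apply: edge_shape => //; [box_lra|box_lra|].
move=> x y; rewrite /box /=; int_cast => -[x1 y1 s1].
by exists (z.2%:~R + 1 - y); [apply/andP; split; lra|split; lra].
Qed.

Lemma triangle_shape q (z z1 z2 z3 : int * int) (l3 : int) : (0 < q)%N ->
  (forall w, w \in [:: z1; z2; z3] ->
     box z.1 z.2 l3 true true true (w.1%:~R : R) w.2%:~R) ->
  (forall x y, box z.1 z.2 l3 true true true x y -> exists s t u : R,
     [/\ 0 <= s, 0 <= t, 0 <= u, s + t + u = 1 &
     x = s * z1.1%:~R + t * z2.1%:~R + u * z3.1%:~R /\
     y = s * z1.2%:~R + t * z2.2%:~R + u * z3.2%:~R]) ->
  has_shape q (convex_hull [set gridpt q z1; gridpt q z2; gridpt q z3])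
    z.1 z.2 l3 true true true.
Proof.
move=> q0 Hb H; apply: has_shape_hull => // [p|x y /H[s [t [u [s0 t0 u0 stu [-> ->]]]]]].
  by case=> [[]|] ->; rewrite !(gridpt_scale _ q0).1 !(gridpt_scale _ q0).2;
    apply: Hb; rewrite !inE eqxx ?orbT.
have := @convex_hull3 _ (gridpt q z1) (gridpt q z2) (gridpt q z3) s t u s0 t0 u0 stu.
by congr convex_hull; congr (_, _); rewrite /= /GRing.scale /=; ring.
Qed.

Lemma lower_shape q z : (0 < q)%N ->
  has_shape q (convex_hull [set gridpt q z; gridpt q (z + (1, 0));
                                gridpt q (z + (0, 1))])
    z.1 z.2 (z.1 + z.2) true true true.
Proof.
move=> q0; apply: triangle_shape => //.
  by move=> w; rewrite !inE => /or3P[] /eqP ->; box_lra.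
move=> x y; rewrite /box /=; int_cast => -[x1 y1 s1].
exists (1 - (x - z.1%:~R) - (y - z.2%:~R)), (x - z.1%:~R), (y - z.2%:~R).
by split; [lra|lra|lra|lra|split; ring].
Qed.

Lemma upper_shape q z : (0 < q)%N ->
  has_shape q (convex_hull [set gridpt q (z + (1, 0)); gridpt q (z + (0, 1));
                                gridpt q (z + (1, 1))])
    z.1 z.2 (z.1 + z.2 + 1) true true true.
Proof.
move=> q0; apply: triangle_shape => //.
  by move=> w; rewrite !inE => /or3P[] /eqP ->; box_lra.
move=> x y; rewrite /box /=; int_cast => -[x1 y1 s1].
exists (z.2%:~R + 1 - y), (z.1%:~R + 1 - x), (x - z.1%:~R + (y - z.2%:~R) - 1).
by split; [lra|lra|lra|lra|split; ring].
Qed.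

Variant vdt_shape : int -> int -> int -> bool -> bool -> bool -> Prop :=
  | VertexShape l1 l2 : vdt_shape l1 l2 (l1 + l2) false false false
  | DiagonalShape l1 l2 : vdt_shape l1 l2 (l1 + l2 + 1) true true false
  | LowerShape l1 l2 : vdt_shape l1 l2 (l1 + l2) true true true
  | UpperShape l1 l2 : vdt_shape l1 l2 (l1 + l2 + 1) true true true.

Lemma vertex_diagonal_or_triangle_shape q (I : set (plane R)) : (0 < q)%N ->
  vertex_diagonal_or_triangle q I ->
  exists l1 l2 l3 e1 e2 e3, vdt_shape l1 l2 l3 e1 e2 e3 /\
    has_shape q I l1 l2 l3 e1 e2 e3.
Proof.
move=> q0 [[z ->]|[z ->]|[z [->|->]]].
- by do 6 eexists; split; [exact: VertexShape|exact: vertex_shape].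
- do 6 eexists; split; last exact: diagonal_shape.
  have -> : z.1 + z.2 = z.1 - 1 + z.2 + 1 by ring.
  exact: DiagonalShape.
- by do 6 eexists; split; [exact: LowerShape|exact: lower_shape].
by do 6 eexists; split; [exact: UpperShape|exact: upper_shape].
Qed.

(* The smallest cell containing a point. *)
Definition floor_box x y : R -> R -> Prop :=
  box (Num.floor x) (Num.floor y) (Num.floor (x + y))
      (x != (Num.floor x)%:~R) (y != (Num.floor y)%:~R)
      (x + y != (Num.floor (x + y))%:~R).

Lemma floor_bounds x : (Num.floor x)%:~R <= x < (Num.floor x)%:~R + 1.
Proof. by have := floor_itv x; rewrite intrD. Qed.

Lemma floor_unique x (m : int) : m%:~R <= x < m%:~R + 1 -> Num.floor x = m.
Proof. by move=> mx; apply/floor_def; rewrite intrD. Qed.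

Lemma floor_boxE x y : floor_box x y x y.
Proof.
have H (u : R) : (Num.floor u)%:~R <= u <= (Num.floor u)%:~R + (u != (Num.floor u)%:~R)%:R.
  have := floor_bounds u; case: eqVneq => [|_] /=; last by lra.
  by rewrite addr0 => <-; rewrite lexx.
by split; exact: H.
Qed.

Lemma triangulation_floor_box q x y : (0 < q)%N ->
  exists2 I, triangulation q I &
    forall x' y', I (scaled q x' y') <-> floor_box x y x' y'.
Proof.
move=> q0; rewrite /floor_box.
set m1 := Num.floor x; set m2 := Num.floor y; set m3 := Num.floor (x + y).
have := floor_bounds x; have := floor_bounds y; have := floor_bounds (x + y).
rewrite -/m1 -/m2 -/m3 => b3 b2 b1.
have m3E (m : int) : m%:~R <= x + y < m%:~R + 1 -> m3 = m by exact: floor_unique.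
pose z := (m1, m2).
have [xi|xi] := eqVneq x m1%:~R; have [yi|yi] := eqVneq y m2%:~R.
- have -> : m3 = m1 + m2 by apply: m3E; rewrite xi yi; int_cast; lra.
  have -> : (x + y != (m1 + m2)%:~R) = false by rewrite xi yi intrD eqxx.
  by exists [set gridpt q z]; [by constructor 2; exists z|exact: (vertex_shape z)].
- have -> : m3 = m1 + m2 by apply: m3E; rewrite xi; int_cast; lra.
  have -> : (x + y != (m1 + m2)%:~R) = true.
    by apply: contra yi => /eqP; rewrite xi intrD => ?; apply/eqP; lra.
  exists (convex_hull [set gridpt q z; gridpt q (z + (0, 1))]);
    last exact: (vertical_shape z).
  by constructor 3; constructor 2; exists z.
- have -> : m3 = m1 + m2 by apply: m3E; rewrite yi; int_cast; lra.
  have -> : (x + y != (m1 + m2)%:~R) = true.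
    by apply: contra xi => /eqP; rewrite yi intrD => ?; apply/eqP; lra.
  exists (convex_hull [set gridpt q z; gridpt q (z + (1, 0))]);
    last exact: (horizontal_shape z).
  by constructor 3; constructor 1; exists z.
have xn : m1%:~R < x by rewrite lt_neqAle eq_sym xi; case/andP: b1.
have yn : m2%:~R < y by rewrite lt_neqAle eq_sym yi; case/andP: b2.
have [lt1|gt1|eq1] := ltgtP (x + y) (m1%:~R + m2%:~R + 1).
- have -> : m3 = m1 + m2 by apply: m3E; int_cast; lra.
  have -> : (x + y != (m1 + m2)%:~R) = true by apply/eqP; rewrite intrD; lra.
  exists (convex_hull [set gridpt q z; gridpt q (z + (1, 0));
    gridpt q (z + (0, 1))]); last exact: (lower_shape z).
  by constructor 4; exists z; left.
- have -> : m3 = m1 + m2 + 1 by apply: m3E; int_cast; lra.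
  have -> : (x + y != (m1 + m2 + 1)%:~R) = true.
    by apply/eqP; rewrite !intrD; lra.
  exists (convex_hull [set gridpt q (z + (1, 0)); gridpt q (z + (0, 1));
    gridpt q (z + (1, 1))]); last exact: (upper_shape z).
  by constructor 4; exists z; right.
have -> : m3 = m1 + m2 + 1 by apply: m3E; int_cast; lra.
have -> : (x + y != (m1 + m2 + 1)%:~R) = false.
  by apply/eqP; rewrite !intrD eq1.
exists (convex_hull [set gridpt q (z + (1, 0)); gridpt q (z + (1, 0) + (-1, 1))]).
  by constructor 3; constructor 3; exists (z + (1, 0)).
have := @diagonal_shape q (z + (1, 0)) q0.
have -> : (z + (1, 0)).1 - 1 = m1 by rewrite /= addrK.
have -> : (z + (1, 0)).2 = m2 by rewrite /= addr0.
by have -> : (z + (1, 0)).1 + m2 = m1 + m2 + 1 by rewrite /= addrAC.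
Qed.

Definition cell_affine (g : R -> R -> R) : Prop :=
  forall (a1 a2 : int) (b : bool), exists A B C, forall x y,
    box a1 a2 (a1 + a2 + b%:R) true true true x y -> g x y = A * x + B * y + C.

(** The smallest cell at a point lies in the lower or in the upper triangle of the unit square of
    the point; the diagonal counts as lower. *)
Lemma floor_box_affine (g : R -> R -> R) x y : cell_affine g ->
  exists A B C, forall x' y', floor_box x y x' y' -> g x' y' = A * x' + B * y' + C.
Proof.
move=> ga; have := floor_bounds x; have := floor_bounds y.
have := floor_bounds (x + y); rewrite /floor_box.
set m1 := Num.floor x; set m2 := Num.floor y; set m3 := Num.floor (x + y).
move=> b3 b2 b1.
have le1 (b : bool) : 0 <= (b%:R : R) <= 1 by case: b; rewrite lexx ler01.
have [le|gt] := leP (x + y) (m1%:~R + m2%:~R + 1).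
  have [A [B [C gE]]] := ga m1 m2 false; exists A, B, C => x' y' [h1 h2 h3].
  apply: gE; rewrite /box addr0.
  have := le1 (x != m1%:~R); have := le1 (y != m2%:~R); have := le1 (x + y != m3%:~R).
  move=> l3 l2 l1.
  have m12 : (m1 + m2)%:~R <= (m3%:~R : R).
    have : (m1 + m2 < m3 + 1)%R by rewrite -(ltr_int R); int_cast; lra.
    by rewrite ltzD1 ler_int.
  rewrite intrD in m12 *.
  have m3' : m3%:~R + (x + y != m3%:~R)%:R <= m1%:~R + m2%:~R + 1 :> R.
    case: eqVneq => [<-|ne]; first by rewrite addr0.
    have : m3 < m1 + m2 + 1.
      rewrite -(ltr_int R) !intrD; case/andP: b3 => b3 _.
      by apply: lt_le_trans le; rewrite lt_neqAle eq_sym ne.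
    by rewrite ltzD1 -(ler_int R) intrD /=; lra.
  by split=> /=; apply/andP; split; lra.
have [A [B [C gE]]] := ga m1 m2 true; exists A, B, C => x' y' [h1 h2 h3].
apply: gE; rewrite /box /=.
have := le1 (x != m1%:~R); have := le1 (y != m2%:~R); have := le1 (x + y != m3%:~R).
move=> l3 l2 l1; rewrite !intrD.
have m12 : (m1 + m2 + 1)%:~R <= (m3%:~R : R).
  have : (m1 + m2 + 1 < m3 + 1)%R by rewrite -(ltr_int R) !intrD; lra.
  by rewrite ltzD1 ler_int.
rewrite !intrD in m12.
by split; apply/andP; split; lra.
Qed.

Lemma pwl_cell_affine q (pi : plane R -> R) : (0 < q)%N -> pwl q pi ->
  cell_affine (fun x y => pi (scaled q x y)).
Proof.
move=> q0 pwlpi a1 a2 b; pose z := (a1, a2).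
have [T [TT TS]] : exists T, is_triangle q T /\
    has_shape q T a1 a2 (a1 + a2 + b%:R) true true true.
  case: b.
    exists (convex_hull [set gridpt q (z + (1, 0)); gridpt q (z + (0, 1));
      gridpt q (z + (1, 1))]); split; [by exists z; right|exact: (upper_shape z)].
  rewrite addr0; exists (convex_hull [set gridpt q z; gridpt q (z + (1, 0));
    gridpt q (z + (0, 1))]); split; [by exists z; left|exact: (lower_shape z)].
have [A [B [C piE]]] := pwlpi T TT.
exists (A / q%:R), (B / q%:R), C => x y /TS /piE ->; rewrite /scaled /=.
by rewrite !mulrA ![_ / _ * _]mulrAC.
Qed.

End Cells.

(** * Additive faces *)

Section AdditiveFaces.
Context {R : realType}.
Implicit Types (x y t : R) (q : nat) (z : int * int).

(** The complex is infinite, but only finitely many faces contain a given point; this provides a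
    maximal additive face above each additive one. *)
Lemma exists_maximal_superset (T : Type) (A : set (set T)) (F0 : set T) :
  finite_set A -> A F0 ->
  exists F, [/\ A F, F0 `<=` F & forall F', A F' -> F `<=` F' -> F' = F].
Proof.
move=> /finite_seqP[s ->].
suff [F [AF F0F maxF]] : exists F, [/\ F \in F0 :: s, F0 `<=` F &
    forall F', F' \in s -> F `<=` F' -> F' = F].
  move=> /= F0s; exists F; split=> //; move: AF.
  by rewrite /= inE => /predU1P[->|].
elim: s => [|G s [F [Fs F0F maxF]]]; first by exists F0; split=> //; rewrite inE eqxx.
have [FG|FG] := pselect (F `<=` G).
  exists G; split=> [||F' ]; first by rewrite !inE eqxx orbT.
    exact: subset_trans FG.
  rewrite inE => /predU1P[->//|F's GF'].
  have := maxF F' F's (subset_trans FG GF') => F'F.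
  by apply/seteqP; split=> //; rewrite F'F.
exists F; split=> [||F'] //.
  by move: Fs; rewrite !inE => /orP[->|->]; rewrite ?orbT.
by rewrite inE => /predU1P[->|]; [|exact: maxF].
Qed.

Definition cell q (k : nat) z : set (plane R) :=
  match k with
  | 0 => [set gridpt q z]
  | 1 => convex_hull [set gridpt q z; gridpt q (z + (1, 0))]
  | 2 => convex_hull [set gridpt q z; gridpt q (z + (0, 1))]
  | 3 => convex_hull [set gridpt q z; gridpt q (z + (-1, 1))]
  | 4 => convex_hull [set gridpt q z; gridpt q (z + (1, 0));
                          gridpt q (z + (0, 1))]
  | _ => convex_hull [set gridpt q (z + (1, 0)); gridpt q (z + (0, 1));
                          gridpt q (z + (1, 1))]
  end.

Lemma floor_near (l : int) x : l%:~R <= x <= l%:~R + 1 ->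
  Num.floor x - 1 <= l <= Num.floor x.
Proof.
move=> /andP[lx xl]; have /andP[f1 f2] := floor_bounds x.
have : l < Num.floor x + 1 by rewrite -(ltr_int R) intrD; lra.
have : Num.floor x < l + 1 + 1 by rewrite -(ltr_int R) !intrD; lra.
by lia.
Qed.

Lemma finite_cells_at q x y : (0 < q)%N ->
  finite_set [set I : set (plane R) | triangulation q I /\ I (scaled q x y)].
Proof.
move=> q0; set m1 := Num.floor x; set m2 := Num.floor y.
(* Three offsets are needed: a base point may be one below the floor, and the base point of a
   diagonal edge is its right end, possibly one above. *)
pose f (u : 'I_6 * ('I_3 * 'I_3)) :=
  cell q u.1 (m1 - 1 + u.2.1%:Z, m2 - 1 + u.2.2%:Z).
apply: (@sub_finite_set _ _ [set` [seq f u | u <- enum {: 'I_6 * ('I_3 * 'I_3)}]]);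
  last exact: finite_seq.
have near k (z : int * int) : (k < 6)%N -> m1 - 1 <= z.1 <= m1 + 1 ->
    m2 - 1 <= z.2 <= m2 + 1 ->
    cell q k z \in [seq f u | u <- enum {: 'I_6 * ('I_3 * 'I_3)}].
  move=> k6 z1 z2.
  have i3 : (absz (z.1 - (m1 - 1))%R < 3)%N by lia.
  have j3 : (absz (z.2 - (m2 - 1))%R < 3)%N by lia.
  apply/mapP; exists (Ordinal k6, (Ordinal i3, Ordinal j3)); first by rewrite mem_enum.
  by rewrite /f /=; congr cell; case: z z1 z2 {i3 j3} => z1 z2 /= z1P z2P; congr (_, _); lia.
have shape_near (I : set (plane R)) l1 l2 l3 e1 e2 e3 : has_shape q I l1 l2 l3 e1 e2 e3 ->
    I (scaled q x y) -> m1 - 1 <= l1 <= m1 /\ m2 - 1 <= l2 <= m2.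
  move=> IS /IS[b1 b2 _].
  have le1 (b : bool) : 0 <= (b%:R : R) <= 1 by case: b; rewrite lexx ler01.
  by split; apply: floor_near; [have := le1 e1|have := le1 e2]; lra.
move=> I [[]] /=.
- by move=> ->.
- move=> [z ->] /(shape_near _ _ _ _ _ _ _ (vertex_shape z q0))[z1 z2].
  by apply: (near 0%N) => //; lia.
- case=> [] [z ->].
  + move=> /(shape_near _ _ _ _ _ _ _ (horizontal_shape z q0))[z1 z2].
    by apply: (near 1%N) => //; lia.
  + move=> /(shape_near _ _ _ _ _ _ _ (vertical_shape z q0))[z1 z2].
    by apply: (near 2%N) => //; lia.
  + move=> /(shape_near _ _ _ _ _ _ _ (diagonal_shape z q0))[z1 z2].
    by apply: (near 3%N) => //; lia.
- case=> z [] ->.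
  + move=> /(shape_near _ _ _ _ _ _ _ (lower_shape z q0))[z1 z2].
    by apply: (near 4%N) => //; lia.
  + move=> /(shape_near _ _ _ _ _ _ _ (upper_shape z q0))[z1 z2].
    by apply: (near 5%N) => //; lia.
Qed.

Lemma finite_faces_at q x1 x2 y1 y2 : (0 < q)%N ->
  finite_set [set F : set (plane R * plane R) |
    DeltaP q F /\ F (scaled q x1 x2, scaled q y1 y2)].
Proof.
move=> q0.
have [s1 s1P] := (finite_seqP _).1 (finite_cells_at x1 x2 q0).
have [s2 s2P] := (finite_seqP _).1 (finite_cells_at y1 y2 q0).
have [s3 s3P] := (finite_seqP _).1 (finite_cells_at (x1 + y1) (x2 + y2) q0).
apply: (@sub_finite_set _ _ [set` [seq Fset u.1 u.2.1 u.2.2 |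
  u <- [seq (a, v) | a <- s1, v <- [seq (b, c) | b <- s2, c <- s3]]]]);
  last exact: finite_seq.
move=> F [[I [J [K [tI tJ tK ->]]]] [/= Ix Jy Kz]].
have Is : [set` s1] I by rewrite -s1P.
have Js : [set` s2] J by rewrite -s2P.
have Ks : [set` s3] K by rewrite -s3P -scaledD.
apply/mapP; exists (I, (J, K)) => //.
by apply/allpairsP; exists (I, (J, K)); split=> //=; apply/allpairsP; exists (J, K).
Qed.

Lemma extend_beyond (x x' : R) :
  (Num.floor x)%:~R <= x' <= (Num.floor x)%:~R + (x != (Num.floor x)%:~R)%:R ->
  exists2 e : R, 0 < e & forall t, 0 <= t <= e ->
    (Num.floor x)%:~R <= x + t * (x - x') <=
    (Num.floor x)%:~R + (x != (Num.floor x)%:~R)%:R.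
Proof.
have := floor_bounds x; set m := Num.floor x => mx.
have [xm|xm] := eqVneq x m%:~R => /= mx'.
  by exists 1 => // t _; have -> : x' = x; [lra|rewrite subrr mulr0; lra].
have mltx : m%:~R < x by rewrite lt_neqAle eq_sym xm; case/andP: mx.
exists (Num.min (x - m%:~R) (m%:~R + 1 - x)).
  by rewrite lt_min; apply/andP; split; lra.
move=> t /andP[t0]; rewrite le_min => /andP[t1 t2].
by apply/andP; split; nra.
Qed.

Lemma extend_beyond_floor_box x y x' y' : floor_box x y x' y' ->
  exists2 e : R, 0 < e & forall t, 0 <= t <= e ->
    floor_box x y (x + t * (x - x')) (y + t * (y - y')).
Proof.
move=> [/extend_beyond[e1 e10 H1] /extend_beyond[e2 e20 H2]
  /extend_beyond[e3 e30 H3]].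
exists (Num.min e1 (Num.min e2 e3)); first by rewrite !lt_min e10 e20.
move=> t; rewrite !le_min => /and4P[t0 t1 t2 t3]; split.
- by apply: H1; rewrite t0.
- by apply: H2; rewrite t0.
have -> : x + t * (x - x') + (y + t * (y - y')) =
  x + y + t * (x + y - (x' + y')) by ring.
by apply: H3; rewrite t0.
Qed.

(** On the smallest face at (x, y) the defect of additivity is affine, nonnegative, and zero at (x,
    y). If it were positive at (x', y'), it would be negative slightly beyond (x, y) on the line
    from (x', y'). *)
Lemma additive_on_floor_boxes (g : R -> R -> R) x1 x2 y1 y2 : cell_affine g ->
  (forall x1 x2 y1 y2, g (x1 + y1) (x2 + y2) <= g x1 x2 + g y1 y2) ->
  g x1 x2 + g y1 y2 = g (x1 + y1) (x2 + y2) ->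
  forall x1' x2' y1' y2', floor_box x1 x2 x1' x2' -> floor_box y1 y2 y1' y2' ->
    floor_box (x1 + y1) (x2 + y2) (x1' + y1') (x2' + y2') ->
    g x1' x2' + g y1' y2' = g (x1' + y1') (x2' + y2').
Proof.
move=> ga gsub gadd x1' x2' y1' y2' bx bY bz.
have [A1 [B1 [C1 E1]]] := floor_box_affine x1 x2 ga.
have [A2 [B2 [C2 E2]]] := floor_box_affine y1 y2 ga.
have [A3 [B3 [C3 E3]]] := floor_box_affine (x1 + y1) (x2 + y2) ga.
have [e1 e10 H1] := extend_beyond_floor_box bx.
have [e2 e20 H2] := extend_beyond_floor_box bY.
have [e3 e30 H3] := extend_beyond_floor_box bz.
pose e := Num.min e1 (Num.min e2 e3).
have e0 : 0 < e by rewrite !lt_min e10 e20.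
have ele : [/\ 0 <= e <= e1, 0 <= e <= e2 & 0 <= e <= e3].
  by rewrite (ltW e0); split; rewrite !ge_min lexx ?orbT.
have [le1 le2 le3] := ele.
have S1 : x1 + e * (x1 - x1') + (y1 + e * (y1 - y1')) =
  x1 + y1 + e * (x1 + y1 - (x1' + y1')) by ring.
have S2 : x2 + e * (x2 - x2') + (y2 + e * (y2 - y2')) =
  x2 + y2 + e * (x2 + y2 - (x2' + y2')) by ring.
have := gsub (x1 + e * (x1 - x1')) (x2 + e * (x2 - x2'))
             (y1 + e * (y1 - y1')) (y2 + e * (y2 - y2')).
rewrite S1 S2 (E1 _ _ (H1 _ le1)) (E2 _ _ (H2 _ le2)) (E3 _ _ (H3 _ le3)).
have := gsub x1' x2' y1' y2'; move: gadd.
rewrite (E1 _ _ bx) (E2 _ _ bY) (E3 _ _ bz).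
rewrite (E1 _ _ (floor_boxE _ _)) (E2 _ _ (floor_boxE _ _)) (E3 _ _ (floor_boxE _ _)).
set a := A1 * x1' + _ + _; set b := A2 * y1' + _ + _.
move=> gadd le_ab le_e; apply/eqP; rewrite eq_le [X in _ && X]le_ab andbT.
rewrite /a /b in le_ab le_e *.
by rewrite -(ler_pM2l e0); have := congr1 (fun v => e * v) gadd; lra.
Qed.

Definition vdt_cell (I : R -> R -> Prop) : Prop :=
  exists l1 l2 l3 e1 e2 e3, vdt_shape l1 l2 l3 e1 e2 e3 /\
    forall x y, I x y <-> box l1 l2 l3 e1 e2 e3 x y.

(** I, J and K are the projections of the face themselves, as the three surjectivity conditions
    express. The cells come from pi, but g will also be a perturbation of it. *)
Record face (g : R -> R -> R) (I J K : R -> R -> Prop) : Prop := Face {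
  face_cell1 : vdt_cell I;
  face_cell2 : vdt_cell J;
  face_cell3 : vdt_cell K;
  face_onto1 : forall x1 x2, I x1 x2 ->
    exists y1 y2, J y1 y2 /\ K (x1 + y1) (x2 + y2);
  face_onto2 : forall y1 y2, J y1 y2 ->
    exists x1 x2, I x1 x2 /\ K (x1 + y1) (x2 + y2);
  face_onto3 : forall w1 w2, K w1 w2 ->
    exists x1 x2, I x1 x2 /\ J (w1 - x1) (w2 - x2);
  face_additive : forall x1 x2 y1 y2, I x1 x2 -> J y1 y2 ->
    K (x1 + y1) (x2 + y2) -> g x1 x2 + g y1 y2 = g (x1 + y1) (x2 + y2) }.

Lemma exists_additive_face q (pi : plane R -> R) x1 x2 y1 y2 : (0 < q)%N ->
  pwl q pi -> diagonally_constrained q pi ->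
  (forall u v : plane R, pi (u + v) <= pi u + pi v) ->
  let g u v := pi (scaled q u v) in
  g x1 x2 + g y1 y2 = g (x1 + y1) (x2 + y2) ->
  exists I J K, [/\ face g I J K, I x1 x2, J y1 y2 & K (x1 + y1) (x2 + y2)].
Proof.
move=> q0 pwlpi dc pisub g gadd.
have gsub u1 u2 v1 v2 : g (u1 + v1) (u2 + v2) <= g u1 u2 + g v1 v2.
  by rewrite /g -scaledD.
have [I0 tI0 I0P] := triangulation_floor_box x1 x2 q0.
have [J0 tJ0 J0P] := triangulation_floor_box y1 y2 q0.
have [K0 tK0 K0P] := triangulation_floor_box (x1 + y1) (x2 + y2) q0.
pose xy : plane R * plane R := (scaled q x1 x2, scaled q y1 y2).
pose A := [set F | DeltaP q F /\ F xy] `&` additive_faces q pi.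
have A0 : A (Fset I0 J0 K0).
  split; split; try by exists I0, J0, K0.
    split=> /=; [exact/I0P/floor_boxE|exact/J0P/floor_boxE|].
    by rewrite scaledD; exact/K0P/floor_boxE.
  move=> [u v] [/=]; rewrite -(scaledK u q0) -(scaledK v q0).
  rewrite scaledD => /I0P bu /J0P bv /K0P bw; rewrite /Delta /= scaledD.
  apply/eqP; rewrite subr_eq0; apply/eqP.
  exact: (additive_on_floor_boxes (pwl_cell_affine q0 pwlpi) gsub gadd).
have fA : finite_set A.
  by apply: sub_finite_set (finite_faces_at x1 x2 y1 y2 q0); exact: subIsetl.
have [F [[[DF Fxy] aF] _ maxF]] := exists_maximal_superset fA A0.
have [| + + +] := dc F.
  split=> // F' aF' FF'; apply: maxF => //; split=> //; split; first by case: aF'.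
  exact: FF'.
set I := [set _ | _ in F]; set J := [set _ | _ in F]; set K := [set _ | _ in F].
move=> vI vJ vK.
have vdt (L : set (plane R)) : vertex_diagonal_or_triangle q L ->
    vdt_cell (fun u v => L (scaled q u v)).
  by case/(vertex_diagonal_or_triangle_shape q0) => l1 [l2 [l3 [e1 [e2 [e3 [? ?]]]]]];
    exists l1, l2, l3, e1, e2, e3.
have scK (p : plane R) := scaledK p q0.
exists (fun u v => I (scaled q u v)), (fun u v => J (scaled q u v)),
  (fun u v => K (scaled q u v)).
split; last 3 first.
- by exists xy.
- by exists xy.
- by exists xy => //; rewrite /= scaledD.
split; [exact: vdt|exact: vdt|exact: vdt| | | |].
- move=> u1 u2 [[u v] Fuv /= uE]; exists (v.1 * q%:R), (v.2 * q%:R).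
  rewrite scK; split; first by exists (u, v).
  by exists (u, v) => //=; rewrite uE -scaledD scK.
- move=> v1 v2 [[u v] Fuv /= vE]; exists (u.1 * q%:R), (u.2 * q%:R).
  rewrite scK; split; first by exists (u, v).
  by exists (u, v) => //=; rewrite vE -scaledD scK.
- move=> w1 w2 [[u v] Fuv /= wE]; exists (u.1 * q%:R), (u.2 * q%:R).
  rewrite scK; split; first by exists (u, v).
  suff -> : scaled q (w1 - u.1 * q%:R) (w2 - u.2 * q%:R) = v by exists (u, v).
  by apply: (addrI u); rewrite wE -{1}(scK u) scaledD !subrKC.
move=> u1 u2 v1 v2 Iu Jv Kw.
(* A face F(I1, J1, K1) is recovered from its projections: they lie in I1, J1 and K1, so any x, y, x
   + y taken from them satisfy the three conditions. *)
case: aF => [[I1 [J1 [K1 [_ _ _ FE]]]] Fadd].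
have : F (scaled q u1 u2, scaled q v1 v2).
  move: Iu Jv Kw; rewrite /I /J /K FE => -[[a b] [/= Ia _ _] aE].
  move=> [[a' b'] [/= _ Jb _] bE] [[a'' b''] [/= _ _ Kc] cE].
  by split; rewrite /= ?scaledD -?aE -?bE -?cE.
by move=> /Fadd; rewrite /Delta /= scaledD => /eqP; rewrite subr_eq0 => /eqP.
Qed.

End AdditiveFaces.

(** * Constancy of a perturbation on the projections of a face *)

Section GridPerturbation.
Context {R : realType}.
Implicit Types (x y u t : R) (I J K : R -> R -> Prop).

Definition vertex_cell I := exists l1 l2,
  forall x y, I x y <-> box l1 l2 (l1 + l2) false false false x y.
Definition diagonal_cell I := exists l1 l2,
  forall x y, I x y <-> box l1 l2 (l1 + l2 + 1) true true false x y.
Definition triangle_cell I := exists l1 l2 (b : bool),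
  forall x y, I x y <-> box l1 l2 (l1 + l2 + b%:R) true true true x y.

Lemma vdt_cellP I : vdt_cell I ->
  [\/ vertex_cell I, diagonal_cell I | triangle_cell I].
Proof.
case=> l1 [l2 [l3 [e1 [e2 [e3 [shape]]]]]]; case: shape => {}l1 {}l2 H.
- by constructor 1; exists l1, l2.
- by constructor 2; exists l1, l2.
- by constructor 3; exists l1, l2, false; rewrite addr0.
by constructor 3; exists l1, l2, true.
Qed.

Lemma box_reflect (f1 f2 l1 l2 l3 : int) (e1 e2 e3 : bool) x y :
  box l1 l2 l3 e1 e2 e3 (f1%:~R - x) (f2%:~R - y) <->
  box (f1 - l1 - e1%:R) (f2 - l2 - e2%:R) (f1 + f2 - l3 - e3%:R) e1 e2 e3 x y.
Proof.
have bE (b : bool) : (b%:R : int)%:~R = b%:R :> R by case: b.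
rewrite /box !intrB !intrD !bE; split=> -[h1 h2 h3];
  split; apply/andP; split; lra.
Qed.

Lemma vdt_cell_reflect (f1 f2 : int) I : vdt_cell I ->
  vdt_cell (fun x y => I (f1%:~R - x) (f2%:~R - y)).
Proof.
case=> l1 [l2 [l3 [e1 [e2 [e3 [shape IE]]]]]].
exists (f1 - l1 - e1%:R), (f2 - l2 - e2%:R), (f1 + f2 - l3 - e3%:R), e1, e2, e3.
split; last by move=> x y; rewrite IE box_reflect.
case: shape {IE} => {}l1 {}l2 /=; rewrite ?subr0.
- have -> : f1 + f2 - (l1 + l2) = f1 - l1 + (f2 - l2) by lia.
  exact: VertexShape.
- have -> : f1 + f2 - (l1 + l2 + 1) = f1 - l1 - 1 + (f2 - l2 - 1) + 1 by lia.
  exact: DiagonalShape.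
- have -> : f1 + f2 - (l1 + l2) - 1 = f1 - l1 - 1 + (f2 - l2 - 1) + 1 by lia.
  exact: UpperShape.
have -> : f1 + f2 - (l1 + l2 + 1) - 1 = f1 - l1 - 1 + (f2 - l2 - 1) by lia.
exact: LowerShape.
Qed.

Definition reflect_cell (f1 f2 : int) I x y := I (f1%:~R - x) (f2%:~R - y).

Lemma vertex_cell_reflect (f1 f2 : int) I : vertex_cell I ->
  vertex_cell (reflect_cell f1 f2 I).
Proof.
case=> l1 [l2 IE]; exists (f1 - l1), (f2 - l2) => x y.
rewrite /reflect_cell IE box_reflect /= !subr0.
by have -> : f1 + f2 - (l1 + l2) = f1 - l1 + (f2 - l2) by lia.
Qed.

Lemma diagonal_cell_reflect (f1 f2 : int) I : diagonal_cell I ->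
  diagonal_cell (reflect_cell f1 f2 I).
Proof.
case=> l1 [l2 IE]; exists (f1 - l1 - 1), (f2 - l2 - 1) => x y.
rewrite /reflect_cell IE box_reflect /= subr0.
by have -> : f1 + f2 - (l1 + l2 + 1) = f1 - l1 - 1 + (f2 - l2 - 1) + 1 by lia.
Qed.

Lemma triangle_cell_reflect (f1 f2 : int) I : triangle_cell I ->
  triangle_cell (reflect_cell f1 f2 I).
Proof.
case=> l1 [l2 [b IE]]; exists (f1 - l1 - 1), (f2 - l2 - 1), (~~ b) => x y.
rewrite /reflect_cell IE box_reflect /=.
have -> // : f1 + f2 - (l1 + l2 + b%:R) - 1 =
          f1 - l1 - 1 + (f2 - l2 - 1) + (~~ b)%:R :> int.
by case: (b) => /=; lia.
Qed.

Variables (h : R -> R -> R) (f1 f2 : int).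
Hypothesis h_reflect : forall x y, h (f1%:~R - x) (f2%:~R - y) = - h x y.

Lemma face_swap I J K : face h I J K -> face h J I K.
Proof.
case=> cI cJ cK oI oJ oK add; split=> //.
- move=> x1 x2 /oJ[y1 [y2 [Iy Kz]]]; exists y1, y2; split=> //.
  by rewrite [x1 + _]addrC [x2 + _]addrC.
- move=> x1 x2 /oI[y1 [y2 [Iy Kz]]]; exists y1, y2; split=> //.
  by rewrite [y1 + _]addrC [y2 + _]addrC.
- move=> w1 w2 /oK[x1 [x2 [Ix Jy]]]; exists (w1 - x1), (w2 - x2).
  by rewrite !subKr.
move=> x1 x2 y1 y2 Jx Iy Kz; rewrite addrC add //.
  by rewrite [y1 + _]addrC [y2 + _]addrC.
by rewrite [y1 + _]addrC [y2 + _]addrC.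
Qed.

(** With z = f - x - y, antisymmetry turns additivity into h x + h y + h z = 0, which is symmetric
    in the three points; here y and z are exchanged. *)
Lemma face_reflect I J K : face h I J K ->
  face h I (reflect_cell f1 f2 K) (reflect_cell f1 f2 J).
Proof.
case=> cI cJ cK oI oJ oK add; split.
- exact: cI.
- exact: vdt_cell_reflect.
- exact: vdt_cell_reflect.
- move=> x1 x2 /oI[y1 [y2 [Jy Kz]]].
  exists (f1%:~R - (x1 + y1)), (f2%:~R - (x2 + y2)); rewrite /reflect_cell !subKr.
  split=> //; move: Jy; congr (J _ _); ring.
- move=> y1 y2 /oK[x1 [x2 [Ix Jy]]]; exists x1, x2; split=> //.
  by move: Jy; rewrite /reflect_cell; congr (J _ _); ring.
- move=> w1 w2 /oJ[x1 [x2 [Ix Kz]]]; exists x1, x2; split=> //.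
  by move: Kz; rewrite /reflect_cell; congr (K _ _); ring.
move=> x1 x2 y1 y2 Ix Ky Jz.
have := add x1 x2 (f1%:~R - (x1 + y1)) (f2%:~R - (x2 + y2)) Ix Jz.
have -> : x1 + (f1%:~R - (x1 + y1)) = f1%:~R - y1 by ring.
have -> : x2 + (f2%:~R - (x2 + y2)) = f2%:~R - y2 by ring.
by move=> /(_ Ky); rewrite !h_reflect; lra.
Qed.

(* Up to exchanging the roles of x, y and f - x - y, a face has a vertex as its
   first projection, or else a diagonal edge, or else three triangles. *)
Lemma face_wlog (P : (R -> R -> Prop) -> (R -> R -> Prop) -> (R -> R -> Prop) -> Prop) :
  (forall I J K, P J I K -> P I J K) ->
  (forall I J K, P I (reflect_cell f1 f2 K) (reflect_cell f1 f2 J) -> P I J K) ->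
  (forall I J K, face h I J K -> vertex_cell I -> P I J K) ->
  (forall I J K, face h I J K -> diagonal_cell I ->
     diagonal_cell J \/ triangle_cell J -> diagonal_cell K \/ triangle_cell K ->
     P I J K) ->
  (forall I J K, face h I J K -> triangle_cell I -> triangle_cell J ->
     triangle_cell K -> P I J K) ->
  forall I J K, face h I J K -> P I J K.
Proof.
move=> swap refl HV HD HT I J K F.
have FS := face_swap F; have FR := face_reflect F; have FRS := face_swap FR.
have nv L : vdt_cell L -> vertex_cell L \/ (diagonal_cell L \/ triangle_cell L).
  by case/vdt_cellP; [left|right; left|right; right].
have dtr L : diagonal_cell L \/ triangle_cell L ->
    diagonal_cell (reflect_cell f1 f2 L) \/ triangle_cell (reflect_cell f1 f2 L).
  by case=> ?; [left; exact: diagonal_cell_reflect|right; exact: triangle_cell_reflect].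
case: (nv I (face_cell1 F)) => [vI|nI]; first exact: HV.
case: (nv J (face_cell2 F)) => [vJ|nJ]; first by apply: swap; apply: HV.
case: (nv K (face_cell3 F)) => [vK|nK].
  by apply: refl; apply: swap; apply: HV => //; exact: vertex_cell_reflect.
case: (nI) => [dI|tI]; first exact: HD.
case: (nJ) => [dJ|tJ]; first by apply: swap; exact: HD.
case: (nK) => [dK|tK]; last exact: HT.
apply: refl; apply: swap; apply: HD => //; first exact: diagonal_cell_reflect.
exact: dtr.
Qed.

Variable L : R.
Hypotheses (L0 : 0 <= L) (h_lip : lipschitz2 L h).
Hypothesis h_int : forall z1 z2 : int, h z1%:~R z2%:~R = 0.

Definition slack (d : R) (l1 l2 l3 : int) (e1 e2 e3 : bool) x y : Prop :=
  [/\ l1%:~R + d * e1%:R <= x <= l1%:~R + e1%:R - d * e1%:R,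
      l2%:~R + d * e2%:R <= y <= l2%:~R + e2%:R - d * e2%:R &
      l3%:~R + d * e3%:R <= x + y <= l3%:~R + e3%:R - d * e3%:R].

Lemma slack_move (d : R) l1 l2 l3 e1 e2 e3 x y w1 w2 :
  slack d l1 l2 l3 e1 e2 e3 x y -> `|w1| <= d * e1%:R -> `|w2| <= d * e2%:R ->
  `|w1 + w2| <= d * e3%:R -> box l1 l2 l3 e1 e2 e3 (x + w1) (y + w2).
Proof.
rewrite !ler_norml => -[s1 s2 s3] w1d w2d w3d.
by split; apply/andP; split; lra.
Qed.

Lemma slack_average l1 l2 l3 e1 e2 e3 x y x' y' x'' y'' :
  slack (3^-1) l1 l2 l3 e1 e2 e3 x y ->
  box l1 l2 l3 e1 e2 e3 x' y' -> box l1 l2 l3 e1 e2 e3 x'' y'' ->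
  slack (9^-1) l1 l2 l3 e1 e2 e3 ((x + x' + x'') / 3) ((y + y' + y'') / 3).
Proof.
by move=> [s1 s2 s3] [b1 b2 b3] [c1 c2 c3]; split; apply/andP; split; lra.
Qed.

(** Common form of the diagonal edges (e false) and the two kinds of triangles (e true), so that one
    argument covers all faces without a vertex. *)
Definition thick_shape (l1 l2 l3 : int) (e : bool) : Prop :=
  l3 = l1 + l2 + 1 \/ (l3 = l1 + l2 /\ e).

Lemma thick_center (l1 l2 l3 : int) e : thick_shape l1 l2 l3 e ->
  exists x y, slack (3^-1) l1 l2 l3 true true e x y.
Proof.
case: e => [[->|[-> _]]|[->|[_ //]]].
- by exists (l1%:~R + 2 / 3), (l2%:~R + 2 / 3); split; rewrite /= ?intrD;
    apply/andP; split; lra.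
- by exists (l1%:~R + 1 / 3), (l2%:~R + 1 / 3); split; rewrite /= ?intrD;
    apply/andP; split; lra.
by exists (l1%:~R + 1 / 2), (l2%:~R + 1 / 2); split; rewrite /= ?intrD;
  apply/andP; split; lra.
Qed.

Lemma slack_box (d : R) l1 l2 l3 e1 e2 e3 x y : 0 <= d ->
  slack d l1 l2 l3 e1 e2 e3 x y -> box l1 l2 l3 e1 e2 e3 x y.
Proof.
move=> d0 s; have e0 (e : bool) : 0 <= d * e%:R by rewrite mulr_ge0.
have := @slack_move d l1 l2 l3 e1 e2 e3 x y 0 0 s.
by rewrite !addr0 normr0; apply.
Qed.

(** The vertices v and w at distance d provide the two equal values, both 0. The implication from eI
    to eK is there because x + y is moved by differences of points of I, and K must have room for
    them. *)
Lemma face_constant_along I J K (i1 i2 i3 j1 j2 j3 k1 k2 k3 : int)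
    (eI eJ eK : bool) (d1 d2 : R) (v1 v2 w1 w2 : int) :
  face h I J K ->
  thick_shape i1 i2 i3 eI -> thick_shape j1 j2 j3 eJ -> thick_shape k1 k2 k3 eK ->
  (forall x y, I x y <-> box i1 i2 i3 true true eI x y) ->
  (forall x y, J x y <-> box j1 j2 j3 true true eJ x y) ->
  (forall x y, K x y <-> box k1 k2 k3 true true eK x y) ->
  `|d1| <= 1 -> `|d2| <= 1 -> `|d1 + d2| <= 1 ->
  d1 + d2 = 0 \/ [/\ eI, eJ & eK] -> (eI -> eK) ->
  v1%:~R + d1 = w1%:~R -> v2%:~R + d2 = w2%:~R ->
  I v1%:~R v2%:~R -> I w1%:~R w2%:~R ->
  [/\ forall x y u, I x y -> I (x + u * d1) (y + u * d2) ->
        h (x + u * d1) (y + u * d2) = h x y,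
      forall x y u, J x y -> J (x + u * d1) (y + u * d2) ->
        h (x + u * d1) (y + u * d2) = h x y &
      forall x y u, K x y -> K (x + u * d1) (y + u * d2) ->
        h (x + u * d1) (y + u * d2) = h x y].
Proof.
move=> F tI tJ tK IE JE KE d1_1 d2_1 d12_1 dsum eIK vw1 vw2 Iv Iw.
have [_ _ _ oI oJ oK add] := F.
have cvx L' l1 l2 l3 e : (forall x y, L' x y <-> box l1 l2 l3 true true e x y) ->
    convex2 L'.
  by move=> E x y x' y' t t01 /E bx /E bx'; apply/E; exact: box_convex2.
have third0 : (0 : R) <= 3^-1 by rewrite invr_ge0.
have [a1 [a2 /[dup] sa /(slack_box third0)/IE Ia]] := thick_center tI.
have [b1 [b2 /[dup] sb /(slack_box third0)/JE Jb]] := thick_center tJ.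
have [c1 [c2 /[dup] sc /(slack_box third0)/KE Kc]] := thick_center tK.
have [a1' [a2' [Ja' Ka']]] := oI _ _ Ia.
have [b1' [b2' [Ib' Kb']]] := oJ _ _ Jb.
have [c1' [c2' [Ic' Jc']]] := oK _ _ Kc.
(* Centres of I, J and K are completed to three points of the face. In their mean each projection
   averages one centre of margin 1/3 with two arbitrary points, which leaves the margin 1/9. *)
pose A1 := (a1 + b1' + c1') / 3; pose A2 := (a2 + b2' + c2') / 3.
pose B1 := (b1 + a1' + (c1 - c1')) / 3; pose B2 := (b2 + a2' + (c2 - c2')) / 3.
have sA : slack (9^-1) i1 i2 i3 true true eI A1 A2.
  by apply: slack_average sa _ _; apply/IE.
have sB : slack (9^-1) j1 j2 j3 true true eJ B1 B2.
  by apply: slack_average sb _ _; apply/JE.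
have sC : slack (9^-1) k1 k2 k3 true true eK (A1 + B1) (A2 + B2).
  have -> : A1 + B1 = (c1 + (a1 + a1') + (b1' + b1)) / 3 by rewrite /A1 /B1; field.
  have -> : A2 + B2 = (c2 + (a2 + a2') + (b2' + b2)) / 3 by rewrite /A2 /B2; field.
  by apply: slack_average sc _ _; apply/KE.
(* Two moves of size at most 1/18 are made at once, within the margin 1/9. *)
have r0 : (0 : R) < 18^-1 by rewrite invr_gt0.
have diff x1 x2 x1' x2' l u : I x1 x2 -> I x1' x2' -> `|l| <= 18^-1 :> R ->
    `|u| <= 18^-1 :> R -> [/\ `|l * (x1' - x1) + u * d1| <= 9^-1,
      `|l * (x2' - x2) + u * d2| <= 9^-1 &
      `|l * (x1' - x1) + u * d1 + (l * (x2' - x2) + u * d2)| <= 9^-1 * eI%:R].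
  move=> /IE[] /= h1 h2 h3 /IE[] /= h1' h2' h3' l1 u1.
  have prod (a b : R) : `|a| <= 18^-1 -> `|b| <= 1 -> `|a * b| <= 18^-1.
    by move=> ha hb; rewrite normrM -[leRHS]mulr1 ler_pM.
  have sum (a b : R) : `|a| <= 18^-1 -> `|b| <= 18^-1 -> `|a + b| <= 9^-1.
    by rewrite !ler_norml => ha hb; apply/andP; split; lra.
  split.
  - by apply: sum; apply: prod => //; rewrite ler_norml; apply/andP; split; lra.
  - by apply: sum; apply: prod => //; rewrite ler_norml; apply/andP; split; lra.
  have -> : l * (x1' - x1) + u * d1 + (l * (x2' - x2) + u * d2) =
    l * ((x1' + x2') - (x1 + x2)) + u * (d1 + d2) by ring.
  case: (eI) h3 h3' dsum => /= h3 h3' dsum.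
    rewrite mulr1; apply: sum; apply: prod => //; rewrite ler_norml; apply/andP; split; lra.
  have -> : d1 + d2 = 0 by case: dsum => // -[].
  have -> : x1' + x2' - (x1 + x2) = 0 by lra.
  by rewrite !mulr0 addr0 normr0.
have := @constant_along R h L d1 d2 L0 h_lip d1_1 d2_1 I J K
  (cvx _ _ _ _ _ IE) (cvx _ _ _ _ _ JE) (cvx _ _ _ _ _ KE) oI oJ oK add
  A1 A2 B1 B2 (18^-1) r0 _ _ _ v1%:~R v2%:~R Iv.
rewrite vw1 vw2 !h_int; apply=> //.
- move=> x1 x2 x1' x2' l u Ix Ix' lr ur; apply/IE; rewrite -!addrA.
  have [H1 H2 H3] := diff _ _ _ _ _ _ Ix Ix' lr ur.
  by apply: slack_move sA _ _ _; rewrite /= ?mulr1.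
- move=> x1 x2 x1' x2' l u Ix Ix' lr ur; apply/KE.
  have [H1 H2 H3] := diff _ _ _ _ _ _ Ix Ix' lr ur.
  rewrite -![_ + l * _ + u * _]addrA.
  apply: slack_move sC _ _ _; rewrite /= ?mulr1 //.
  apply: le_trans H3 _; rewrite ler_pM2l ?invr_gt0 // ler_nat.
  by case: (eI) eIK => // ->.
move=> u ur; apply/JE; apply: slack_move sB _ _ _; rewrite /= ?mulr1.
- rewrite normrM; apply: (@le_trans _ _ (18^-1 * 1)); last by lra.
  by rewrite ler_pM.
- rewrite normrM; apply: (@le_trans _ _ (18^-1 * 1)); last by lra.
  by rewrite ler_pM.
rewrite -mulrDr normrM; case: dsum => [->|[_ -> _]].
  by rewrite normr0 mulr0 mulr_ge0 ?invr_ge0.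
rewrite /= mulr1; apply: (@le_trans _ _ (18^-1 * 1)); last by lra.
by rewrite ler_pM.
Qed.

Lemma thick_diagonal (l1 l2 : int) : thick_shape l1 l2 (l1 + l2 + 1) false.
Proof. by left. Qed.

Lemma thick_triangle (l1 l2 : int) (b : bool) : thick_shape l1 l2 (l1 + l2 + b%:R) true.
Proof. by case: b; [left|right; rewrite addr0]. Qed.

Lemma thickP I : diagonal_cell I \/ triangle_cell I ->
  exists l1 l2 l3 e, thick_shape l1 l2 l3 e /\
    (forall x y, I x y <-> box l1 l2 l3 true true e x y).
Proof.
case=> [[l1 [l2 IE]]|[l1 [l2 [b IE]]]].
  by do 4 eexists; split; [exact: thick_diagonal|exact: IE].
by do 4 eexists; split; [exact: thick_triangle|exact: IE].
Qed.

Definition constant_on_diagonals I := forall x y u, I x y -> I (x - u) (y + u) ->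
  h (x - u) (y + u) = h x y.

(** The segment between vertices is the diagonal edge from (i1 + 1, i2) to (i1, i2 + 1), common to
    the diagonal, lower and upper cells at (i1, i2). *)
Lemma face_diagonal_constant I J K : face h I J K ->
  diagonal_cell I \/ [/\ triangle_cell I, triangle_cell J & triangle_cell K] ->
  diagonal_cell J \/ triangle_cell J -> diagonal_cell K \/ triangle_cell K ->
  [/\ constant_on_diagonals I, constant_on_diagonals J & constant_on_diagonals K].
Proof.
move=> F dI tJ tK.
have n1 : `|-1 : R| <= 1 by rewrite normrN normr1.
have p1 : `|1 : R| <= 1 by rewrite normr1.
have d0 : -1 + 1 = 0 :> R by ring.
have z1 : `|-1 + 1 : R| <= 1 by rewrite d0 normr0.
have [j1 [j2 [j3 [eJ [tJ' JE]]]]] := thickP tJ.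
have [k1 [k2 [k3 [eK [tK' KE]]]]] := thickP tK.
have E (v1 v2 : int) : (v1 + 1)%:~R + -1 = v1%:~R :> R by rewrite intrD; ring.
have E' (v2 : int) : v2%:~R + 1 = (v2 + 1)%:~R :> R by rewrite intrD.
suff [H1 H2 H3] : [/\ forall x y u, I x y -> I (x + u * -1) (y + u * 1) ->
        h (x + u * -1) (y + u * 1) = h x y,
      forall x y u, J x y -> J (x + u * -1) (y + u * 1) ->
        h (x + u * -1) (y + u * 1) = h x y &
      forall x y u, K x y -> K (x + u * -1) (y + u * 1) ->
        h (x + u * -1) (y + u * 1) = h x y].
  split=> x y u; [move: (H1 x y u)|move: (H2 x y u)|move: (H3 x y u)];
    by rewrite mulrN1 mulr1.
case: dI => [[i1 [i2 IE]]|[[i1 [i2 [b IE]]] [l1 [l2 [b' JE']]] [m1 [m2 [b'' KE']]]]].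
  apply: (face_constant_along F (thick_diagonal i1 i2) tJ' tK' IE JE KE n1 p1 z1
    (or_introl d0) _ (E i1 0) (E' i2)) => //.
    by apply/IE; rewrite /box !intrD; split; apply/andP; split=> /=; lra.
  by apply/IE; rewrite /box !intrD; split; apply/andP; split=> /=; lra.
apply: (face_constant_along F (thick_triangle i1 i2 b) (thick_triangle l1 l2 b')
  (thick_triangle m1 m2 b'') IE JE' KE' n1 p1 z1 (or_introl d0) _ (E i1 0) (E' i2)) => //.
  by apply/IE; rewrite /box !intrD; case: (b); split; apply/andP; split=> /=; lra.
by apply/IE; rewrite /box !intrD; case: (b); split; apply/andP; split=> /=; lra.
Qed.

Lemma face_horizontal_constant I J K : face h I J K ->
  triangle_cell I -> triangle_cell J -> triangle_cell K ->
  [/\ forall x y u, I x y -> I (x + u) y -> h (x + u) y = h x y,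
      forall x y u, J x y -> J (x + u) y -> h (x + u) y = h x y &
      forall x y u, K x y -> K (x + u) y -> h (x + u) y = h x y].
Proof.
move=> F [i1 [i2 [b IE]]] [j1 [j2 [b' JE]]] [k1 [k2 [b'' KE]]].
have p1 : `|1 : R| <= 1 by rewrite normr1.
have p0 : `|0 : R| <= 1 by rewrite normr0.
have p10 : `|1 + 0 : R| <= 1 by rewrite addr0 normr1.
have E (v : int) : v%:~R + 1 = (v + 1)%:~R :> R by rewrite intrD.
(* The horizontal edge is at the bottom of a lower triangle and at the top of an upper one. *)
have E' : (i2 + b%:R)%:~R + 0 = (i2 + b%:R)%:~R :> R by rewrite addr0.
have bE (c : bool) : (c%:R : int)%:~R = c%:R :> R by case: c.
have [|||H1 H2 H3] := face_constant_along F (thick_triangle i1 i2 b)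
  (thick_triangle j1 j2 b') (thick_triangle k1 k2 b'') IE JE KE p1 p0 p10
  (or_intror (And3 isT isT isT)) _ (E i1) E'.
- by [].
- by apply/IE; rewrite /box !intrD bE; case: (b); split; apply/andP; split=> /=; lra.
- by apply/IE; rewrite /box !intrD bE; case: (b); split; apply/andP; split=> /=; lra.
split=> x y u; [move: (H1 x y u)|move: (H2 x y u)|move: (H3 x y u)];
  by rewrite mulr0 mulr1 addr0.
Qed.

End GridPerturbation.

(** * Perturbations on the refined grid *)

Section GridSolution.
Context {R : realType}.
Implicit Types (x y u t : R) (I J K : R -> R -> Prop) (X Y : int).

Variables (g h : R -> R -> R) (f1 f2 : int) (q : nat) (L : R).
Hypothesis h_reflect : forall x y, h (f1%:~R - x) (f2%:~R - y) = - h x y.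
Hypotheses (L0 : 0 <= L) (h_lip : lipschitz2 L h).
Hypothesis h_int : forall z1 z2 : int, h z1%:~R z2%:~R = 0.
Hypothesis h_periodic : forall x y (z1 z2 : int),
  h (x + (z1 * q%:Z)%:~R) (y + (z2 * q%:Z)%:~R) = h x y.
Hypothesis h_faces : forall x1 x2 y1 y2,
  g x1 x2 + g y1 y2 = g (x1 + y1) (x2 + y2) ->
  exists I J K, [/\ face h I J K, I x1 x2, J y1 y2 & K (x1 + y1) (x2 + y2)].

Definition third X : R := X%:~R / 3.

Lemma thirdD X Y : third (X + Y) = third X + third Y.
Proof. by rewrite /third intrD mulrDl. Qed.

Lemma third3 X : third (3 * X) = X%:~R.
Proof. by rewrite /third intrM; field. Qed.

Lemma third_period X (z : int) (n : nat) :
  third (X + z * (3 * n%:Z)) = third X + (z * n%:Z)%:~R.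
Proof. by rewrite /third !(intrD, intrM); field. Qed.

(** Indices count multiples of 1/3q in the plane, so vertices of the original triangulation have
    indices divisible by 3 and the period is 3 q. *)
Definition grid_solution (phi : int -> int -> R) : Prop :=
  [/\ exists X1 X2, phi X1 X2 != 0,
      forall X1 X2 z1 z2 : int,
        phi (X1 + z1 * (3 * q%:Z)) (X2 + z2 * (3 * q%:Z)) = phi X1 X2,
      phi (3 * f1) (3 * f2) = 0 &
      forall X1 X2 Y1 Y2,
        g (third X1) (third X2) + g (third Y1) (third Y2) =
          g (third (X1 + Y1)) (third (X2 + Y2)) ->
        phi X1 X2 + phi Y1 Y2 = phi (X1 + Y1) (X2 + Y2)].

Definition additive_on_grid (phi : int -> int -> R) I J K : Prop :=
  forall X1 X2 Y1 Y2, I (third X1) (third X2) -> J (third Y1) (third Y2) ->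
    K (third (X1 + Y1)) (third (X2 + Y2)) ->
    phi X1 X2 + phi Y1 Y2 = phi (X1 + Y1) (X2 + Y2).

Lemma additive_on_grid_swap phi I J K :
  additive_on_grid phi J I K -> additive_on_grid phi I J K.
Proof.
move=> H X1 X2 Y1 Y2 IX JY KZ; rewrite addrC H //.
  by rewrite [Y1 + _]addrC [Y2 + _]addrC.
by rewrite [Y1 + _]addrC [Y2 + _]addrC.
Qed.

Lemma additive_on_grid_reflect phi I J K :
  (forall X1 X2, phi (3 * f1 - X1) (3 * f2 - X2) = - phi X1 X2) ->
  additive_on_grid phi I (reflect_cell f1 f2 K) (reflect_cell f1 f2 J) ->
  additive_on_grid phi I J K.
Proof.
move=> phiR H X1 X2 Y1 Y2 IX JY KZ.
have E (f X Y : int) : X + (3 * f - (X + Y)) = 3 * f - Y by ring.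
have T (f X : int) : f%:~R - third (3 * f - X) = third X.
  by rewrite /third intrB intrM; field.
have := H X1 X2 (3 * f1 - (X1 + Y1)) (3 * f2 - (X2 + Y2)) IX.
by rewrite /reflect_cell !E !T !phiR => /(_ KZ JY); lra.
Qed.

Lemma grid_solution_of phi :
  (exists X1 X2, phi X1 X2 != 0) ->
  (forall X1 X2 z1 z2 : int,
     phi (X1 + z1 * (3 * q%:Z)) (X2 + z2 * (3 * q%:Z)) = phi X1 X2) ->
  (forall z1 z2 : int, phi (3 * z1) (3 * z2) = 0) ->
  (forall I J K, face h I J K -> additive_on_grid phi I J K) ->
  grid_solution phi.
Proof.
move=> nz per z0 add; split=> //.
move=> X1 X2 Y1 Y2; rewrite !thirdD => /h_faces[I [J [K [F IX JY KZ]]]].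
by apply: add F _ _ _ _ IX JY _; rewrite !thirdD.
Qed.

(* A vertex or, when h depends on x + y only, a diagonal edge acts on the other
   two projections as a translation that preserves h. *)
Lemma face_translation I J K x1 x2 y1 y2 : face h I J K -> I x1 x2 ->
  (forall x1 x2, I x1 x2 -> h x1 x2 = 0) ->
  (forall x1' x2', I x1' x2' -> h (x1' + y1) (x2' + y2) = h (x1 + y1) (x2 + y2)) ->
  J y1 y2 -> h (x1 + y1) (x2 + y2) = h y1 y2.
Proof.
move=> F Ix hI hK Jy; have [x1' [x2' [Ix' Kz]]] := face_onto2 F Jy.
by rewrite -(hK _ _ Ix') -(face_additive F Ix' Jy Kz) hI // add0r.
Qed.

Lemma vertex_cellE I : vertex_cell I -> exists a1 a2 : int,
  forall x y, I x y <-> x = a1%:~R /\ y = a2%:~R.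
Proof.
case=> l1 [l2 IE]; exists l1, l2 => x y; rewrite IE /box /= !addr0 !intrD.
split=> [[b1 b2 _]|[-> ->]]; first by split; apply/eqP; rewrite eq_le andbC.
by split; rewrite !lexx.
Qed.

Lemma third_inj_int X (a : int) : third X = a%:~R -> X = 3 * a.
Proof.
move=> E; apply/eqP; rewrite -(eqr_int R); apply/eqP.
by rewrite intrM -E /third; field.
Qed.

Section TriangleBubble.
Variables (p1 p2 p : R).
Hypothesis (pT : box 0 0 0 true true true p1 p2).
Hypothesis (pT' : box 0 0 0 true true true (p1 - p) (p2 + p)).

Let c (a1 a2 : int) : R :=
  h (a1%:~R + p1) (a2%:~R + p2) - h (a1%:~R + p1 - p) (a2%:~R + p2 + p).

(* Supported on the barycentres of the triangles. *)
Definition bubble X1 X2 : R :=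
  if ((X1 %% 3)%Z == 1) && ((X2 %% 3)%Z == 1) then c (X1 %/ 3)%Z (X2 %/ 3)%Z
  else if ((X1 %% 3)%Z == 2) && ((X2 %% 3)%Z == 2) then
    - c (f1 - 1 - (X1 %/ 3)%Z) (f2 - 1 - (X2 %/ 3)%Z)
  else 0.

(** The value at an upper barycentre is dictated by antisymmetry. It is again a difference of two
    values of h, at the sample points turned into the upper triangle, so translations act on it as
    on the lower ones. *)
Lemma upper_weightE (a1 a2 : int) : - c (f1 - 1 - a1) (f2 - 1 - a2) =
  h (a1%:~R + (1 - p1)) (a2%:~R + (1 - p2)) -
  h (a1%:~R + (1 - p1 + p)) (a2%:~R + (1 - p2 - p)).
Proof.
rewrite /c; have -> : h ((f1 - 1 - a1)%:~R + p1) ((f2 - 1 - a2)%:~R + p2) =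
    - h (a1%:~R + (1 - p1)) (a2%:~R + (1 - p2)).
  by rewrite -h_reflect !intrB; congr h; ring.
have -> : h ((f1 - 1 - a1)%:~R + p1 - p) ((f2 - 1 - a2)%:~R + p2 + p) =
    - h (a1%:~R + (1 - p1 + p)) (a2%:~R + (1 - p2 - p)).
  by rewrite -h_reflect !intrB; congr h; ring.
by rewrite opprK opprD opprK.
Qed.

Variant bubble_spec : int -> int -> R -> Prop :=
  | BubbleLower a1 a2 : bubble_spec (3 * a1 + 1) (3 * a2 + 1) (c a1 a2)
  | BubbleUpper a1 a2 : bubble_spec (3 * a1 + 2) (3 * a2 + 2)
      (- c (f1 - 1 - a1) (f2 - 1 - a2))
  | BubbleNone X1 X2 of
      ~ ((X1 %% 3)%Z = 1 /\ (X2 %% 3)%Z = 1) &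
      ~ ((X1 %% 3)%Z = 2 /\ (X2 %% 3)%Z = 2) : bubble_spec X1 X2 0.

Lemma bubbleP X1 X2 : bubble_spec X1 X2 (bubble X1 X2).
Proof.
rewrite /bubble; case: ifPn => [/andP[/eqP m1 /eqP m2]|n1].
  have {1}-> : X1 = 3 * (X1 %/ 3)%Z + 1 by lia.
  have {1}-> : X2 = 3 * (X2 %/ 3)%Z + 1 by lia.
  exact: BubbleLower.
case: ifPn => [/andP[/eqP m1 /eqP m2]|n2].
  have {1}-> : X1 = 3 * (X1 %/ 3)%Z + 2 by lia.
  have {1}-> : X2 = 3 * (X2 %/ 3)%Z + 2 by lia.
  exact: BubbleUpper.
by apply: BubbleNone => -[m1 m2]; [move: n1|move: n2]; rewrite m1 m2 eqxx.
Qed.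

Lemma bubble_lower (a1 a2 : int) : bubble (3 * a1 + 1) (3 * a2 + 1) = c a1 a2.
Proof.
rewrite /bubble; have -> : ((3 * a1 + 1) %% 3)%Z = 1 by lia.
have -> : ((3 * a2 + 1) %% 3)%Z = 1 by lia.
by congr c; lia.
Qed.

Lemma bubble_upper (a1 a2 : int) : bubble (3 * a1 + 2) (3 * a2 + 2) =
  - c (f1 - 1 - a1) (f2 - 1 - a2).
Proof.
rewrite /bubble; have -> : ((3 * a1 + 2) %% 3)%Z = 2 by lia.
have -> : ((3 * a2 + 2) %% 3)%Z = 2 by lia.
by congr (- c _ _); lia.
Qed.

Lemma bubble_none X1 X2 : ~ ((X1 %% 3)%Z = 1 /\ (X2 %% 3)%Z = 1) ->
  ~ ((X1 %% 3)%Z = 2 /\ (X2 %% 3)%Z = 2) -> bubble X1 X2 = 0.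
Proof. by move=> n1 n2; rewrite /bubble; do 2 case: eqP; do 2 case: eqP; tauto. Qed.

Lemma bubble_reflect X1 X2 : bubble (3 * f1 - X1) (3 * f2 - X2) = - bubble X1 X2.
Proof.
case: (bubbleP X1 X2) => [a1 a2|a1 a2|{}X1 {}X2 n1 n2].
- have -> : 3 * f1 - (3 * a1 + 1) = 3 * (f1 - 1 - a1) + 2 by ring.
  have -> : 3 * f2 - (3 * a2 + 1) = 3 * (f2 - 1 - a2) + 2 by ring.
  by rewrite bubble_upper; congr (- c _ _); ring.
- have -> : 3 * f1 - (3 * a1 + 2) = 3 * (f1 - 1 - a1) + 1 by ring.
  have -> : 3 * f2 - (3 * a2 + 2) = 3 * (f2 - 1 - a2) + 1 by ring.
  by rewrite bubble_lower opprK.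
by rewrite oppr0 bubble_none //; lia.
Qed.

(** Neither the indices of a barycentre nor their sum are divisible by 3, so it lies on no vertex
    and no diagonal edge; among the triangles only its own contains it. *)
Lemma bubble_centreE I (a1 a2 : int) (b : bool) :
  diagonal_cell I \/ triangle_cell I \/ vertex_cell I ->
  I (third (3 * a1 + 1 + b%:R)) (third (3 * a2 + 1 + b%:R)) ->
  forall x y, I x y <-> box a1 a2 (a1 + a2 + b%:R) true true true x y.
Proof.
have bE (e : bool) : (e%:R : int)%:~R = e%:R :> R by case: e.
have T (a : int) : third (3 * a + 1 + b%:R) = a%:~R + (1 + b%:R) / 3.
  by rewrite /third !intrD intrM bE; field.
rewrite !T; case=> [[l1 [l2 IE]]|[[l1 [l2 [b' IE]]]|[l1 [l2 IE]]]] /IE[].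
- rewrite !intrD => _ _ b3; exfalso.
  have : (3 * (a1 + a2) + 2 + 2 * b%:R)%:~R = (3 * (l1 + l2 + 1))%:~R :> R.
    by rewrite !(intrD, intrM) bE; move: b3; case: (b) => /=; lra.
  by move=> /eqP; rewrite eqr_int; case: (b) => /=; lia.
- move=> /= b1 b2 b3 x y; rewrite IE.
  have A (a l : int) : l%:~R <= a%:~R + (1 + b%:R) / 3 :> R ->
      a%:~R + (1 + b%:R) / 3 <= l%:~R + 1 :> R -> l = a.
    move=> H1 H2.
    have : l < a + 1 by rewrite -(ltr_int R) intrD; case: (b) H1 => /=; lra.
    have : a < l + 1 by rewrite -(ltr_int R) intrD; case: (b) H2 => /=; lra.
    by lia.
  have l1E : l1 = a1 by case/andP: b1; exact: A.
  have l2E : l2 = a2 by case/andP: b2; exact: A.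
  rewrite -l1E -l2E.
  suff -> : b = b' by [].
  move: b3; rewrite !intrD bE l1E l2E.
  by case: (b); case: (b') => //=; lra.
rewrite /= addr0 => b1 _ _; exfalso.
have : (3 * a1 + 1 + b%:R)%:~R = (3 * l1)%:~R :> R.
  by rewrite !(intrD, intrM) bE; move: b1; case: (b) => /=; lra.
by move=> /eqP; rewrite eqr_int; case: (b) => /=; lia.
Qed.

(** Translation by the vertex preserves h on J and carries the two sample points in J to those of
    the translated triangle. *)
Lemma bubble_additive_vertex I J K : face h I J K -> vertex_cell I ->
  additive_on_grid bubble I J K.
Proof.
move=> F /vertex_cellE[a1 [a2 IE]] X1 X2 Y1 Y2 /IE[/third_inj_int-> /third_inj_int->] JY KZ.
have tr y1 y2 : J y1 y2 -> h (a1%:~R + y1) (a2%:~R + y2) = h y1 y2.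
  apply: (face_translation F); first by apply/IE.
    by move=> x1 x2 /IE[-> ->].
  by move=> x1 x2 /IE[-> ->].
have -> : bubble (3 * a1) (3 * a2) = 0 by apply: bubble_none; lia.
have cJ : diagonal_cell J \/ triangle_cell J \/ vertex_cell J.
  by case/vdt_cellP: (face_cell2 F); tauto.
rewrite add0r; case: (bubbleP Y1 Y2) JY {KZ} => [b1 b2|b1 b2|{}Y1 {}Y2 n1 n2] JY.
- have -> : 3 * a1 + (3 * b1 + 1) = 3 * (a1 + b1) + 1 by ring.
  have -> : 3 * a2 + (3 * b2 + 1) = 3 * (a2 + b2) + 1 by ring.
  have JE := @bubble_centreE J b1 b2 false cJ; rewrite /= !addr0 in JE.
  rewrite bubble_lower /c !intrD -!addrA; congr (_ - _); apply/esym/tr/JE => //.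
    by case: pT => /= h1 h2 h3; split=> /=; rewrite ?intrD; lra.
  by case: pT' => /= h1 h2 h3; split=> /=; rewrite ?intrD; lra.
- have -> : 3 * a1 + (3 * b1 + 2) = 3 * (a1 + b1) + 2 by ring.
  have -> : 3 * a2 + (3 * b2 + 2) = 3 * (a2 + b2) + 2 by ring.
  have E2 (b : int) : 3 * b + 2 = 3 * b + 1 + true%:R by rewrite /= -addrA.
  have JE := @bubble_centreE J b1 b2 true cJ; rewrite -!E2 in JE.
  rewrite bubble_upper !upper_weightE !intrD -!addrA.
  congr (_ - _); apply/esym/tr/JE => //.
    by case: pT => /= h1 h2 h3; split=> /=; rewrite ?intrD; lra.
  by case: pT' => /= h1 h2 h3; split=> /=; rewrite ?intrD; lra.
by rewrite bubble_none //; lia.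
Qed.

Lemma bubble_vanishes I X1 X2 :
  diagonal_cell I \/ triangle_cell I -> constant_on_diagonals h I ->
  I (third X1) (third X2) -> bubble X1 X2 = 0.
Proof.
move=> tI cI IX; have tI' : diagonal_cell I \/ triangle_cell I \/ vertex_cell I by tauto.
case: (bubbleP X1 X2) IX => [b1 b2|b1 b2|//] IX.
  have IE := @bubble_centreE I b1 b2 false tI'; rewrite /= !addr0 in IE.
  rewrite /c cI ?subrr //; apply/IE => //.
    by case: pT => /= h1 h2 h3; split=> /=; rewrite ?intrD; lra.
  by case: pT' => /= h1 h2 h3; split=> /=; rewrite ?intrD; lra.
have E2 (b : int) : 3 * b + 2 = 3 * b + 1 + true%:R by rewrite /= -addrA.
have IE := @bubble_centreE I b1 b2 true tI'; rewrite -!E2 in IE.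
rewrite upper_weightE.
have := cI (b1%:~R + (1 - p1)) (b2%:~R + (1 - p2)) (- p).
rewrite opprK -!addrA => ->; first by rewrite subrr.
  apply/IE => //.
  by case: pT => /= h1 h2 h3; split=> /=; rewrite ?intrD; lra.
apply/IE => //.
by case: pT' => /= h1 h2 h3; split=> /=; rewrite ?intrD; lra.
Qed.

Lemma bubble_solution (a1 a2 : int) :
  h (a1%:~R + p1) (a2%:~R + p2) != h (a1%:~R + p1 - p) (a2%:~R + p2 + p) ->
  grid_solution bubble.
Proof.
move=> ne; apply: grid_solution_of.
- by exists (3 * a1 + 1), (3 * a2 + 1); rewrite bubble_lower subr_eq0.
- move=> X1 X2 z1 z2; have E (X z : int) : X + z * (3 * q%:Z) = z * q%:Z * 3 + X by ring.
  rewrite /bubble !E !modzMDl !divzMDl //.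
  have cP (b1 b2 w1 w2 : int) : c (b1 + w1 * q%:Z) (b2 + w2 * q%:Z) = c b1 b2.
    rewrite /c ![(b1 + _)%:~R]intrD ![(b2 + _)%:~R]intrD -(h_periodic (b1%:~R + p1) _ w1 w2).
    rewrite -(h_periodic (b1%:~R + p1 - p) _ w1 w2).
    by congr (h _ _ - h _ _); ring.
  rewrite ![_ * q%:Z + _]addrC !cP; do 2 case: ifP => //.
  move=> _ _; congr (- _).
  have -> : f1 - 1 - ((X1 %/ 3)%Z + z1 * q%:Z) = f1 - 1 - (X1 %/ 3)%Z + (- z1) * q%:Z by ring.
  have -> : f2 - 1 - ((X2 %/ 3)%Z + z2 * q%:Z) = f2 - 1 - (X2 %/ 3)%Z + (- z2) * q%:Z by ring.
  by rewrite cP.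
- by move=> z1 z2; apply: bubble_none; lia.
apply: (face_wlog h_reflect).
- by move=> I J K; exact: additive_on_grid_swap.
- by move=> I J K; apply: additive_on_grid_reflect; exact: bubble_reflect.
- exact: bubble_additive_vertex.
- move=> I J K F dI tJ tK X1 X2 Y1 Y2 IX JY KZ.
  have [cI cJ cK] := face_diagonal_constant L0 h_lip h_int F (or_introl dI) tJ tK.
  by rewrite (bubble_vanishes _ cI IX) ?(bubble_vanishes _ cJ JY)
    ?(bubble_vanishes _ cK KZ) ?addr0 //; left.
move=> I J K F tI tJ tK X1 X2 Y1 Y2 IX JY KZ.
have [cI cJ cK] := face_diagonal_constant L0 h_lip h_int F
  (or_intror (And3 tI tJ tK)) (or_intror tJ) (or_intror tK).
by rewrite (bubble_vanishes _ cI IX) ?(bubble_vanishes _ cJ JY)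
  ?(bubble_vanishes _ cK KZ) ?addr0 //; right.
Qed.

End TriangleBubble.
End GridSolution.

(** * Perturbations that depend on the coordinate sum *)

Section Stripes.
Context {R : realType}.
Implicit Types (x y u t s : R) (I J K : R -> R -> Prop) (X Y : int).

Variable h : R -> R -> R.
Hypothesis h_diagonal : forall (a1 a2 : int) (b : bool),
  constant_on_diagonals h (box a1 a2 (a1 + a2 + b%:R) true true true).

(** Inside a vertical strip of width 1, a line along (-1,1) crosses a lower triangle and then the
    upper triangle of the square below it; the two meet where y = m - k. *)
Lemma diagonal_step x y (k : int) : k%:~R <= x <= k%:~R + 1 ->
  h x y = h k%:~R (x + y - k%:~R).
Proof.
move=> kx; set m := Num.floor (x + y).
have ms : m%:~R <= x + y < m%:~R + 1 := floor_bounds (x + y).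
have mk : (m - k)%:~R = m%:~R - k%:~R :> R by rewrite intrB.
have low x' y' u : box k (m - k) m true true true x' y' ->
    box k (m - k) m true true true (x' - u) (y' + u) ->
    h (x' - u) (y' + u) = h x' y'.
  by move: (@h_diagonal k (m - k) false x' y' u); rewrite /= addr0 subrKC.
have upp x' y' u : box k (m - k - 1) m true true true x' y' ->
    box k (m - k - 1) m true true true (x' - u) (y' + u) ->
    h (x' - u) (y' + u) = h x' y'.
  move: (@h_diagonal k (m - k - 1) true x' y' u).
  by have -> : k + (m - k - 1) + true%:R = m by rewrite /=; ring.
have mk1 : (m - k - 1)%:~R = m%:~R - k%:~R - 1 :> R by rewrite !intrB.
have e1 : h k%:~R (x + y - k%:~R) =
    h (k%:~R + (x + y - m%:~R)) (m%:~R - k%:~R).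
  have := low (k%:~R + (x + y - m%:~R)) (m%:~R - k%:~R) (x + y - m%:~R).
  have -> : k%:~R + (x + y - m%:~R) - (x + y - m%:~R) = k%:~R by ring.
  have -> : m%:~R - k%:~R + (x + y - m%:~R) = x + y - k%:~R by ring.
  by apply; rewrite /box mk /=; split; lra.
have [le|lt] := leP x (k%:~R + (x + y - m%:~R)).
  have := low x y (x - k%:~R).
  have -> : x - (x - k%:~R) = k%:~R by ring.
  have -> : y + (x - k%:~R) = x + y - k%:~R by ring.
  by move=> <- //; rewrite /box mk /=; split; lra.
rewrite e1; have := upp x y (x - (k%:~R + (x + y - m%:~R))).
have -> : x - (x - (k%:~R + (x + y - m%:~R))) = k%:~R + (x + y - m%:~R) by ring.
have -> : y + (x - (k%:~R + (x + y - m%:~R))) = m%:~R - k%:~R by ring.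
by move=> <- //; rewrite /box mk1 /=; split; lra.
Qed.

Lemma diagonal_profile x y : h x y = h 0 (x + y).
Proof.
have step (k : int) s : h (k + 1)%:~R (s - (k + 1)%:~R) = h k%:~R (s - k%:~R).
  rewrite (@diagonal_step _ _ k); last by rewrite intrD; lra.
  by congr h; rewrite intrD; ring.
have all (k : int) s : h k%:~R (s - k%:~R) = h 0 s.
  elim/int_ind: k => [|n IH|n IH]; first by rewrite subr0.
    by have -> : n.+1%:Z = n%:Z + 1; [lia|rewrite step].
  by rewrite -step; have -> : - n.+1%:Z + 1 = - n%:Z by lia.
have := floor_bounds x => /andP[l u].
rewrite (@diagonal_step x y (Num.floor x)); first exact: all.
by rewrite l ltW.
Qed.

Variables (g : R -> R -> R) (f1 f2 : int) (q : nat) (L : R).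
Hypothesis h_reflect : forall x y, h (f1%:~R - x) (f2%:~R - y) = - h x y.
Hypotheses (L0 : 0 <= L) (h_lip : lipschitz2 L h).
Hypothesis h_int : forall z1 z2 : int, h z1%:~R z2%:~R = 0.
Hypothesis h_periodic : forall x y (z1 z2 : int),
  h (x + (z1 * q%:Z)%:~R) (y + (z2 * q%:Z)%:~R) = h x y.
Hypothesis h_faces : forall x1 x2 y1 y2,
  g x1 x2 + g y1 y2 = g (x1 + y1) (x2 + y2) ->
  exists I J K, [/\ face h I J K, I x1 x2, J y1 y2 & K (x1 + y1) (x2 + y2)].

Variables (s0 : R) (k0 : int).
Hypothesis s0P : 0 < s0 < 1.

(** It commutes with integer translations and reflections and keeps each unit interval, which is all
    the additive relations see. For s0 > 1/2 it is not monotone. *)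
Definition relabel X : R := (X %/ 3)%Z%:~R +
  (if (X %% 3)%Z == 1 then s0 else if (X %% 3)%Z == 2 then 1 - s0 else 0).

Definition stripe X1 X2 : R := h 0 (relabel (X1 + X2)).

Lemma relabelD X (m : int) : relabel (3 * m + X) = m%:~R + relabel X.
Proof.
by rewrite /relabel [3 * m]mulrC modzMDl divzMDl // intrD addrA.
Qed.

Lemma relabel_add3 (a : int) : relabel (3 * a) = a%:~R.
Proof. by rewrite -[3 * a]addr0 relabelD /relabel /= !addr0. Qed.

Lemma relabelN X (m : int) : relabel (3 * m - X) = m%:~R - relabel X.
Proof.
rewrite /relabel; have : [\/ (X %% 3)%Z = 0, (X %% 3)%Z = 1 | (X %% 3)%Z = 2].
  have [|n0] := eqVneq (X %% 3)%Z 0; first by constructor 1.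
  have [|n1] := eqVneq (X %% 3)%Z 1; first by constructor 2.
  by constructor 3; lia.
case=> XE; rewrite XE /=.
- have -> : ((3 * m - X) %% 3)%Z = 0 by lia.
  have -> : ((3 * m - X) %/ 3)%Z = m - (X %/ 3)%Z by lia.
  by rewrite intrB /=; ring.
- have -> : ((3 * m - X) %% 3)%Z = 2 by lia.
  have -> : ((3 * m - X) %/ 3)%Z = m - (X %/ 3)%Z - 1 by lia.
  by rewrite !intrB /=; ring.
have -> : ((3 * m - X) %% 3)%Z = 1 by lia.
have -> : ((3 * m - X) %/ 3)%Z = m - (X %/ 3)%Z - 1 by lia.
by rewrite !intrB /=; ring.
Qed.

Lemma third_bounds X (l : int) : l%:~R <= @third R X <= l%:~R + 1 ->
  3 * l <= X <= 3 * l + 3.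
Proof.
rewrite /third => /andP[]; rewrite ler_pdivlMr // ler_pdivrMr // => H1 H2.
by apply/andP; split; rewrite -(ler_int R) ?intrD intrM; lra.
Qed.

Lemma relabel_bounds X (l : int) : 3 * l <= X <= 3 * l + 3 -> l%:~R <= relabel X <= l%:~R + 1.
Proof.
move: s0P => /andP[s1 s2] lX; have [->|ne] := eqVneq X (3 * l + 3).
  have -> : 3 * l + 3 = 3 * (l + 1) by ring.
  by rewrite relabel_add3 intrD; lra.
rewrite /relabel; have -> : (X %/ 3)%Z = l by lia.
by case: ifP => _; [|case: ifP => _]; apply/andP; split; lra.
Qed.

Lemma stripe_mod3 X1 X2 : ((X1 + X2) %% 3)%Z = 0 -> stripe X1 X2 = 0.
Proof.
move=> m; rewrite /stripe; have -> : X1 + X2 = 3 * ((X1 + X2) %/ 3)%Z by lia.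
by rewrite relabel_add3; exact: (h_int 0).
Qed.

Lemma stripe_reflect X1 X2 : stripe (3 * f1 - X1) (3 * f2 - X2) = - stripe X1 X2.
Proof.
rewrite /stripe; have -> : 3 * f1 - X1 + (3 * f2 - X2) = 3 * (f1 + f2) - (X1 + X2).
  by ring.
rewrite relabelN -h_reflect subr0 [RHS]diagonal_profile.
by rewrite intrD; congr h; ring.
Qed.

Lemma flat_cell I : vertex_cell I \/ diagonal_cell I ->
  exists k : int, forall x y, I x y -> x + y = k%:~R.
Proof.
case=> -[l1 [l2 IE]]; eexists => x y /IE[_ _ /=].
  by rewrite addr0 => ?; apply/eqP; rewrite eq_le andbC; eassumption.
by rewrite addr0 => ?; apply/eqP; rewrite eq_le andbC; eassumption.
Qed.

Lemma third_sum X1 X2 : third X1 + third X2 = third (X1 + X2) :> R.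
Proof. by rewrite thirdD. Qed.

Lemma stripe_additive_flat I J K : face h I J K ->
  vertex_cell I \/ diagonal_cell I -> additive_on_grid stripe I J K.
Proof.
move=> F /flat_cell[k Ik] X1 X2 Y1 Y2 IX JY KZ.
have XE : X1 + X2 = 3 * k by apply: (@third_inj_int R); rewrite thirdD; exact: Ik.
have -> : stripe X1 X2 = 0 by apply: stripe_mod3; rewrite XE; lia.
have SE : X1 + Y1 + (X2 + Y2) = 3 * k + (Y1 + Y2) by rewrite -XE; ring.
have [Y0|Y0] := eqVneq ((Y1 + Y2) %% 3)%Z 0.
  by rewrite !stripe_mod3 ?addr0 // SE; lia.
have tr y1 y2 : J y1 y2 -> h 0 (k%:~R + (y1 + y2)) = h 0 (y1 + y2).
  move=> Jy; have := face_translation F IX _ _ Jy.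
  rewrite [h y1 y2]diagonal_profile [h (_ + _) _]diagonal_profile.
  have -> : third X1 + y1 + (third X2 + y2) = k%:~R + (y1 + y2) by rewrite -(Ik _ _ IX); ring.
  apply=> [x1 x2 Ix|x1 x2 Ix].
    by rewrite diagonal_profile (Ik _ _ Ix); exact: (h_int 0).
  rewrite !(diagonal_profile (_ + _)); congr h.
  have -> : x1 + y1 + (x2 + y2) = x1 + x2 + (y1 + y2) by ring.
  by rewrite (Ik _ _ Ix).
rewrite add0r /stripe SE relabelD.
case/vdt_cellP: (face_cell2 F) => [vJ|dJ|[l1 [l2 [b JE]]]].
- have [k' Jk'] := flat_cell (or_introl vJ).
  have YE : Y1 + Y2 = 3 * k' by apply: (@third_inj_int R); rewrite thirdD; exact: Jk'.
  by rewrite YE in Y0; move: Y0; have -> : ((3 * k') %% 3)%Z = 0 by lia.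
- have [k' Jk'] := flat_cell (or_intror dJ).
  have YE : Y1 + Y2 = 3 * k' by apply: (@third_inj_int R); rewrite thirdD; exact: Jk'.
  by rewrite YE in Y0; move: Y0; have -> : ((3 * k') %% 3)%Z = 0 by lia.
have bE (e : bool) : (e%:R : int)%:~R = e%:R :> R by case: e.
move/JE: JY => [_ _]; rewrite third_sum => /third_bounds/relabel_bounds.
set r := relabel _; rewrite !intrD bE => rb.
(* This is the point with coordinate sum r on the vertical edge of J, the left edge of a lower
   triangle and the right edge of an upper one. *)
have := tr (l1%:~R + b%:R) (r - l1%:~R - b%:R).
have -> : l1%:~R + b%:R + (r - l1%:~R - b%:R) = r by ring.
move=> -> //; apply/JE; rewrite /box !intrD bE /=.
by case: (b) rb => /= rb; split; lra.
Qed.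

(** Every coordinate sum in the triangle occurs on its horizontal edge, where h is constant and
    starts with the value 0 at a vertex. *)
Lemma stripe_vanishes I X1 X2 : triangle_cell I ->
  (forall x y u, I x y -> I (x + u) y -> h (x + u) y = h x y) ->
  I (third X1) (third X2) -> stripe X1 X2 = 0.
Proof.
have bE (e : bool) : (e%:R : int)%:~R = e%:R :> R by case: e.
move=> [l1 [l2 [b IE]]] hI /IE[_ _].
rewrite third_sum => /third_bounds/relabel_bounds.
rewrite /stripe; set r := relabel _; rewrite !intrD bE => rb.
have := hI l1%:~R (l2 + b%:R)%:~R (r - l1%:~R - l2%:~R - b%:R).
rewrite h_int diagonal_profile intrD bE.
have -> : l1%:~R + (r - l1%:~R - l2%:~R - b%:R) + (l2%:~R + b%:R) = r by ring.
apply; apply/IE; rewrite /box !intrD bE /=;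
  by case: (b) rb => /= rb; split; lra.
Qed.

Lemma stripe_solution : h 0 (k0%:~R + s0) != 0 -> grid_solution g f1 f2 q stripe.
Proof.
move=> ne; apply: (grid_solution_of (h := h)) => //.
- exists 0, (3 * k0 + 1); rewrite /stripe add0r relabelD.
  by rewrite /relabel /= add0r.
- move=> X1 X2 z1 z2; rewrite /stripe.
  have -> : X1 + z1 * (3 * q%:Z) + (X2 + z2 * (3 * q%:Z)) =
    3 * ((z1 + z2) * q%:Z) + (X1 + X2) by ring.
  rewrite relabelD addrC -[RHS](h_periodic _ _ 0 (z1 + z2)).
  by rewrite mul0r addr0.
- by move=> z1 z2; apply: stripe_mod3; lia.
apply: (face_wlog h_reflect).
- by move=> I J K; exact: additive_on_grid_swap.
- by move=> I J K; apply: additive_on_grid_reflect; exact: stripe_reflect.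
- by move=> I J K F vI; apply: stripe_additive_flat F _; left.
- by move=> I J K F dI _ _; apply: stripe_additive_flat F _; right.
move=> I J K F tI tJ tK X1 X2 Y1 Y2 IX JY KZ.
have [hI hJ hK] := face_horizontal_constant L0 h_lip h_int F tI tJ tK.
by rewrite (stripe_vanishes tI hI IX) (stripe_vanishes tJ hJ JY)
  (stripe_vanishes tK hK KZ) addr0.
Qed.

End Stripes.

Lemma exists_grid_solution (R : realType) (g h : R -> R -> R) (f1 f2 : int)
    (q : nat) (L : R) :
  (forall x y, h (f1%:~R - x) (f2%:~R - y) = - h x y) ->
  0 <= L -> lipschitz2 L h -> h 0 0 = 0 ->
  (forall x y (z1 z2 : int),
     h (x + (z1 * q%:Z)%:~R) (y + (z2 * q%:Z)%:~R) = h x y) ->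
  (forall x1 x2 y1 y2, g x1 x2 + g y1 y2 = g (x1 + y1) (x2 + y2) ->
     exists I J K, [/\ face h I J K, I x1 x2, J y1 y2 & K (x1 + y1) (x2 + y2)]) ->
  (exists x y, h x y != 0) ->
  exists phi, grid_solution g f1 f2 q phi.
Proof.
move=> h_reflect L0 h_lip h00 h_periodic h_faces [x0 [y0 nz]].
have [h_int|] := pselect (forall z1 z2 : int, h z1%:~R z2%:~R = 0); last first.
  move=> /existsNP[z1 /existsNP[z2 /eqP nzz]].
  exists (fun X1 X2 => h (third X1) (third X2)); split.
  - by exists (3 * z1), (3 * z2); rewrite !third3.
  - move=> X1 X2 w1 w2; rewrite -[RHS](h_periodic _ _ w1 w2).
    by rewrite !third_period.
  - rewrite !third3; have := h_reflect 0 0; rewrite !subr0 h00 oppr0; exact.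
  move=> X1 X2 Y1 Y2; rewrite !thirdD => /h_faces[I [J [K [F IX JY KZ]]]].
  exact: (face_additive F IX JY KZ).
have [h_diagonal|] := pselect (forall (a1 a2 : int) (b : bool),
  constant_on_diagonals h (box a1 a2 (a1 + a2 + b%:R) true true true)).
  pose s := x0 + y0; pose k := Num.floor s.
  have ks : k%:~R <= s < k%:~R + 1 := floor_bounds s.
  have nzs : h 0 s != 0 by rewrite -(diagonal_profile h_diagonal).
  have kn : k%:~R != s.
    by apply: contraNneq nzs => <-; apply/eqP; exact: (h_int 0).
  have kl : k%:~R < s by rewrite lt_neqAle kn; case/andP: ks.
  exists (stripe h (s - k%:~R)).
  have sk : 0 < s - k%:~R < 1 by apply/andP; split; lra.
  apply: (stripe_solution h_diagonal h_reflect L0 h_lip h_int h_periodic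
    h_faces sk (k0 := k)).
  by rewrite subrKC.
move=> /existsNP[a1 /existsNP[a2 /existsNP[b]]].
move=> /existsNP[x /existsNP[y /existsNP[u /not_implyP[T0 /not_implyP[T1 ne]]]]].
have bE (e : bool) : (e%:R : int)%:~R = e%:R :> R by case: e.
case: b T0 T1 => [[/= b1 b2 b3] [/= c1 c2 c3]|[/= b1 b2 b3] [/= c1 c2 c3]].
  (* [bubble] is built from sample points in a lower triangle. For an upper one the reflection x ->
     f - x is applied first; it only changes the sign of h. *)
  pose p1 := a1%:~R + 1 - x; pose p2 := a2%:~R + 1 - y.
  exists (bubble h f1 f2 p1 p2 (- u)).
  apply: (@bubble_solution R g h f1 f2 q L h_reflect L0 h_lip h_int h_periodic
    h_faces p1 p2 (- u) _ _ (f1 - 1 - a1) (f2 - 1 - a2)).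
  - by rewrite /p1 /p2; split; rewrite /=; rewrite !intrD /= in b3 *; lra.
  - by rewrite /p1 /p2; split; rewrite /=; rewrite !intrD /= in b3 c3 *; lra.
  rewrite !intrB /=.
  have -> : f1%:~R - 1 - a1%:~R + p1 = f1%:~R - x by rewrite /p1; ring.
  have -> : f2%:~R - 1 - a2%:~R + p2 = f2%:~R - y by rewrite /p2; ring.
  have -> : f1%:~R - x - - u = f1%:~R - (x - u) by ring.
  have -> : f2%:~R - y + - u = f2%:~R - (y + u) by ring.
  by rewrite !h_reflect eqr_opp eq_sym; apply/eqP.
pose p1 := x - a1%:~R; pose p2 := y - a2%:~R.
exists (bubble h f1 f2 p1 p2 u).
apply: (@bubble_solution R g h f1 f2 q L h_reflect L0 h_lip h_int h_periodic
  h_faces p1 p2 u _ _ a1 a2).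
- by rewrite /p1 /p2; split; rewrite /=; rewrite addr0 !intrD /= in b3 *; lra.
- by rewrite /p1 /p2; split; rewrite /=; rewrite addr0 !intrD /= in b3 c3 *; lra.
rewrite /p1 /p2 !subrKC eq_sym; exact/eqP.
Qed.

(** * Subadditivity and interpolation from a grid *)

Section Forms.

(** For x = (a, b) and y = (c, d) these are the quantities bounded by the cells of x, y and x + y,
    three for each. *)
Definition forms (V : nmodType) (a b c d : V) : seq V :=
  [:: a; b; a + b; c; d; c + d; a + c; b + d; a + b + (c + d)].

(* The nine forms are arranged in a 3 x 3 table with zero line sums (up to sign
   in the last row and column), so that no line has exactly one nonintegral
   entry; a closed circuit of nonintegral entries gives a direction along which
   all of them can be moved while the integral ones stay fixed. *)
Definition lines : seq (nat * nat * nat) :=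
  [:: (0, 1, 2); (3, 4, 5); (6, 7, 8); (0, 3, 6); (1, 4, 7); (2, 5, 8)]%N.

Definition lonely (s : seq bool) (l : nat * nat * nat) : bool :=
  let: (i, j, k) := l in
  (nth false s i + nth false s j + nth false s k == 1)%N.

Fixpoint bit_seqs (n : nat) : seq (seq bool) :=
  if n is m.+1 then [seq b :: s | b <- [:: true; false], s <- bit_seqs m]
  else [:: [::]].

Lemma mem_bit_seqs s : s \in bit_seqs (size s).
Proof.
elim: s => [|b s IH] //; apply/allpairsP; exists (b, s); split=> //.
by case: b.
Qed.

Definition signs : seq int := [:: 1; -1; 0].

(* One orientation of each of the nine 4-circuits and six 6-circuits. *)
Definition directions : seq (int * int * (int * int)) :=
  [:: ((1, -1), (-1, 1)); ((1, -1), (-1, 0)); ((1, -1), (0, 1)); ((1, -1),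
  (0, 0)); ((1, 0), (-1, 1)); ((1, 0), (-1, 0)); ((1, 0), (0, -1)); ((1,
  0), (0, 0)); ((0, 1), (1, -1)); ((0, 1), (-1, 0)); ((0, 1), (0, -1));
  ((0, 1), (0, 0)); ((0, 0), (1, -1)); ((0, 0), (1, 0)); ((0, 0), (0,
  1))].

Lemma directions_signs u : u \in directions ->
  all [in signs] (forms u.1.1 u.1.2 u.2.1 u.2.2).
Proof. by move: u; apply/allP; vm_compute. Qed.

Definition moves_only (s : seq bool) (u : int * int * (int * int)) : bool :=
  let v := forms u.1.1 u.1.2 u.2.1 u.2.2 in
  has (fun x => x != 0) v &&
  all (fun p => p.1 || (p.2 == 0)) (zip s v).

(** A check of all 512 patterns of nonintegral entries: without a lonely line, the nonintegral
    entries contain a circuit. *)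
Lemma direction_table :
  all (fun s => has id s && ~~ has (lonely s) lines ==>
                has (moves_only s) directions) (bit_seqs 9).
Proof. by vm_compute. Qed.

End Forms.

Section SubadditiveFromGrid.
Context {R : realType}.
Implicit Types (x y t : R) (p : R * R * (R * R)).

Definition form p (k : 'I_9) : R := nth 0 (forms p.1.1 p.1.2 p.2.1 p.2.2) k.

Definition integral x : bool := x == (Num.floor x)%:~R.

Lemma integralP x : reflect (exists z : int, x = z%:~R) (integral x).
Proof.
apply: (iffP eqP) => [->|[z ->]]; first by eexists.
by rewrite intrKfloor.
Qed.

Lemma integralD x y : integral x -> integral y -> integral (x + y).
Proof.
by move=> /integralP[a ->] /integralP[b ->]; apply/integralP; exists (a + b); rewrite intrD.
Qed.

Lemma integralB x y : integral x -> integral y -> integral (x - y).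
Proof.
by move=> /integralP[a ->] /integralP[b ->]; apply/integralP; exists (a - b); rewrite intrB.
Qed.

Lemma integral_line x y :
  ((~~ integral x) + (~~ integral y) + (~~ integral (x + y)) == 1)%N = false.
Proof.
case: (boolP (integral x)) (boolP (integral y)) (boolP (integral (x + y)))
  => [ix|ix] [iy|iy] [iz|iz] //=; exfalso.
- by move/negP: iz; apply; exact: integralD.
- by move/negP: iy; apply; rewrite -(addrK x y) addrC [y + x]addrC addrC; exact: integralB.
by move/negP: ix; apply; rewrite -(addrK y x); exact: integralB.
Qed.

Definition shift p t (u : int * int * (int * int)) : R * R * (R * R) :=
  ((p.1.1 + t * u.1.1%:~R, p.1.2 + t * u.1.2%:~R),
   (p.2.1 + t * u.2.1%:~R, p.2.2 + t * u.2.2%:~R)).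

Definition dform (u : int * int * (int * int)) (k : 'I_9) : int :=
  nth 0 (forms u.1.1 u.1.2 u.2.1 u.2.2) k.

Lemma form_shift p t u k : form (shift p t u) k = form p k + t * (dform u k)%:~R.
Proof.
case: k => k k9; rewrite /form /dform.
by do 9 (case: k k9 => [|k] k9; first by rewrite /= ?intrD; ring).
Qed.

Definition fractional p : {set 'I_9} := [set k | ~~ integral (form p k)].

Lemma exists_direction p : fractional p != finset.set0 ->
  exists u, [/\ exists k, dform u k != 0,
    forall k, dform u k \in signs & forall k, dform u k != 0 -> k \in fractional p].
Proof.
case/set0Pn => k0; rewrite inE => k0f.
pose s := [seq ~~ integral x | x <- forms p.1.1 p.1.2 p.2.1 p.2.2].
have ss : size s = 9%N by [].
have := allP direction_table s; rewrite -{1}ss mem_bit_seqs => /(_ isT).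
have -> : has id s.
  apply/hasP; exists (~~ integral (form p k0)) => //.
  by apply/mapP; exists (form p k0) => //; apply: mem_nth.
have -> : has (lonely s) lines = false.
  rewrite /lonely /s /= !integral_line /=.
  have -> : p.1.1 + p.1.2 + (p.2.1 + p.2.2) = p.1.1 + p.2.1 + (p.1.2 + p.2.2).
    by rewrite addrACA.
  by rewrite !integral_line.
rewrite implyTb => /hasP[u /directions_signs/allP us].
case/andP => /hasP[x /(nthP 0)[i i9 <-] ui] /allP us0.
have sv : size (forms u.1.1 u.1.2 u.2.1 u.2.2) = 9%N by [].
exists u; split.
- by exists (Ordinal i9).
- by move=> k; apply/us/mem_nth; rewrite sv.
move=> k uk; rewrite inE.
have := us0 (nth (false, 0) (zip s (forms u.1.1 u.1.2 u.2.1 u.2.2)) k).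
rewrite mem_nth ?size_zip ?ss ?sv ?minnn // nth_zip //= => /(_ isT).
rewrite -/(dform u k) (negPf uk) orbF (nth_map 0) //.
Qed.

(** The moved forms have speed 1 or -1, so [room] is the time until each meets an integer. Stopping
    at the first such time, no form leaves its unit interval and one more is integral. *)
Lemma move_to_boundary p u : (exists k, dform u k != 0) ->
  (forall k, dform u k \in signs) ->
  (forall k, dform u k != 0 -> k \in fractional p) ->
  exists t, [/\ 0 < t, (#|fractional (shift p t u)| < #|fractional p|)%N &
    forall k, (Num.floor (form p k))%:~R <= form (shift p t u) k <=
      (Num.floor (form p k))%:~R + (form p k != (Num.floor (form p k))%:~R)%:R].
Proof.
move=> [k0 uk0] us uf.
pose room k := if dform u k == 1 then (Num.floor (form p k))%:~R + 1 - form p k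
               else form p k - (Num.floor (form p k))%:~R.
have fracP k : dform u k != 0 -> (Num.floor (form p k))%:~R < form p k.
  move=> /uf; rewrite inE => nk; have /andP[l _] := floor_bounds (form p k).
  by rewrite lt_neqAle l andbT eq_sym.
have room0 k : dform u k != 0 -> 0 < room k.
  move=> uk; have := fracP k uk; have := floor_bounds (form p k).
  by rewrite /room; case: ifP => _; lra.
have [k1 uk1 kmin] := @arg_minP _ R _ k0 (fun k => dform u k != 0) room uk0.
exists (room k1); have t0 := room0 k1 uk1.
have signP k : dform u k != 0 -> dform u k = 1 \/ dform u k = -1.
  by have := us k; rewrite !inE => /or3P[/eqP->|/eqP->|/eqP->]; [left|right|].
have bounds k : (Num.floor (form p k))%:~R <= form (shift p (room k1) u) k <=
      (Num.floor (form p k))%:~R + (form p k != (Num.floor (form p k))%:~R)%:R.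
  rewrite form_shift; have fb := floor_bounds (form p k).
  have [->|uk] := eqVneq (dform u k) 0.
    rewrite mulr0 addr0; case: eqVneq => [<-|_] /=; first by rewrite addr0 lexx.
    by lra.
  have fr := fracP k uk; rewrite gt_eqF //=.
  have := kmin k uk; rewrite /= {2}/room.
  by case: (signP k uk) => -> /=; lra.
split=> //; apply: proper_card; apply/fintype.properP; split.
  apply/fintype.subsetP => k; rewrite !inE; apply: contra => ik.
  rewrite form_shift; have [->|/uf] := eqVneq (dform u k) 0.
    by rewrite mulr0 addr0.
  by rewrite inE ik.
exists k1; first exact: uf.
rewrite inE negbK form_shift /room; apply/integralP.
case: (signP k1 uk1) => -> /=.
  by exists (Num.floor (form p k1) + 1); rewrite intrD; ring.
by exists (Num.floor (form p k1)); ring.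
Qed.

(** Induction on the number of nonintegral forms. Moving both ways along a direction reaches two
    pairs with fewer of them, in cells on which the defect of additivity is affine, and p lies
    between the two. *)
Lemma subadditive_from_grid (g : R -> R -> R) : cell_affine g ->
  (forall a1 a2 b1 b2 : int, g (a1 + b1)%:~R (a2 + b2)%:~R <=
     g a1%:~R a2%:~R + g b1%:~R b2%:~R) ->
  forall x1 x2 y1 y2, g (x1 + y1) (x2 + y2) <= g x1 x2 + g y1 y2.
Proof.
move=> ga gint; suff main n p : (#|fractional p| <= n)%N ->
    g (p.1.1 + p.2.1) (p.1.2 + p.2.2) <= g p.1.1 p.1.2 + g p.2.1 p.2.2.
  by move=> x1 x2 y1 y2; exact: (main _ ((x1, x2), (y1, y2)) (leqnn _)).
elim: n p => [|n IH] p pn.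
  have int k : integral (form p k).
    have : fractional p == finset.set0 by rewrite -cards_eq0 -leqn0.
    move=> /eqP E; apply/negPn/negP => nk.
    by have : k \in fractional p; [rewrite inE|rewrite E finset.in_set0].
  have := int (inord 0); have := int (inord 1); have := int (inord 3).
  have := int (inord 4); rewrite /form !inordK //=.
  by move=> /integralP[d ->] /integralP[c ->] /integralP[b ->] /integralP[a ->];
    rewrite -!intrD.
have [f0|f0] := eqVneq (fractional p) finset.set0.
  by apply: IH; rewrite f0 cards0.
have [u [unz us uf]] := exists_direction f0.
pose w := ((- u.1.1, - u.1.2), (- u.2.1, - u.2.2)).
have wE k : dform w k = - dform u k.
  case: k => k k9; rewrite /dform.
  by do 9 (case: k k9 => [|k] k9; first by rewrite /= ?opprD).
have [t [t0 tn tb]] := move_to_boundary unz us uf.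
have [s [s0 sn sb]] : exists t, [/\ 0 < t, (#|fractional (shift p t w)| < #|fractional p|)%N &
    forall k, (Num.floor (form p k))%:~R <= form (shift p t w) k <=
      (Num.floor (form p k))%:~R + (form p k != (Num.floor (form p k))%:~R)%:R].
  apply: move_to_boundary.
  - by case: unz => k uk; exists k; rewrite wE oppr_eq0.
  - by move=> k; rewrite wE; have := us k; rewrite !inE; lia.
  by move=> k; rewrite wE oppr_eq0; exact: uf.
have ge1 := IH _ (leq_trans tn pn); have ge2 := IH _ (leq_trans sn pn).
have [A1 [B1 [C1 E1]]] := floor_box_affine p.1.1 p.1.2 ga.
have [A2 [B2 [C2 E2]]] := floor_box_affine p.2.1 p.2.2 ga.
have [A3 [B3 [C3 E3]]] := floor_box_affine (p.1.1 + p.2.1) (p.1.2 + p.2.2) ga.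
have boxes (r : R) v : (forall k, (Num.floor (form p k))%:~R <= form (shift p r v) k <=
      (Num.floor (form p k))%:~R + (form p k != (Num.floor (form p k))%:~R)%:R) ->
    [/\ floor_box p.1.1 p.1.2 (shift p r v).1.1 (shift p r v).1.2,
        floor_box p.2.1 p.2.2 (shift p r v).2.1 (shift p r v).2.2 &
        floor_box (p.1.1 + p.2.1) (p.1.2 + p.2.2)
          ((shift p r v).1.1 + (shift p r v).2.1)
          ((shift p r v).1.2 + (shift p r v).2.2)].
  move=> H; split; split.
  - by have := H (inord 0); rewrite /form inordK.
  - by have := H (inord 1); rewrite /form inordK.
  - by have := H (inord 2); rewrite /form inordK.
  - by have := H (inord 3); rewrite /form inordK.
  - by have := H (inord 4); rewrite /form inordK.
  - by have := H (inord 5); rewrite /form inordK.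
  - by have := H (inord 6); rewrite /form inordK.
  - by have := H (inord 7); rewrite /form inordK.
  have := H (inord 8); rewrite /form inordK //=.
  have E (a b c d : R) : a + b + (c + d) = a + c + (b + d) by ring.
  by rewrite (E p.1.1 p.1.2) (E (p.1.1 + _) (p.1.2 + _)).
have [b1 b2 b3] := boxes _ _ tb; have [c1 c2 c3] := boxes _ _ sb.
move: ge1 ge2; rewrite (E1 _ _ b1) (E2 _ _ b2) (E3 _ _ b3).
rewrite (E1 _ _ c1) (E2 _ _ c2) (E3 _ _ c3).
rewrite (E1 _ _ (floor_boxE _ _)) (E2 _ _ (floor_boxE _ _)) (E3 _ _ (floor_boxE _ _)).
rewrite /= !mulrNz -subr_ge0 => ge1; rewrite -subr_ge0 => ge2; rewrite -subr_ge0.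
have ts : 0 < t + s by rewrite addr_gt0.
rewrite -(pmulr_rge0 _ ts).
(* The point p is the mean of p + t u and p - s u with weights s and t. *)
have := addr_ge0 (mulr_ge0 (ltW s0) ge1) (mulr_ge0 (ltW t0) ge2).
by congr (0 <= _); ring.
Qed.

End SubadditiveFromGrid.

(** * Piecewise linear interpolation and refinement *)

Section Interpolation.
Context {R : realType}.
Implicit Types (x y : R) (phi : int -> int -> R).

Definition interpolation phi x y : R :=
  let a := Num.floor x in let b := Num.floor y in
  let u := x - a%:~R in let v := y - b%:~R in
  if u + v <= 1 then
    phi a b * (1 - u - v) + phi (a + 1) b * u + phi a (b + 1) * v
  else phi (a + 1) (b + 1) * (u + v - 1) + phi a (b + 1) * (1 - u) +
       phi (a + 1) b * (1 - v).

Lemma interpolation_int phi (a b : int) : interpolation phi a%:~R b%:~R = phi a b.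
Proof.
by rewrite /interpolation !intrKfloor !subrr addr0 ler01; ring.
Qed.

(** Points on the right or top border of a closed triangle are evaluated by [interpolation] in a
    neighbouring square, which calls for a separate check. *)
Lemma floor_between x (a : int) : a%:~R <= x <= a%:~R + 1 ->
  (x < a%:~R + 1 /\ Num.floor x = a) \/ (x = a%:~R + 1 /\ Num.floor x = a + 1).
Proof.
move=> /andP[l]; rewrite le_eqVlt => /orP[/eqP ->|lt]; last first.
  by left; split=> //; apply: floor_unique; rewrite l.
by right; split=> //; rewrite -intrD1 intrKfloor.
Qed.

Lemma interpolation_affine phi : cell_affine (interpolation phi).
Proof.
move=> a b [].
  exists (phi (a + 1) (b + 1) - phi a (b + 1)), (phi (a + 1) (b + 1) - phi (a + 1) b).
  exists (phi (a + 1) (b + 1) * (- a%:~R - b%:~R - 1) + phi a (b + 1) * (1 + a%:~R) +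
    phi (a + 1) b * (1 + b%:~R)).
  rewrite /box /= !intrD => x y [b1 b2 b3]; rewrite /interpolation.
  have [[x1 ->]|[x1 ->]] := floor_between b1; have [[y1 ->]|[y1 ->]] := floor_between b2.
  - case: leP => [le|lt]; last by ring.
    have -> : y = a%:~R + b%:~R + 1 - x by lra.
    by ring.
  - by rewrite y1 !intrD ifT; [ring|lra].
  - by rewrite x1 !intrD ifT; [ring|lra].
  by rewrite x1 y1 !intrD ifT; [ring|lra].
exists (phi (a + 1) b - phi a b), (phi a (b + 1) - phi a b).
exists (phi a b * (1 + a%:~R + b%:~R) - phi (a + 1) b * a%:~R - phi a (b + 1) * b%:~R).
rewrite /box /= addr0 !intrD => x y [b1 b2 b3]; rewrite /interpolation.
have [[x1 ->]|[x1 ->]] := floor_between b1; have [[y1 ->]|[y1 ->]] := floor_between b2.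
- by rewrite ifT; [ring|lra].
- have -> : x = a%:~R by lra.
  by rewrite y1 !intrD ifT; [ring|lra].
- have -> : y = b%:~R by lra.
  by rewrite x1 !intrD ifT; [ring|lra].
by exfalso; lra.
Qed.

Lemma interpolation_periodic phi (m1 m2 : int) :
  (forall a b, phi (a + m1) (b + m2) = phi a b) ->
  forall x y, interpolation phi (x + m1%:~R) (y + m2%:~R) = interpolation phi x y.
Proof.
move=> per x y; rewrite /interpolation.
have fE (z : R) (m : int) : Num.floor (z + m%:~R) = Num.floor z + m.
  apply: floor_unique; have := floor_bounds z; rewrite !intrD; lra.
rewrite !fE ![_ + _ + 1]addrAC !per !intrD.
have E (z c m : R) : z + m - (c + m) = z - c by ring.
by rewrite !E.
Qed.

Lemma cell_affine_ge0 (g : R -> R -> R) : cell_affine g ->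
  (forall a b : int, 0 <= g a%:~R b%:~R) -> forall x y, 0 <= g x y.
Proof.
move=> ga g0 x y; set a := Num.floor x; set b := Num.floor y.
have := floor_bounds x; have := floor_bounds y; rewrite -/a -/b => hy hx.
have [le|lt] := leP (x + y) (a%:~R + b%:~R + 1).
  have [A [B [C gE]]] := ga a b false.
  have := g0 a b; have := g0 (a + 1) b; have := g0 a (b + 1).
  rewrite !gE; try (by rewrite /box /= addr0 !intrD; split; lra).
  rewrite !intrD => g1 g2 g3.
  have -> : A * x + B * y + C =
    (1 - (x - a%:~R) - (y - b%:~R)) * (A * a%:~R + B * b%:~R + C) +
    (x - a%:~R) * (A * (a%:~R + 1) + B * b%:~R + C) +
    (y - b%:~R) * (A * a%:~R + B * (b%:~R + 1) + C) by ring.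
  by rewrite !addr_ge0 // mulr_ge0 //; lra.
have [A [B [C gE]]] := ga a b true.
have := g0 (a + 1) (b + 1); have := g0 (a + 1) b; have := g0 a (b + 1).
rewrite !gE; try (by rewrite /box /= !intrD; split; lra).
rewrite !intrD => g1 g2 g3.
have -> : A * x + B * y + C =
  (x - a%:~R + (y - b%:~R) - 1) * (A * (a%:~R + 1) + B * (b%:~R + 1) + C) +
  (b%:~R + 1 - y) * (A * (a%:~R + 1) + B * b%:~R + C) +
  (a%:~R + 1 - x) * (A * a%:~R + B * (b%:~R + 1) + C) by ring.
by rewrite !addr_ge0 // mulr_ge0 //; lra.
Qed.

Lemma cell_affine_add (g h : R -> R -> R) (c : R) : cell_affine g ->
  cell_affine h -> cell_affine (fun x y => g x y + c * h x y).
Proof.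
move=> ga ha a b e; have [A [B [C gE]]] := ga a b e.
have [A' [B' [C' hE]]] := ha a b e.
exists (A + c * A'), (B + c * B'), (C + c * C') => x y bx.
by rewrite gE // hE //; ring.
Qed.

Lemma box_interior_witness (a1 a2 : int) (e : bool) : exists x y : R,
  [/\ a1%:~R < x < a1%:~R + 1, a2%:~R < y < a2%:~R + 1 &
      (a1 + a2 + e%:R)%:~R < x + y < (a1 + a2 + e%:R)%:~R + 1].
Proof.
case: e; [exists (a1%:~R + 2 / 3), (a2%:~R + 2 / 3)|
  exists (a1%:~R + 1 / 3), (a2%:~R + 1 / 3)];
  by rewrite !intrD /=; split; lra.
Qed.

(** No line of the coarse triangulation crosses the interior of a fine triangle, so the smallest
    coarse cell at an interior point of a fine triangle contains all of it. *)
Lemma cell_affine_refine (g : R -> R -> R) (n : nat) : (0 < n)%N ->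
  cell_affine g -> cell_affine (fun x y => g (x / n%:R) (y / n%:R)).
Proof.
move=> n0 ga a1 a2 e.
have np : (0 : R) < n%:R by rewrite ltr0n.
have nz : n%:R != 0 :> R by rewrite gt_eqF.
have [x [y [hx hy hs]]] := box_interior_witness a1 a2 e.
have [A [B [C gE]]] := floor_box_affine (x / n%:R) (y / n%:R) ga.
exists (A / n%:R), (B / n%:R), C => x' y' [b1 b2 b3] /=.
have key (l : int) (z z' : R) : l%:~R < z < l%:~R + 1 -> l%:~R <= z' <= l%:~R + true%:R ->
   (Num.floor (z / n%:R))%:~R <= z' / n%:R <=
   (Num.floor (z / n%:R))%:~R + (z / n%:R != (Num.floor (z / n%:R))%:~R)%:R.
  move=> hz hz'; set m := Num.floor _.
  have := floor_bounds (z / n%:R); rewrite -/m.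
  rewrite ler_pdivlMr // ltr_pdivrMr // => /andP[m1 m2].
  have e1 : m * n%:Z < l + 1 by rewrite -(ltr_int R) intrM intrD; lra.
  have e2 : l < (m + 1) * n%:Z by rewrite -(ltr_int R) intrM intrD; lra.
  have e3 : m%:~R * n%:R <= (l%:~R : R).
    have : m * n%:Z <= l by rewrite -ltzD1.
    by rewrite -(ler_int R) intrM.
  have e4 : l%:~R + 1 <= (m%:~R + 1) * n%:R :> R.
    have : l + 1 <= (m + 1) * n%:Z by rewrite lezD1.
    by rewrite -(ler_int R) intrM !intrD.
  have -> : z / n%:R != m%:~R.
    apply/eqP => E; have : z = m%:~R * n%:R by rewrite -E divfK.
    by lra.
  rewrite /= in hz' *.
  by rewrite ler_pdivlMr // ler_pdivrMr //; apply/andP; split; lra.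
have bE : floor_box (x / n%:R) (y / n%:R) (x' / n%:R) (y' / n%:R).
  split; [exact: key hx b1|exact: key hy b2|].
  by rewrite -!mulrDl; exact: key hs b3.
by rewrite gE //; ring.
Qed.

End Interpolation.

(** * Extremality and grid solutions *)

Lemma subadditive_mulrn (R : realType) (g : R -> R -> R) (n : nat) x y :
  g 0 0 = 0 -> (forall x1 x2 y1 y2, g (x1 + y1) (x2 + y2) <= g x1 x2 + g y1 y2) ->
  g (n%:R * x) (n%:R * y) <= n%:R * g x y.
Proof.
move=> g0 gsub; elim: n => [|n IH]; first by rewrite !mul0r g0.
rewrite -[n.+1]addn1 natrD !mulrDl !mul1r.
by apply: le_trans (gsub _ _ _ _) _; rewrite lerD2r.
Qed.

Section MinimalFunction.
Context {R : realType}.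
Implicit Types (x y : R) (u v : plane R).

Lemma Z2_0 : @Z2 R 0.
Proof. by split=> /=; exact: rpred0. Qed.

Lemma Z2_D u v : Z2 u -> Z2 v -> Z2 (u + v).
Proof. by case=> u1 u2 [v1 v2]; split=> /=; exact: rpredD. Qed.

Lemma Z2_N u : Z2 u -> Z2 (- u).
Proof. by case=> u1 u2; split=> /=; rewrite rpredN. Qed.

Lemma Z2_scaled q (z1 z2 : int) : (0 < q)%N ->
  @Z2 R (scaled q (z1 * q%:Z)%:~R (z2 * q%:Z)%:~R).
Proof.
move=> q0; have qn : q%:R != 0 :> R by rewrite pnatr_eq0 -lt0n.
by split; rewrite /scaled /= intrM mulfK //; exact: intr_int.
Qed.

Variables (q : nat) (f1 f2 : int) (pi : plane R -> R).
Let f : plane R := scaled q f1%:~R f2%:~R.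
Hypothesis pi_min : minimal Z2 f pi.
Let P x y := pi (scaled q x y).

Lemma scaled_subadditive x1 x2 y1 y2 : P (x1 + y1) (x2 + y2) <= P x1 x2 + P y1 y2.
Proof. by rewrite /P -scaledD; exact: (minimal_subadditive pi_min). Qed.

Lemma scaled_periodic (q0 : (0 < q)%N) x y (z1 z2 : int) :
  P (x + (z1 * q%:Z)%:~R) (y + (z2 * q%:Z)%:~R) = P x y.
Proof.
rewrite /P -scaledD; apply: (minimal_periodic Z2_0 Z2_D Z2_N pi_min).
exact: Z2_scaled.
Qed.

Lemma grid_periodic (q0 : (0 < q)%N) (X1 X2 z1 z2 : int) :
  P (third (X1 + z1 * (3 * q%:Z))) (third (X2 + z2 * (3 * q%:Z))) = P (third X1) (third X2).
Proof. by rewrite !third_period scaled_periodic. Qed.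

Lemma scaled_symmetric x y : P x y + P (f1%:~R - x) (f2%:~R - y) = 1.
Proof.
rewrite /P -[RHS](minimal_symmetric Z2_0 Z2_D Z2_N pi_min (scaled q x y)).
by congr (_ + pi _); rewrite /f /scaled !mulrBl.
Qed.

Lemma scaled_00 : P 0 0 = 0.
Proof.
rewrite /P; have -> : scaled q 0 0 = 0 :> plane R by rewrite /scaled !mul0r.
exact: (minimal_subgroup0 Z2_0 Z2_D Z2_N pi_min Z2_0).
Qed.

Lemma scaled_ge0 x y : 0 <= P x y.
Proof. exact: (minimal_ge0 pi_min). Qed.

Hypothesis P_affine : cell_affine P.

(** Cutting t d into n equal parts that lie in the linear range, subadditivity bounds the value by n
    times that of one part. *)
Lemma scaled_ray (d1 d2 : int) :
  (forall t, 0 <= t <= 1 -> P (t * d1%:~R) (t * d2%:~R) = t * P d1%:~R d2%:~R) ->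
  forall t, 0 <= t -> P (t * d1%:~R) (t * d2%:~R) <= t * P d1%:~R d2%:~R.
Proof.
move=> H t t0; pose n := (Num.truncn t).+1.
have np : (0 : R) < n%:R by rewrite ltr0n.
have tn : t <= n%:R by apply/ltW/truncnS_gt.
have E (d : int) : t * d%:~R = n%:R * (t / n%:R * d%:~R) by field; rewrite gt_eqF.
rewrite E (E d2); apply: le_trans (subadditive_mulrn _ _ _ scaled_00 scaled_subadditive) _.
rewrite H; last by rewrite divr_ge0 ?(ltW np) //= ler_pdivrMr ?mul1r.
by rewrite mulrA; have -> : n%:R * (t / n%:R) = t by field; rewrite gt_eqF.
Qed.

(** Linear growth from the origin, together with subadditivity, yields the Lipschitz constants. A
    point is split into its two axis-parallel parts, each on one of four rays that begin with an
    edge. *)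
Lemma scaled_linear_bound : exists2 C, 0 <= C &
  forall x y, P x y <= C * (`|x| + `|y|).
Proof.
have ray (d1 d2 a b : int) :
    (forall t, 0 <= t <= 1 -> box a b (a + b) true true true (t * d1%:~R) (t * d2%:~R : R)) ->
    forall t, 0 <= t -> P (t * d1%:~R) (t * d2%:~R) <= t * P d1%:~R d2%:~R.
  move=> H; apply: scaled_ray => t t01; have [A [B [C PE]]] := P_affine a b false.
  have bE : forall t, 0 <= t <= 1 -> box a b (a + b + false%:R) true true true (t * d1%:~R) (t * d2%:~R : R).
    by rewrite addr0.
  have := PE _ _ (bE 0 _); have := PE _ _ (bE 1 _); have := PE _ _ (bE t t01).
  rewrite !mul1r !mul0r scaled_00 !lexx ler01 => -> /(_ isT) -> /(_ isT) Z.
  by have -> : C = 0 by [move: Z; rewrite !mulr0 !add0r]; ring.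
pose C := P 1 0 + P (-1) 0 + P 0 1 + P 0 (-1).
have [p1 p2 p3 p4] : [/\ 0 <= P 1 0, 0 <= P (-1) 0, 0 <= P 0 1 & 0 <= P 0 (-1)].
  by split; exact: scaled_ge0.
exists C => [|x y]; first by rewrite /C !addr_ge0.
have axis (d1 d2 a b : int) t : 0 <= t -> P d1%:~R d2%:~R <= C ->
    (forall t, 0 <= t <= 1 -> box a b (a + b) true true true (t * d1%:~R) (t * d2%:~R : R)) ->
    P (t * d1%:~R) (t * d2%:~R) <= C * t.
  move=> t0 dC /ray/(_ t t0) Pt; apply: le_trans Pt _.
  by rewrite mulrC ler_wpM2r.
have -> : P x y = P (x + 0) (0 + y) by rewrite addr0 add0r.
apply: le_trans (scaled_subadditive _ _ _ _) _; rewrite mulrDr; apply: lerD.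
  case: (leP 0 x) => [x0|/ltW]; last rewrite -oppr_ge0 => x0.
    rewrite (ger0_norm x0); have := @axis 1 0 0 0 x x0; rewrite mulr1 mulr0; apply; first by rewrite /C; lra.
    by move=> t t01; rewrite /box /= !mulr1 !mulr0 !addr0; split; lra.
  rewrite -[`|x|]normrN (ger0_norm x0); have := @axis (-1) 0 (-1) 0 (- x) x0; rewrite mulrN1z mulrNN mulr1 mulr0.
  apply; first by rewrite /C; lra.
  by move=> t t01; rewrite /box /= !mulrN1 !mulr0 !addr0; split; lra.
case: (leP 0 y) => [y0|/ltW]; last rewrite -oppr_ge0 => y0.
  rewrite (ger0_norm y0); have := @axis 0 1 0 0 y y0; rewrite mulr1 mulr0; apply; first by rewrite /C; lra.
  by move=> t t01; rewrite /box /= !mulr1 !mulr0 !addr0 ?add0r; split; lra.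
rewrite -[`|y|]normrN (ger0_norm y0); have := @axis 0 (-1) 0 (-1) (- y) y0; rewrite mulrN1z mulrNN mulr1 mulr0.
apply; first by rewrite /C; lra.
by move=> t t01; rewrite /box /= !mulrN1 !mulr0 ?addr0 ?add0r; split; lra.
Qed.

End MinimalFunction.

(** Subadditivity gives g u - g u' <= g (u - u'). *)
Lemma subadditive_lipschitz (R : realType) (g : R -> R -> R) (C : R) :
  (forall x1 x2 y1 y2, g (x1 + y1) (x2 + y2) <= g x1 x2 + g y1 y2) ->
  (forall x y, g x y <= C * (`|x| + `|y|)) -> lipschitz2 C g.
Proof.
move=> gsub gC x y x' y'.
have half u v u' v' : g u v - g u' v' <= C * (`|u - u'| + `|v - v'|).
  rewrite lerBlDl; apply: le_trans (lerD (lexx _) (gC _ _)).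
  by apply: le_trans (gsub _ _ _ _); rewrite !subrKC.
rewrite ler_norml half andbT lerNl opprB.
by rewrite [`|x - _|]distrC [`|y - _|]distrC half.
Qed.

Lemma finite_lower_bound (R : realType) (T : finType) (F : T -> R) :
  (forall t, 0 < F t) -> exists2 e, 0 < e & forall t, e <= F t.
Proof.
move=> F0; suff [e e0 eF] : exists2 e : R, 0 < e & forall t, t \in enum T -> e <= F t.
  by exists e => // t; apply: eF; rewrite mem_enum.
elim: (enum T) => [|a s [e e0 eF]]; first by exists 1.
exists (Num.min e (F a)); first by rewrite lt_min e0 F0.
move=> t; rewrite inE ge_min => /predU1P[->|/eF->//]; by rewrite lexx orbT.
Qed.

Section Residue.
Variable n : nat.
Hypothesis n0 : (0 < n)%N.
Implicit Types X Y z : int.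

Definition residue X : nat := absz (X %% n%:Z)%Z.

Let n_neq0 : n%:Z != 0. Proof. by rewrite eqz_nat -lt0n. Qed.

Lemma residueE X : X = (residue X)%:Z + (X %/ n%:Z)%Z * n%:Z.
Proof. by rewrite gez0_abs ?modz_ge0 // addrC -divz_eq. Qed.

Lemma residue_lt X : (residue X < n)%N.
Proof. by rewrite -ltz_nat gez0_abs ?modz_ge0 // ltz_pmod. Qed.

Lemma residue_nat (a : nat) : (a < n)%N -> residue a = a.
Proof. by move=> an; rewrite /residue modz_nat modn_small. Qed.

Lemma residueD X Y : residue (X + Y) = ((residue X + residue Y) %% n)%N.
Proof.
by apply/eqP; rewrite -eqz_nat -modz_nat PoszD !gez0_abs ?modz_ge0 // modzDm.
Qed.

Lemma residue_period X z : residue (X + z * n%:Z) = residue X.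
Proof. by rewrite /residue addrC modzMDl. Qed.

End Residue.

Section Extremality.
Context {R : realType}.
Variables (q : nat) (f1 f2 : int) (pi : plane R -> R).
Hypothesis q0 : (0 < q)%N.
Let f : plane R := scaled q f1%:~R f2%:~R.
Hypotheses (pi_min : minimal Z2 f pi) (pi_pwl : pwl q pi).
Let P x y := pi (scaled q x y).

Lemma valid_perturbation (phi : int -> int -> R) (c : R) :
  (forall X1 X2 z1 z2 : int,
     phi (X1 + z1 * (3 * q%:Z)) (X2 + z2 * (3 * q%:Z)) = phi X1 X2) ->
  phi 0 0 = 0 -> phi (3 * f1) (3 * f2) = 0 ->
  (forall X1 X2 Y1 Y2,
     c * (phi (X1 + Y1) (X2 + Y2) - phi X1 X2 - phi Y1 Y2) <=
     P (third X1) (third X2) + P (third Y1) (third Y2) -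
     P (third (X1 + Y1)) (third (X2 + Y2))) ->
  valid Z2 f (fun v => pi v + c * interpolation phi (v.1 * (3 * q)%:R) (v.2 * (3 * q)%:R)).
Proof.
move=> per phi0 phif le.
have Q0 : (0 < 3 * q)%N by rewrite muln_gt0.
pose g x y := P (x / 3) (y / 3) + c * interpolation phi x y.
have scE x y : scaled (3 * q) x y = scaled q (x / 3) (y / 3) :> plane R.
  by rewrite /scaled natrM !invfM !mulrA.
set p := fun v => _.
have pE v : p v = g (v.1 * (3 * q)%:R) (v.2 * (3 * q)%:R).
  by rewrite /p /g /P -scE scaledK.
have ga : cell_affine g.
  apply: cell_affine_add; last exact: interpolation_affine.
  by apply: (cell_affine_refine (n := 3)) => //; exact: pwl_cell_affine.
have gint (a b : int) : g a%:~R b%:~R = P (third a) (third b) + c * phi a b.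
  by rewrite /g interpolation_int.
have gsub : forall x1 x2 y1 y2, g (x1 + y1) (x2 + y2) <= g x1 x2 + g y1 y2.
  by apply: subadditive_from_grid => // a1 a2 b1 b2; rewrite !gint; have := le a1 a2 b1 b2; lra.
have g00 : g 0 0 = 0.
  by rewrite -(mulr0z 1) gint /third mul0r phi0 mulr0 addr0; exact: (scaled_00 pi_min).
have gper x y (z1 z2 : int) :
    g (x + (z1 * (3 * q%:Z))%:~R) (y + (z2 * (3 * q%:Z))%:~R) = g x y.
  rewrite /g interpolation_periodic //.
  have E (u : R) (z : int) : (u + (z * (3 * q%:Z))%:~R) / 3 = u / 3 + (z * q%:Z)%:~R.
    by rewrite !intrM; field.
  by rewrite !E /P (scaled_periodic pi_min q0).
(* At grid points, periodicity and subadditivity give 0 = g (Q a) (Q b) <= Q g a b with Q = 3 q. *)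
have ge0 x y : 0 <= g x y.
  move: x y; apply: cell_affine_ge0 => // a b.
  have := subadditive_mulrn (3 * q)%N a%:~R b%:~R g00 gsub; have := gper 0 0 a b.
  rewrite !add0r g00 !intrM natrM ![_ * (3 * _)]mulrC => ->.
  by rewrite pmulr_rge0 // mulr_gt0 // ltr0n.
have Qn : (3 * q)%:R != 0 :> R by rewrite pnatr_eq0 -lt0n.
apply: subadditive_valid.
- by move=> v; rewrite pE.
- by rewrite pE /= !mul0r.
- by move=> u v; rewrite !pE /= !mulrDl.
move=> y [/intrP[z1 y1] /intrP[z2 y2]]; rewrite pE /f /scaled /=.
have E (a z : int) (w : R) : w = z%:~R -> (a%:~R / q%:R + w) * (3 * q)%:R =
    (3 * a)%:~R + (z * (3 * q%:Z))%:~R.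
  move=> ->; have qn : q%:R != 0 :> R by rewrite pnatr_eq0 -lt0n.
  by rewrite natrM !intrM; field.
rewrite (E _ _ _ y1) (E _ _ _ y2) gper gint phif mulr0 addr0 !third3.
have := scaled_symmetric pi_min f1%:~R f2%:~R; rewrite !subrr.
by rewrite (scaled_00 pi_min) addr0 /P => ->.
Qed.

Lemma not_extreme_of_grid_solution phi :
  grid_solution P f1 f2 q phi -> ~ extreme Z2 f pi.
Proof.
move=> [[W1 [W2 nz]] per phif add] [_ ext].
have phi0 : phi 0 0 = 0.
  have := add 0 0 0 0; rewrite !addr0 /third mul0r.
  by rewrite /P (scaled_00 pi_min) addr0 => /(_ erefl); lra.
pose D (u : int * int * (int * int)) : R :=
  P (third u.1.1) (third u.1.2) + P (third u.2.1) (third u.2.2) -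
  P (third (u.1.1 + u.2.1)) (third (u.1.2 + u.2.2)).
pose d (u : int * int * (int * int)) : R :=
  phi (u.1.1 + u.2.1) (u.1.2 + u.2.2) - phi u.1.1 u.1.2 - phi u.2.1 u.2.2.
have D0 u : 0 <= D u.
  by rewrite subr_ge0 !thirdD; exact: (scaled_subadditive pi_min).
have dD u : D u = 0 -> d u = 0.
  by move=> /eqP; rewrite subr_eq0 => /eqP /add; rewrite /d => <-; ring.
pose N := (3 * q)%N.
have N0 : (0 < N)%N by rewrite muln_gt0.
pose T := ('I_N * 'I_N * ('I_N * 'I_N))%type.
pose emb (t : T) : int * int * (int * int) :=
  ((t.1.1%:Z, t.1.2%:Z), (t.2.1%:Z, t.2.2%:Z)).
(* Pairs with D = 0 have d = 0 and do not restrict the size of the perturbation; the summand 1 keeps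
   the quotient meaningful when d = 0. *)
pose F (t : T) : R := if 0 < D (emb t) then D (emb t) / (`|d (emb t)| + 1) else 1.
have [t|e e0 eF] := @finite_lower_bound R T F.
  by rewrite /F; case: ifP => // Dt; rewrite divr_gt0 // ltr_wpDl.
have bound u : e * `|d u| <= D u.
  pose o (a : int) : 'I_N := Ordinal (residue_lt N0 a).
  pose t : T := ((o u.1.1, o u.1.2), (o u.2.1, o u.2.2)).
  have oE (a : int) : a = (o a)%:Z + (a %/ N)%Z * (3 * q%:Z) := residueE N0 a.
  have sumE (a b z w : int) : a + z * (3 * q%:Z) + (b + w * (3 * q%:Z)) =
      a + b + (z + w) * (3 * q%:Z) by ring.
  have DE : D u = D (emb t).
    rewrite /D; rewrite (oE u.1.1) (oE u.1.2) (oE u.2.1) (oE u.2.2).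
    by rewrite !sumE /P !(grid_periodic pi_min q0).
  have dE : d u = d (emb t).
    rewrite /d; rewrite (oE u.1.1) (oE u.1.2) (oE u.2.1) (oE u.2.2).
    by rewrite !sumE !per.
  rewrite DE dE; have := eF t; rewrite /F; case: ltP => [Dt|Dt] et.
    have d1 : 0 < `|d (emb t)| + 1 by rewrite ltr_wpDl.
    apply: (@le_trans _ _ (e * (`|d (emb t)| + 1))).
      by rewrite ler_pM2l // lerDl.
    by rewrite -ler_pdivlMr.
  have Dt0 : D (emb t) = 0 by apply/eqP; rewrite eq_le Dt D0.
  by rewrite Dt0 dD // normr0 mulr0.
have valid_c c : `|c| = e ->
  valid Z2 f (fun v => pi v + c * interpolation phi (v.1 * (3 * q)%:R) (v.2 * (3 * q)%:R)).
  move=> ce; apply: valid_perturbation => // X1 X2 Y1 Y2.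
  apply: le_trans (bound ((X1, X2), (Y1, Y2))); rewrite -ce -normrM.
  exact: ler_norm.
have v1 : valid Z2 f (fun v => pi v + e * interpolation phi (v.1 * (3 * q)%:R) (v.2 * (3 * q)%:R)).
  by apply: valid_c; rewrite gtr0_norm.
have v2 : valid Z2 f (fun v => pi v + (- e) * interpolation phi (v.1 * (3 * q)%:R) (v.2 * (3 * q)%:R)).
  by apply: valid_c; rewrite normrN gtr0_norm.
have [|piE _] := ext _ _ v1 v2; first by move=> r; field.
have Qn : (3 * q)%:R != 0 :> R by rewrite pnatr_eq0 -lt0n.
have /= := congr1 (fun p => p (scaled (3 * q) W1%:~R W2%:~R)) piE.
rewrite !divfK // interpolation_int => /eqP.
by rewrite -subr_eq0 opprD addrA subrr sub0r oppr_eq0 mulf_eq0 gt_eqF //= (negPf nz).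
Qed.

Lemma grid_solution_of_not_extreme : diagonally_constrained q pi ->
  ~ extreme Z2 f pi -> exists phi, grid_solution P f1 f2 q phi.
Proof.
move=> dc; have [vpi _] := pi_min.
move=> /not_andP[//|] /existsNP[pi1 /existsNP[pi2 /not_implyP[v1 /not_implyP[v2]]]].
move=> /not_implyP[piE ne].
have m1 := minimal_half pi_min v1 v2 piE.
have sub1 := minimal_subadditive m1; have sub := minimal_subadditive pi_min.
have m2 : minimal Z2 f pi2.
  by apply: (minimal_half pi_min v2 v1) => r; rewrite piE addrC.
have sub2 := minimal_subadditive m2.
pose P1 x y := pi1 (scaled q x y).
pose h x y := P1 x y - P x y.
have Pa : cell_affine P by exact: pwl_cell_affine.
have [C C0 PC] := scaled_linear_bound pi_min Pa.
have P_lip : lipschitz2 C P.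
  by apply: subadditive_lipschitz PC; exact: (scaled_subadditive pi_min).
(* pi1 need not be piecewise linear, but pi1 <= 2 pi because pi2 is nonnegative, so it inherits the
   linear bound. *)
have P1_lip : lipschitz2 (2 * C) P1.
  apply: subadditive_lipschitz => [|x y]; first exact: (scaled_subadditive m1).
  have := PC x y; have := piE (scaled q x y); case: v2 => /(_ (scaled q x y)).
  by rewrite /P1 /P => h2 _ -> h1; lra.
apply: (@exists_grid_solution R P h f1 f2 q (2 * C + C)).
- move=> x y; have := scaled_symmetric pi_min x y.
  by have := scaled_symmetric m1 x y; rewrite /h /P1 /P; lra.
- by rewrite addr_ge0 // mulr_ge0.
- move=> x y x' y'; rewrite mulrDl.
  have -> : h x y - h x' y' = (P1 x y - P1 x' y') - (P x y - P x' y') by rewrite /h; ring.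
  exact: le_trans (ler_normB _ _) (lerD (P1_lip _ _ _ _) (P_lip _ _ _ _)).
- by rewrite /h /P1 /P (scaled_00 m1) (scaled_00 pi_min) subrr.
- by move=> x y z1 z2; rewrite /h /P1 /P (scaled_periodic m1 q0) (scaled_periodic pi_min q0).
- move=> x1 x2 y1 y2 Padd.
  have [I [J [K [F Ix Jy Kz]]]] := exists_additive_face q0 pi_pwl dc sub Padd.
  exists I, J, K; split=> //; case: F => cI cJ cK oI oJ oK addF; split=> //.
  (* The defect of pi is the mean of those of pi1 and pi2, which are nonnegative; where it vanishes,
     so do both. *)
  move=> u1 u2 w1 w2 Iu Jw Kuw; have := addF _ _ _ _ Iu Jw Kuw.
  rewrite /h /P1 /P !piE -!scaledD.
  have := sub1 (scaled q u1 u2) (scaled q w1 w2).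
  by have := sub2 (scaled q u1 u2) (scaled q w1 w2); lra.
apply: contrapT => hz; apply: ne.
have h0 x y : h x y = 0.
  by apply/eqP/negPn/negP => hxy; apply: hz; exists x, y.
have E : pi = pi1.
  apply/funext => v; have := h0 (v.1 * q%:R) (v.2 * q%:R).
  by rewrite /h /P1 /P scaledK // => /eqP; rewrite subr_eq0 => /eqP.
split=> //; apply/funext => v; have := piE v.
by rewrite -E; lra.
Qed.

End Extremality.

(** * Total correctness with time bounds *)

Section HoareTriples.
Context {R : realType}.
Implicit Types (m : nat -> nat) (r : nat -> R) (d : nat) (c : cmd).

(** The natural memory is read at literal addresses only; indirect addressing is reserved to the
    real memory. *)
Fixpoint reads_below d (e : iexpr) : bool :=
  match e with
  | ICell (ICst j) => (j < d)%N
  | ICell _ => false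
  | ICst _ => true
  | IAdd a b | ISub a b | IMul a b => reads_below d a && reads_below d b
  end.

Fixpoint rreads_below d (e : rexpr) : bool :=
  match e with
  | RCell a => reads_below d a
  | RCst _ => true
  | RAdd a b | RSub a b | RMul a b | RDiv a b =>
      rreads_below d a && rreads_below d b
  end.

Definition agree d m (s : @state R) : Prop := forall j, (j < d)%N -> imem s j = m j.

Lemma ieval_agree d m s r e : agree d m s -> reads_below d e ->
  ieval s e = ieval (State m r) e.
Proof.
move=> ag; elim: e => //= [[]//= j _ /ag //|a IHa b IHb|a IHa b IHb|a IHa b IHb] /andP[ra rb];
  by rewrite IHa ?IHb.
Qed.

Lemma reval_agree d m s e : agree d m s -> rreads_below d e ->
  reval s e = reval (State m (rmem s)) e.
Proof.
move=> ag; elim: e => //= [a ra|a IHa b IHb|a IHa b IHb|a IHa b IHb|a IHa b IHb];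
  first by rewrite (ieval_agree (rmem s) ag ra).
all: by case/andP=> ra rb; rewrite IHa ?IHb.
Qed.

(* Cells below d of the natural memory hold the memory layout and the counters
   of the enclosing loops, which c must leave unchanged. *)
Definition triple d m (P Q : (nat -> R) -> Prop) c (T : nat) : Prop :=
  forall s, agree d m s -> P (rmem s) ->
  exists t s', [/\ exec c s t s', (t <= T)%N, agree d m s' & Q (rmem s')].

Lemma triple_conseq d m (P P' Q Q' : (nat -> R) -> Prop) c T T' :
  (forall r, P r -> P' r) -> (forall r, Q' r -> Q r) -> (T' <= T)%N ->
  triple d m P' Q' c T' -> triple d m P Q c T.
Proof.
move=> PP QQ TT H s ag /PP Ps; have [t [s' [ex tT ag' Qs]]] := H s ag Ps.
by exists t, s'; split; [|exact: leq_trans TT| |exact: QQ].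
Qed.

Lemma triple_seq d m P Q Q' c1 c2 T1 T2 :
  triple d m P Q c1 T1 -> triple d m Q Q' c2 T2 ->
  triple d m P Q' (Seq c1 c2) (T1 + T2)%N.
Proof.
move=> H1 H2 s ag Ps; have [t1 [s1 [ex1 tT1 ag1 Qs]]] := H1 s ag Ps.
have [t2 [s2 [ex2 tT2 ag2 Qs']]] := H2 s1 ag1 Qs.
exists (t1 + t2)%N, s2; split=> //; first exact: exec_seq ex1 ex2.
exact: leq_add.
Qed.

Lemma triple_rset d m (P Q : (nat -> R) -> Prop) a e :
  reads_below d a -> rreads_below d e ->
  (forall r, P r -> Q (upd r (ieval (State m r) a) (reval (State m r) e))) ->
  triple d m P Q (RSet a e) (icost a + rcost e).+1.
Proof.
move=> ra re H s ag Ps; exists (icost a + rcost e).+1.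
exists (State (imem s) (upd (rmem s) (ieval s a) (reval s e))); split=> //.
  exact: exec_rset.
by rewrite /= (ieval_agree (rmem s) ag ra) (reval_agree ag re); exact: H.
Qed.

Definition Var (j : nat) : iexpr := ICell (ICst j).

Definition For d (e : iexpr) c : cmd :=
  Seq (ISet (ICst d) (ICst 0))
      (While (BNot (BIle e (Var d)))
             (Seq c (ISet (ICst d) (IAdd (Var d) (ICst 1))))).

(** An iteration costs k + 4 for the guard, T for the body, 6 for the increment and 1 for the loop;
    the last test costs k + 5 and the initialisation 3. *)
Definition for_cost (n T k : nat) : nat := (n * (T + k + 11) + k + 8)%N.

Lemma agree_upd d m s k : agree d m s -> imem s d = k -> agree d.+1 (upd m d k) s.
Proof.
move=> ag sd j; rewrite ltnS leq_eqVlt /upd => /predU1P[->|jd]; first by rewrite eqxx.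
by rewrite ltn_eqF // ag.
Qed.

Lemma agree_pred d m k s : agree d.+1 (upd m d k) s -> agree d m s /\ imem s d = k.
Proof.
move=> ag; split=> [j jd|].
  by rewrite ag ?ltnS 1?ltnW // /upd ltn_eqF.
by rewrite ag // /upd eqxx.
Qed.

Lemma triple_for d m (Inv : nat -> (nat -> R) -> Prop) e c n T :
  reads_below d e -> (forall r, ieval (State m r) e = n) ->
  (forall k, (k < n)%N -> triple d.+1 (upd m d k) (Inv k) (Inv k.+1) c T) ->
  triple d m (Inv 0%N) (Inv n) (For d e c) (for_cost n T (icost e)).
Proof.
move=> re en body s ag Is.
(* Induction on the number k of remaining iterations. *)
have loop k s1 : (k <= n)%N -> agree d.+1 (upd m d (n - k)%N) s1 ->
    Inv (n - k)%N (rmem s1) -> exists t s', [/\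
    exec (While (BNot (BIle e (Var d)))
           (Seq c (ISet (ICst d) (IAdd (Var d) (ICst 1))))) s1 t s',
    (t <= k * (T + icost e + 11) + icost e + 5)%N, agree d m s' & Inv n (rmem s')].
  elim: k s1 => [|k IH] s1 kn ag1 I1.
    have [ag2 s1d] := agree_pred ag1; rewrite subn0 in s1d I1.
    exists (bcost (BNot (BIle e (Var d)))).+1, s1; split=> //.
      by apply: exec_while_false; rewrite /= negbK (ieval_agree (rmem s1) ag2 re) en s1d.
    by rewrite /=; lia.
  have [ag2 s1d] := agree_pred ag1.
  have nk : (n - k.+1 < n)%N by lia.
  have [t1 [s2 [ex1 t1T ag3 I3]]] := body _ nk s1 ag1 I1.
  have [ag4 s2d] := agree_pred ag3.
  pose s3 := State (upd (imem s2) d (n - k)%N) (rmem s2).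
  have ex2 : exec (ISet (ICst d) (IAdd (Var d) (ICst 1))) s2 6 s3.
    have := @exec_iset R s2 (ICst d) (IAdd (Var d) (ICst 1)).
    by rewrite /= s2d /s3; have -> : (n - k.+1 + 1 = n - k)%N by lia.
  have ag5 : agree d.+1 (upd m d (n - k)%N) s3.
    apply: agree_upd => [j jd|]; last by rewrite /s3 /= /upd eqxx.
    by rewrite /s3 /= /upd ltn_eqF // ag4.
  have I5 : Inv (n - k)%N (rmem s3).
    by rewrite /s3 /=; have -> : (n - k = (n - k.+1).+1)%N by lia.
  have [t3 [s4 [ex4 t4 ag6 I6]]] := IH s3 (ltnW kn) ag5 I5.
  exists (bcost (BNot (BIle e (Var d))) + (t1 + 6) + t3).+1, s4; split=> //.
    apply: exec_while_true ex4; last exact: exec_seq ex1 ex2.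
    by rewrite /= (ieval_agree (rmem s1) ag2 re) en s1d; lia.
  by rewrite /=; lia.
pose s1 := State (upd (imem s) d 0%N) (rmem s).
have ag1 : agree d.+1 (upd m d (n - n)%N) s1.
  rewrite subnn; apply: agree_upd => [j jd|]; last by rewrite /s1 /= /upd eqxx.
  by rewrite /s1 /= /upd ltn_eqF // ag.
have I1 : Inv (n - n)%N (rmem s1) by rewrite subnn.
have [t [s' [ex tT ag' I']]] := loop n s1 (leqnn n) ag1 I1.
exists (3 + t)%N, s'; split=> //; last by rewrite /for_cost; lia.
apply: exec_seq ex; exact: (@exec_iset R s (ICst d) (ICst 0)).
Qed.

End HoareTriples.

(** * Gaussian elimination *)

Section Elimination.
Context {R : realType}.
Variable N : nat.
Implicit Types (V : nat -> nat -> R) (S T : (nat -> R) -> Prop) (W : (nat -> R) -> R).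

Definition subspace S : Prop :=
  forall a u v, S u -> S v -> S (fun i => a * u i + v i).

Definition linear_form W : Prop :=
  (forall a u v, W (fun i => a * u i + v i) = a * W u + W v) /\
  (forall u v, (forall i, (i < N)%N -> u i = v i) -> W u = W v).

Definition spans S V : Prop :=
  (forall k, (k < N)%N -> S (V k)) /\
  (forall v, S v -> exists a : nat -> R,
     forall i, (i < N)%N -> v i = \sum_(k < N) a k * V k i).

(* One pivoting step; as x / 0 = 0, it does nothing if W vanishes on V j. *)
Definition pivot W j V : nat -> nat -> R :=
  fun k i => V k i - W (V k) / W (V j) * V j i.

Lemma linear_form0 W : linear_form W -> W (fun=> 0) = 0.
Proof.
move=> [lin _]; have := lin (-1) (fun=> 0) (fun=> 0).
have -> : (fun _ : nat => -1 * 0 + 0 : R) = fun=> 0.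
  by apply/funext => i; rewrite mulr0 addr0.
by rewrite mulN1r addNr.
Qed.

Lemma linear_form_sum W n (a : nat -> R) V : linear_form W ->
  W (fun i => \sum_(k < n) a k * V k i) = \sum_(k < n) a k * W (V k).
Proof.
move=> lW; have [lin _] := lW; elim: n => [|n IH].
  rewrite big_ord0; have -> : (fun i => \sum_(k < 0) a k * V k i) = fun=> 0.
    by apply/funext => i; rewrite big_ord0.
  exact: linear_form0.
rewrite big_ord_recr /= -IH addrC -lin; congr W; apply/funext => i.
by rewrite big_ord_recr /= addrC.
Qed.

Lemma pivotE W j V : pivot W j V = fun k i => - (W (V k) / W (V j)) * V j i + V k i.
Proof. by apply/funext => k; apply/funext => i; rewrite /pivot mulNr addrC. Qed.

Lemma pivot_form W j V k : linear_form W ->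
  W (pivot W j V k) = W (V k) - W (V k) / W (V j) * W (V j).
Proof. by move=> [lin _]; rewrite pivotE lin mulNr addrC. Qed.

Definition pivoting S W j V : Prop :=
  [/\ forall k, (k < N)%N -> S (V k),
      forall v, S v -> W v = 0 -> exists a : nat -> R,
        forall i, (i < N)%N -> v i = \sum_(k < N) a k * V k i &
      forall k, (k < j)%N -> W (V k) = 0].

(** The coefficients of v need not change: pivoting alters their combination by W v / W (V j) times
    V j, and W v = 0. If W (V j) is nonzero, row j becomes 0 and stays in the list. *)
Lemma pivoting_step S W j V : subspace S -> linear_form W -> (j < N)%N ->
  pivoting S W j V -> pivoting S W j.+1 (pivot W j V).
Proof.
move=> sS lW jN [SV span zero]; split.
- by move=> k kN; rewrite pivotE; apply: sS; exact: SV.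
- move=> v Sv Wv; have [a vE] := span v Sv Wv.
  exists a => i iN; rewrite vE // /pivot.
  under [RHS]eq_bigr do rewrite mulrBr.
  rewrite sumrB; have -> : \sum_(k < N) a k * (W (V k) / W (V j) * V j i) =
      W v / W (V j) * V j i.
    have -> : W v = \sum_(k < N) a k * W (V k).
      by rewrite -(linear_form_sum _ _ _ lW); apply: lW.2.
    rewrite !mulr_suml.
    by apply: eq_bigr => k _; rewrite !mulrA.
  by rewrite Wv !mul0r subr0.
move=> k; rewrite ltnS leq_eqVlt pivot_form // => kj.
have [Wj|Wj] := eqVneq (W (V j)) 0; last by rewrite divfK // subrr.
rewrite Wj mulr0 subr0; case/predU1P: kj => [->//|]; exact: zero.
Qed.

Lemma spans_pivoting S W V : spans S V -> pivoting S W 0 V.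
Proof. by move=> [SV span]; split=> // v Sv _; exact: span. Qed.

Lemma pivoting_spans S W V : pivoting S W N V ->
  spans (fun v => S v /\ W v = 0) V.
Proof.
move=> [SV span zero]; split=> [k kN|v [Sv Wv]]; last exact: span.
by split; [exact: SV|exact: zero].
Qed.

Lemma subspaceI S T : subspace S -> subspace T -> subspace (fun v => S v /\ T v).
Proof. by move=> sS sT a u v [Su Tu] [Sv Tv]; split; [exact: sS|exact: sT]. Qed.

Lemma subspace_kernel W : linear_form W -> subspace (fun v => W v = 0).
Proof. by move=> [lin _] a u v Wu Wv; rewrite lin Wu Wv mulr0 addr0. Qed.

Lemma spans_trivial S V : spans S V ->
  ((forall k i, (k < N)%N -> (i < N)%N -> V k i = 0) <->
   (forall v, S v -> forall i, (i < N)%N -> v i = 0)).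
Proof.
move=> [SV span]; split=> [V0 v /span[a vE] i iN|S0 k i kN iN].
  by rewrite vE // big1 // => k _; rewrite V0 ?mulr0.
by apply: S0 => //; exact: SV.
Qed.

Lemma spans_identity : spans (fun=> True) (fun k i => (k == i)%:R).
Proof.
split=> // v _; exists v => i iN.
rewrite (bigD1 (Ordinal iN)) //= eqxx mulr1 big1 ?addr0 // => k ki.
by rewrite (negPf (_ : _ != i)) ?mulr0 //; apply: contra ki => /eqP ki; apply/eqP/val_inj.
Qed.

End Elimination.

(** * The program *)

(* Contents of cells 0 to 7 of the natural memory: q, the width 3 q of the
   refined grid, the number of unknowns, and the base addresses of the reals
   0, 1, 2, 3, of the refined table of pi, of the matrix whose rows span the
   solutions, of a copy of the pivot row, and of a scratch cell. *)
Definition lay (q : nat) (j : nat) : nat :=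
  let Q := (3 * q)%N in let N := (Q * Q)%N in let B0 := (2 + q * q)%N in
  let B1 := (B0 + 4)%N in let B2 := (B1 + N)%N in let B3 := (B2 + N * N)%N in
  nth 0%N [:: q; Q; N; B0; B1; B2; B3; (B3 + N)%N] j.

Definition setup : cmd :=
  Seq (ISet (ICst 1) (IMul (ICst 3) (Var 0)))
  (Seq (ISet (ICst 2) (IMul (Var 1) (Var 1)))
  (Seq (ISet (ICst 3) (IAdd (ICst 2) (IMul (Var 0) (Var 0))))
  (Seq (ISet (ICst 4) (IAdd (Var 3) (ICst 4)))
  (Seq (ISet (ICst 5) (IAdd (Var 4) (Var 2)))
  (Seq (ISet (ICst 6) (IAdd (Var 5) (IMul (Var 2) (Var 2))))
       (ISet (ICst 7) (IAdd (Var 6) (Var 2)))))))).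

(** Expressions cannot convert a natural into a real, so the weights 0 to 3 of the interpolation are
    looked up in memory. *)
Definition casts : cmd :=
  Seq (RSet (IAdd (Var 3) (ICst 0)) (RCst 0))
  (Seq (RSet (IAdd (Var 3) (ICst 1)) (RCst 1))
  (Seq (RSet (IAdd (Var 3) (ICst 2)) (RCst 2))
       (RSet (IAdd (Var 3) (ICst 3)) (RCst 3)))).

(* Reduces a sum s < 2 n modulo the content n of cell k. *)
Definition wrap (k : nat) (s : iexpr) : iexpr :=
  ISub s (IMul (Var k) (ISub (ICst 1) (ISub (Var k) s))).

Definition given (a b : iexpr) : rexpr :=
  RCell (IAdd (ICst 2) (IAdd (IMul a (Var 0)) b)).

Definition cast (w : iexpr) : rexpr := RCell (IAdd (Var 3) w).

Definition next_cell (j : nat) : iexpr := wrap 0 (IAdd (Var j) (ICst 1)).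

(* Interpolates at the point (3 a1 + b1, 3 a2 + b2) of the refined grid, where
   a1, a2, b1, b2 are in cells 8 to 11; truncated subtraction selects the
   triangle that contains the point. *)
Definition refine : cmd :=
  let s := IAdd (Var 10) (Var 11) in
  let w11 := ISub s (ICst 3) in
  For 8 (Var 0) (For 9 (Var 0) (For 10 (ICst 3) (For 11 (ICst 3)
    (RSet (IAdd (Var 4)
            (IAdd (IMul (IAdd (IMul (ICst 3) (Var 8)) (Var 10)) (Var 1))
                  (IAdd (IMul (ICst 3) (Var 9)) (Var 11))))
      (RDiv
        (RAdd
          (RAdd (RMul (cast (ISub (ICst 3) s)) (given (Var 8) (Var 9)))
                (RMul (cast (ISub (Var 10) w11)) (given (next_cell 8) (Var 9))))
          (RAdd (RMul (cast (ISub (Var 11) w11)) (given (Var 8) (next_cell 9)))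
                (RMul (cast w11) (given (next_cell 8) (next_cell 9)))))
        (RCst 3)))))).

Definition row (j : nat) : iexpr := IAdd (Var 5) (IMul (Var j) (Var 2)).

(** The cells of the matrix are still zero from the input, so only the diagonal is written. *)
Definition identity : cmd :=
  For 8 (Var 2) (RSet (IAdd (row 8) (Var 8)) (RCst 1)).

(** The pivot row is copied because the loop over the rows overwrites it in turn; the ratio is
    stored because changing a row changes the value of [w] on it. *)
Definition eliminate (w : iexpr -> rexpr) : cmd :=
  For 12 (Var 2)
    (Seq (For 13 (Var 2) (RSet (IAdd (Var 6) (Var 13)) (RCell (IAdd (row 12) (Var 13)))))
         (For 13 (Var 2)
           (Seq (RSet (Var 7) (RDiv (w (row 13)) (w (Var 6))))
                (For 14 (Var 2)
                  (RSet (IAdd (row 13) (Var 14))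
                    (RSub (RCell (IAdd (row 13) (Var 14)))
                          (RMul (RCell (Var 7)) (RCell (IAdd (Var 6) (Var 14)))))))))).

Definition fine_index (a b : iexpr) : iexpr := IAdd (IMul a (Var 1)) b.
Definition fine (i : iexpr) : rexpr := RCell (IAdd (Var 4) i).

(* 1 - x / x is 1 if x = 0, and 0 otherwise. *)
Definition if_zero (x : rexpr) : rexpr := RSub (RCst 1) (RDiv x x).

Definition index_x : iexpr := fine_index (Var 8) (Var 9).
Definition index_y : iexpr := fine_index (Var 10) (Var 11).
Definition index_xy : iexpr :=
  fine_index (wrap 1 (IAdd (Var 8) (Var 10))) (wrap 1 (IAdd (Var 9) (Var 11))).

Definition additive_form (base : iexpr) : rexpr :=
  RMul (if_zero (RSub (RAdd (fine index_x) (fine index_y)) (fine index_xy)))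
       (RSub (RAdd (RCell (IAdd base index_x)) (RCell (IAdd base index_y)))
             (RCell (IAdd base index_xy))).

Definition one_form (base : iexpr) : rexpr :=
  RMul (if_zero (RSub (fine index_x) (RCst 1))) (RCell (IAdd base index_x)).

(** [one_form] depends on x alone; eliminating it again for each y leaves rows that are already in
    its kernel as they are. *)
Definition solve : cmd :=
  For 8 (Var 1) (For 9 (Var 1) (For 10 (Var 1) (For 11 (Var 1)
    (Seq (eliminate additive_form) (eliminate one_form))))).

Definition decide : cmd :=
  Seq (RSet (Var 7) (RCst 0))
  (Seq (For 8 (Var 2) (For 9 (Var 2)
         (RSet (Var 7) (RAdd (RCell (Var 7))
           (RMul (RCell (IAdd (row 8) (Var 9))) (RCell (IAdd (row 8) (Var 9))))))))
       (If (BRle (RCell (Var 7)) (RCst 0)) (ISet (ICst 0) (ICst 1)) (ISet (ICst 0) (ICst 0)))).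

Definition extremality_test : cmd :=
  Seq setup (Seq casts (Seq refine (Seq identity (Seq solve decide)))).

Section ProgramCorrectness.
Context {R : realType}.
Variables (q : nat) (p : nat -> nat -> R).
Hypothesis q0 : (0 < q)%N.
Implicit Types (m : nat -> nat) (r : nat -> R).

Let Q := (3 * q)%N.
Let N := (Q * Q)%N.
Let B0 := (2 + q * q)%N.
Let B1 := (B0 + 4)%N.
Let B2 := (B1 + N)%N.
Let B3 := (B2 + N * N)%N.
Let B4 := (B3 + N)%N.

Lemma layE : ((lay q 0 = q) * (lay q 1 = Q) * (lay q 2 = N) * (lay q 3 = B0) *
  (lay q 4 = B1) * (lay q 5 = B2) * (lay q 6 = B3) * (lay q 7 = B4))%type.
Proof. by []. Qed.

Lemma row_bound k i : (k < N)%N -> (i < N)%N -> (k * N + i < N * N)%N.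
Proof. by move: N => n kn iN; nia. Qed.

Lemma row_inj n k i k' i' : (i < n)%N -> (i' < n)%N ->
  (k * n + i = k' * n + i')%N -> k = k' /\ i = i'.
Proof.
move=> iN iN' E; have n0 : (0 < n)%N by case: n iN {iN' E}.
have := congr1 (divn^~ n) E; have := congr1 (modn^~ n) E.
by rewrite /= !modnMDl !modn_small // !divnMDl // !divn_small // !addn0.
Qed.

Definition next (a : nat) : nat := (a.+1 %% q)%N.

(** The weights are three times barycentric coordinates; for b1 + b2 > 3 they are 0, 3 - b2, 3 - b1
    and b1 + b2 - 3. *)
Definition refined_value (a1 a2 b1 b2 : nat) : R :=
  let w11 := (b1 + b2 - 3)%N in
  ((3 - (b1 + b2))%:R * p a1 a2 + (b1 - w11)%:R * p (next a1) a2 +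
   ((b2 - w11)%:R * p a1 (next a2) + w11%:R * p (next a1) (next a2))) / 3.

Definition refined (X1 X2 : nat) : R :=
  refined_value (X1 %/ 3) (X2 %/ 3) (X1 %% 3) (X2 %% 3).

Definition table (i : nat) : R := refined (i %/ Q) (i %% Q).

Definition input_loaded r : Prop :=
  (forall i j, (i < q)%N -> (j < q)%N -> r (2 + (i * q + j))%N = p i j) /\
  (forall k, (k < 4)%N -> r (B0 + k)%N = k%:R).

Definition refining (S : nat -> Prop) r : Prop :=
  [/\ input_loaded r, forall a, (B2 <= a)%N -> r a = 0 &
      forall i, (i < N)%N -> S i -> r (B1 + i)%N = table i].

Lemma wrapE n s : (s < 2 * n)%N -> (s - n * (1 - (n - s)) = s %% n)%N.
Proof.
move=> sn; have [lt|ge] := ltnP s n.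
  rewrite modn_small //; have -> : (1 - (n - s) = 0)%N by lia.
  by rewrite muln0 subn0.
have -> : (1 - (n - s) = 1)%N by lia.
rewrite muln1 -{2}(subnK ge) modnDr modn_small //; lia.
Qed.

Lemma casts_triple m : (forall j, (j < 8)%N -> m j = lay q j) ->
  triple 8 m
    (fun r => (forall i j, (i < q)%N -> (j < q)%N -> r (2 + (i * q + j))%N = p i j) /\
              forall a, (B0 <= a)%N -> r a = 0)
    (refining (fun=> False)) casts 24.
Proof.
move=> mE; pose pre n r :=
  (forall i j, (i < q)%N -> (j < q)%N -> r (2 + (i * q + j))%N = p i j) /\
  [/\ forall k, (k < n)%N -> r (B0 + k)%N = k%:R & forall a, (B0 + n <= a)%N -> r a = 0].
have bound i j : (i < q)%N -> (j < q)%N -> (2 + (i * q + j) < B0)%N.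
  by rewrite /B0 => iq jq; nia.
have step n : triple 8 m (pre n) (pre n.+1) (RSet (IAdd (Var 3) (ICst n)) (RCst n)) 6.
  apply: triple_rset => // r [rp [rk rz]] /=; rewrite mE // layE; split=> [i j iq jq|].
    by rewrite /upd ltn_eqF ?rp // ltn_addr // bound.
  split=> [k|a aB]; last by rewrite /upd gtn_eqF ?rz //; lia.
  rewrite ltnS leq_eqVlt /upd => /predU1P[->|kn]; first by rewrite eqxx.
  by rewrite ltn_eqF ?rk // ltn_add2l.
apply: (@triple_conseq _ 8 m _ (pre 0%N) _ (pre 4%N) casts _ (6 + (6 + (6 + 6)))%N).
- by move=> r [rp rz]; split=> //; split=> // a; rewrite addn0; exact: rz.
- move=> r [rp [rk rz]]; split=> // a aB; apply: rz.
  by move: aB; rewrite /B2 /B1; lia.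
- by [].
by do 3 (apply: triple_seq; first exact: step); exact: step.
Qed.

(** The set of entries already written is arbitrary in the premise, so the rule nests without a
    separate invariant for each of the four loops. *)
Lemma refining_for d m e body n c (T : nat -> nat -> Prop) :
  reads_below d e -> (forall r, ieval (State m r) e = n) ->
  (forall k S, (k < n)%N -> triple d.+1 (upd m d k) (refining S)
     (refining (fun i => S i \/ T k i)) body c) ->
  forall S, triple d m (refining S)
    (refining (fun i => S i \/ exists2 k, (k < n)%N & T k i))
    (For d e body) (for_cost n c (icost e)).
Proof.
move=> re en H S; apply: (@triple_conseq _ d m _
  (refining (fun i => S i \/ exists2 k, (k < 0)%N & T k i)) _ _ _ _ _ _ _ (leqnn _)).
- by move=> r [r1 r2 r3]; split=> // i iN [Si|[]//]; exact: r3.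
- by move=> r H'; exact: H'.
apply: (triple_for (Inv := fun n' => refining (fun i => S i \/ exists2 k, (k < n')%N & T k i))) => //.
move=> k kn; apply: triple_conseq
  (H k (fun i => S i \/ exists2 k', (k' < k)%N & T k' i) kn) => // r [r1 r2 r3].
split=> // i iN.
case=> [Si|[k']]; first by apply: r3 => //; left; left.
rewrite ltnS leq_eqVlt => /predU1P[->|kk'] Ti; apply: r3 => //; first by right.
by left; right; exists k'.
Qed.

Lemma lay_upd m d k : (forall j, (j < 8)%N -> m j = lay q j) -> (8 <= d)%N ->
  forall j, (j < 8)%N -> upd m d k j = lay q j.
Proof. by move=> mE d8 j j8; rewrite /upd ltn_eqF ?mE // (leq_trans j8). Qed.

Lemma fine_bound X1 X2 : (X1 < Q)%N -> (X2 < Q)%N -> (X1 * Q + X2 < N)%N.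
Proof. by rewrite /N; move: Q => n; nia. Qed.

Lemma tableE a1 a2 b1 b2 : (a2 < q)%N -> (b1 < 3)%N -> (b2 < 3)%N ->
  table ((3 * a1 + b1) * Q + (3 * a2 + b2)) = refined_value a1 a2 b1 b2.
Proof.
move=> a2q b13 b23; have lt : (3 * a2 + b2 < Q)%N by rewrite /Q; lia.
have Q0 : (0 < Q)%N by rewrite /Q muln_gt0.
rewrite /table divnMDl // (divn_small lt) addn0 modnMDl (modn_small lt) /refined.
by rewrite ![(3 * _)%N]mulnC !divnMDl // !modnMDl !modn_small // !divn_small // !addn0.
Qed.

Lemma ltnS_neq i n : i != n -> (i < n.+1)%N = (i < n)%N.
Proof. by move=> ne; rewrite ltnS leq_eqVlt (negPf ne). Qed.

Lemma ltnS_or i n : (i < n.+1)%N = (i < n)%N || (i == n).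
Proof. by rewrite ltnS leq_eqVlt orbC. Qed.

(** 200 here, and 60 and 600 in the loops below, are roomy bounds on the cost of innermost
    assignments, checked by computation. *)
Definition refine_cost : nat :=
  for_cost q (for_cost q (for_cost 3 (for_cost 3 200 1) 1) 2) 2.

Lemma refine_triple m : (forall j, (j < 8)%N -> m j = lay q j) ->
  triple 8 m (refining (fun=> False)) (refining (fun=> True)) refine refine_cost.
Proof.
move=> mE; pose T a1 a2 b1 b2 i := i = ((3 * a1 + b1) * Q + (3 * a2 + b2))%N.
apply: (@triple_conseq _ 8 m _ (refining (fun=> False)) _
  (refining (fun i => False \/ exists2 a1, (a1 < q)%N & exists2 a2, (a2 < q)%N &
     exists2 b1, (b1 < 3)%N & exists2 b2, (b2 < 3)%N & T a1 a2 b1 b2 i))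
  refine _ _ _ _ (leqnn _)).
- by [].
- move=> r [r1 r2 r3]; split=> // i iN _; apply: r3 => //; right.
  have Q0 : (0 < Q)%N by rewrite /Q muln_gt0.
  have iQ : (i %/ Q < Q)%N by rewrite ltn_divLR.
  have iQ' := ltn_pmod i Q0.
  exists (i %/ Q %/ 3)%N; first by rewrite ltn_divLR // mulnC.
  exists (i %% Q %/ 3)%N; first by rewrite ltn_divLR // mulnC.
  exists (i %/ Q %% 3)%N; first exact: ltn_pmod.
  exists (i %% Q %% 3)%N; first exact: ltn_pmod.
  by rewrite /T ![(3 * _)%N]mulnC -!divn_eq.
rewrite /refine /refine_cost.
apply: refining_for => // [r|a1 S1 a1q]; first by rewrite /= mE.
have mE1 := lay_upd a1 mE (leqnn 8).
apply: refining_for => // [r|a2 S2 a2q]; first by rewrite /= mE1.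
have mE2 := lay_upd a2 mE1 (leqnSn 8).
apply: refining_for => // b1 S3 b13.
have mE3 := lay_upd b1 mE2 (isT : 8 <= 10)%N.
apply: refining_for => // b2 S4 b23.
have mE4 := lay_upd b2 mE3 (isT : 8 <= 11)%N.
set m4 := upd _ 11 b2 in mE4 *.
have [m8 m9 m10 m11] : [/\ m4 8%N = a1, m4 9%N = a2, m4 10%N = b1 & m4 11%N = b2] by [].
apply: (@triple_conseq _ 12 m4 _ (refining S4) _
  (refining (fun i => S4 i \/ T a1 a2 b1 b2 i))) (triple_rset _ _ _) => //.
move=> r [[rp rk] rz rS] /=.
rewrite m8 m9 m10 m11 !mE4 // !layE.
have nextE a : (a < q)%N -> (a + 1 - q * (1 - (q - (a + 1))))%N = next a.
  by move=> aq; rewrite wrapE ?addn1 //; lia.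
rewrite !nextE //.
have nq a : (next a < q)%N by rewrite ltn_mod.
rewrite (rp _ _ a1q a2q) (rp _ _ (nq a1) a2q) (rp _ _ a1q (nq a2)) (rp _ _ (nq a1) (nq a2)).
have [rk1 rk2 rk3 rk4] : [/\ (3 - (b1 + b2) < 4)%N, (b1 - (b1 + b2 - 3) < 4)%N,
  (b2 - (b1 + b2 - 3) < 4)%N & (b1 + b2 - 3 < 4)%N] by split; lia.
rewrite (rk _ rk1) (rk _ rk2) (rk _ rk3) (rk _ rk4).
set val := (X in upd _ _ X); set a := (X in upd _ X _).
have aB : (a < B2)%N.
  by rewrite /a /B2 ltn_add2l; apply: fine_bound; rewrite /Q; lia.
have Ba : (B1 <= a)%N by rewrite /a leq_addr.
split.
- split=> [i j iq jq|k k4]; rewrite /upd ltn_eqF.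
  + exact: rp.
  + by apply: leq_trans Ba; rewrite /B1 /B0; nia.
  + exact: rk.
  by apply: leq_trans Ba; rewrite /B1 ltn_add2l.
- by move=> i iB; rewrite /upd gtn_eqF ?rz //; apply: leq_trans iB.
move=> i iN Si; rewrite /upd; case: eqP => [E|ne].
  have -> : i = ((3 * a1 + b1) * Q + (3 * a2 + b2))%N by move: E; rewrite /a; lia.
  by rewrite tableE.
case: Si => [Si|Ti]; first exact: rS.
by case: ne; rewrite Ti.
Qed.

Definition table_loaded r : Prop := forall i, (i < N)%N -> r (B1 + i)%N = table i.

Definition matrix_loaded (V : nat -> nat -> R) r : Prop :=
  forall k i, (k < N)%N -> (i < N)%N -> r (B2 + k * N + i)%N = V k i.

Lemma table_loaded_upd r a x : (B2 <= a)%N -> table_loaded r -> table_loaded (upd r a x).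
Proof.
move=> aB rT i iN; rewrite /upd ltn_eqF ?rT //.
by apply: leq_trans aB; rewrite ltn_add2l.
Qed.

Lemma matrix_loaded_upd V r a x : (B3 <= a)%N -> matrix_loaded V r ->
  matrix_loaded V (upd r a x).
Proof.
move=> aB rV k i kN iN; rewrite /upd ltn_eqF ?rV //.
apply: leq_trans aB; rewrite -addnA ltn_add2l; exact: row_bound.
Qed.

Lemma B23 : (B2 <= B3)%N. Proof. exact: leq_addr. Qed.
Lemma B34 : (B3 <= B4)%N. Proof. exact: leq_addr. Qed.

Lemma identity_triple m : (forall j, (j < 8)%N -> m j = lay q j) ->
  triple 8 m (refining (fun=> True))
    (fun r => table_loaded r /\ matrix_loaded (fun k i => (k == i)%:R) r)
    identity (for_cost N 60 2).
Proof.
move=> mE; pose Inv n r := table_loaded r /\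
  matrix_loaded (fun k i => ((k == i) && (k < n)%N)%:R) r.
apply: (@triple_conseq _ 8 m _ (Inv 0%N) _ (Inv N) identity _ _ _ _ (leqnn _)).
- move=> r [_ rz rT]; split=> [i iN|k i kN iN]; first exact: rT.
  by rewrite rz ?andbF // -addnA leq_addr.
- by move=> r [rT rV]; split=> // k i kN iN; rewrite rV // kN andbT.
apply: triple_for => // [r|n nN]; first by rewrite /= mE.
have mE1 := lay_upd n mE (leqnn 8); set m1 := upd _ 8 n in mE1 *.
have m8 : m1 8%N = n by [].
apply: (triple_conseq _ _ _ (triple_rset (P := Inv n) (Q := Inv n.+1) _ _ _)) => //.
move=> r [rT rV] /=; rewrite m8 !mE1 // !layE.
split; first by apply: table_loaded_upd => //; rewrite -addnA leq_addr.
move=> k i kN iN; rewrite /upd; case: eqP => [E|ne].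
  have [-> ->] : k = n /\ i = n by apply: (@row_inj N) => //; move: E; lia.
  by rewrite eqxx leqnn.
rewrite rV //; congr (_%:R); case: eqP => //= ki; subst i.
by rewrite ltnS_neq //; apply/eqP => kn; case: ne; rewrite kn.
Qed.

Definition eliminate_cost (cw : nat) : nat :=
  for_cost N (for_cost N 60 2 + for_cost N (cw + for_cost N 60 2) 2) 2.

Section Eliminate.
Variables (m : nat -> nat) (w : iexpr -> rexpr) (W : (nat -> R) -> R) (cw : nat).
Hypothesis mE : forall j, (j < 8)%N -> m j = lay q j.
Hypothesis lW : linear_form N W.
Hypothesis w_reads : forall d base, (12 <= d)%N -> reads_below d base ->
  rreads_below d (w base).
Hypothesis w_cost : ((rcost (w (row 13)) + rcost (w (Var 6))).+1 + 2 < cw)%N.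
Hypothesis wE : forall m' r base, (forall j, (j < 12)%N -> m' j = m j) ->
  table_loaded r ->
  reval (State m' r) (w base) = W (fun i => r (ieval (State m' r) base + i)%N).

Lemma pivot_triple j V : (j < N)%N ->
  triple 13 (upd m 12 j) (fun r => table_loaded r /\ matrix_loaded V r)
    (fun r => table_loaded r /\ matrix_loaded (pivot W j V) r)
    (Seq (For 13 (Var 2) (RSet (IAdd (Var 6) (Var 13)) (RCell (IAdd (row 12) (Var 13)))))
         (For 13 (Var 2)
           (Seq (RSet (Var 7) (RDiv (w (row 13)) (w (Var 6))))
                (For 14 (Var 2)
                  (RSet (IAdd (row 13) (Var 14))
                    (RSub (RCell (IAdd (row 13) (Var 14)))
                          (RMul (RCell (Var 7)) (RCell (IAdd (Var 6) (Var 14))))))))))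
    (for_cost N 60 2 + for_cost N (cw + for_cost N 60 2) 2)%N.
Proof.
move=> jN; have mE1 := lay_upd j mE (isT : 8 <= 12)%N.
set m1 := upd m 12 j in mE1 *.
have m12 : m1 12%N = j by [].
pose copied n r := forall i, (i < n)%N -> r (B3 + i)%N = V j i.
pose loaded U r := table_loaded r /\ matrix_loaded U r.
apply: (triple_seq (Q := fun r => loaded V r /\ copied N r)).
  apply: (@triple_conseq _ 13 m1 _ (fun r => loaded V r /\ copied 0%N r) _
    (fun r => loaded V r /\ copied N r) _ _ _ _ _ (leqnn _)) => //.
  apply: (triple_for (Inv := fun n r => loaded V r /\ copied n r)) => // [r|n nN].
    by rewrite /= mE1.
  have mE2 := lay_upd n mE1 (isT : 8 <= 13)%N; set m2 := upd _ 13 n in mE2 *.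
  have m2_13 : m2 13%N = n by []. have m2_12 : m2 12%N = j by [].
  apply: (triple_conseq _ _ _ (triple_rset (P := fun r => loaded V r /\ copied n r)
    (Q := fun r => loaded V r /\ copied n.+1 r) _ _ _)) => //.
  move=> r [[rT rV] rc] /=; rewrite m2_13 m2_12 !mE2 // !layE.
  have Bn : (B3 <= B3 + n)%N by exact: leq_addr.
  split; first split.
  - by apply: table_loaded_upd => //; exact: leq_trans B23 _.
  - exact: matrix_loaded_upd.
  move=> i; rewrite ltnS leq_eqVlt /upd => /predU1P[->|iltn].
    by rewrite eqxx rV.
  by rewrite eqn_add2l ltn_eqF // rc.
pose upto k k' i := if (k' < k)%N then pivot W j V k' i else V k' i.
apply: (@triple_conseq _ 13 m1 _ (fun r => loaded (upto 0%N) r /\ copied N r) _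
  (fun r => loaded (upto N) r /\ copied N r) _ _ _ _ _ (leqnn _)) => //.
  by move=> r [[rT rV] _]; split=> // k i kN iN; rewrite rV // /upto kN.
apply: (triple_for (Inv := fun k r => loaded (upto k) r /\ copied N r)) => // [r|k kN].
  by rewrite /= mE1.
have mE2 := lay_upd k mE1 (isT : 8 <= 13)%N; set m2 := upd _ 13 k in mE2 *.
have m2_13 : m2 13%N = k by [].
pose ratio := W (V k) / W (V j).
have m2m j' : (j' < 12)%N -> m2 j' = m j'.
  by move=> j12; rewrite /m2 /m1 /upd !ltn_eqF // (leq_trans j12).
apply: (triple_seq (Q := fun r => [/\ loaded (upto k) r, copied N r & r B4 = ratio])).
  apply: (triple_conseq _ _ _ (triple_rset (P := fun r => loaded (upto k) r /\ copied N r)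
    (Q := fun r => [/\ loaded (upto k) r, copied N r & r B4 = ratio]) _ _ _)) => //.
  - by apply: leq_trans w_cost; rewrite /=; lia.
  - by rewrite /= !w_reads.
  move=> r [[rT rV] rc] /=; rewrite !wE //= m2_13 !mE2 // !layE.
  split; first split.
  - by apply: table_loaded_upd => //; exact: leq_trans B23 B34.
  - by apply: matrix_loaded_upd => //; exact: B34.
  - by move=> i iN; rewrite /upd ltn_eqF ?rc // ltn_add2l.
  rewrite /upd eqxx /ratio; congr (_ / _); apply: lW.2 => i iN.
    by rewrite rV // /upto ltnn.
  exact: rc.
pose part n k' i := if (k' < k)%N || ((k' == k) && (i < n)%N) then pivot W j V k' i
                    else V k' i.
pose Inv n r := [/\ loaded (part n) r, copied N r & r B4 = ratio].
apply: (@triple_conseq _ 14 m2 _ (Inv 0%N) _ (Inv N) _ _ _ _ _ (leqnn _)).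
- move=> r [[rT rV] rc rr]; split=> //; split=> // k' i kN' iN.
  by rewrite rV // /part /upto ltn0 andbF orbF.
- move=> r [[rT rV] rc rr]; split=> //; split=> // k' i kN' iN.
  rewrite rV // /part /upto iN andbT.
  by rewrite (ltnS_or k' k).
apply: (triple_for (Inv := Inv)) => // [r|n nN]; first by rewrite /= mE2.
have mE3 := lay_upd n mE2 (isT : 8 <= 14)%N; set m3 := upd _ 14 n in mE3 *.
have m3_14 : m3 14%N = n by []. have m3_13 : m3 13%N = k by [].
apply: (triple_conseq _ _ _ (triple_rset (P := Inv n) (Q := Inv n.+1) _ _ _)) => //.
move=> r [[rT rV] rc rr] /=; rewrite m3_14 m3_13 !mE3 // !layE.
rewrite rr rc // rV // {1}/part ltnn eqxx ltnn /=.
have ltB3 : (B2 + k * N + n < B3)%N by rewrite -addnA ltn_add2l; exact: row_bound.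
split; first split.
- by apply: table_loaded_upd => //; rewrite -addnA leq_addr.
- move=> k' i kN' iN; rewrite /upd; case: eqP => [E|ne].
    have [-> ->] : k' = k /\ i = n by apply: (@row_inj N) => //; move: E; lia.
    by rewrite /part eqxx leqnn orbT.
  rewrite rV // /part; case: (eqVneq k' k) ne => [->|//] ne /=.
  by rewrite ltnn /= ltnS_neq //; apply/eqP => E; case: ne; rewrite E.
- by move=> i iN; rewrite /upd gtn_eqF ?rc //; apply: leq_trans ltB3 _; exact: leq_addr.
by rewrite /upd gtn_eqF ?rr //; apply: leq_trans ltB3 B34.
Qed.

(** The matrix is remembered only through the space it spans, so that an elimination simply
    intersects S with a kernel. *)
Definition solving (S : (nat -> R) -> Prop) r : Prop :=
  [/\ subspace S, table_loaded r & exists V, matrix_loaded V r /\ spans N S V].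

Lemma eliminate_triple S :
  triple 12 m (solving S) (solving (fun v => S v /\ W v = 0)) (eliminate w)
    (eliminate_cost cw).
Proof.
pose Inv j r := [/\ subspace S, table_loaded r &
  exists V, matrix_loaded V r /\ pivoting N S W j V].
apply: (@triple_conseq _ 12 m _ (Inv 0%N) _ (Inv N) _ _ _ _ _ (leqnn _)).
- move=> r [sS rT [V [rV sp]]]; split=> //; exists V; split=> //.
  exact: spans_pivoting.
- move=> r [sS rT [V [rV sp]]]; split=> //.
    by apply: subspaceI => //; exact: subspace_kernel lW.
  by exists V; split=> //; exact: pivoting_spans.
apply: (triple_for (Inv := Inv)) => // [r|j jN]; first by rewrite /= mE.
move=> s ag [sS rT [V [rV sp]]].
have [t [s' [ex tT ag' [rT' rV']]]] := @pivot_triple j V jN s ag (conj rT rV).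
exists t, s'; split=> //; split=> //; exists (pivot W j V); split=> //.
exact: pivoting_step.
Qed.

End Eliminate.

Lemma solving_iff S S' r : (forall v, S v <-> S' v) -> solving S r -> solving S' r.
Proof. by move=> SS; have -> : S = S' by apply/funext => v; apply/propext. Qed.

Lemma solving_for d m e body n c (T : nat -> (nat -> R) -> Prop) :
  reads_below d e -> (forall r, ieval (State m r) e = n) ->
  (forall k S, (k < n)%N -> triple d.+1 (upd m d k) (solving S)
     (solving (fun v => S v /\ T k v)) body c) ->
  forall S, triple d m (solving S)
    (solving (fun v => S v /\ forall k, (k < n)%N -> T k v))
    (For d e body) (for_cost n c (icost e)).
Proof.
move=> re en H S; apply: (@triple_conseq _ d m _
  (solving (fun v => S v /\ forall k, (k < 0)%N -> T k v)) _ _ _ _ _ _ _ (leqnn _)).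
- by move=> r; apply: solving_iff => v; split=> [|[]].
- by move=> r H'; exact: H'.
apply: (triple_for (Inv := fun n' => solving (fun v => S v /\ forall k, (k < n')%N -> T k v))) => //.
move=> k kn; apply: triple_conseq
  (H k (fun v => S v /\ forall k', (k' < k)%N -> T k' v) kn) => // r.
apply: solving_iff => v; split=> [[[Sv Tv] Tk]|[Sv Tv]].
  by split=> // k'; rewrite ltnS leq_eqVlt => /predU1P[->//|]; exact: Tv.
by split; [split=> // k' k'k; apply: Tv; exact: ltnW|exact: Tv].
Qed.

Definition indicator (x : R) : R := 1 - x / x.

(** A conditional equation becomes one linear equation, eliminated without a branch. *)
Lemma indicator_mul_eq0 x y : indicator x * y = 0 <-> (x = 0 -> y = 0).
Proof.
rewrite /indicator; have [->|x0] := eqVneq x 0.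
  by rewrite mul0r subr0 mul1r; split=> // H; exact: H.
by rewrite divff // subrr mul0r; split=> // _ xE; rewrite xE eqxx in x0.
Qed.

Definition fidx (X1 X2 : nat) : nat := (X1 * Q + X2)%N.

Definition wrapped_idx (x1 x2 y1 y2 : nat) : nat :=
  fidx ((x1 + y1) %% Q) ((x2 + y2) %% Q).

Definition additivity (x1 x2 y1 y2 : nat) (u : nat -> R) : R :=
  u (fidx x1 x2) + u (fidx y1 y2) - u (wrapped_idx x1 x2 y1 y2).

Definition additive_equation x1 x2 y1 y2 u : R :=
  indicator (additivity x1 x2 y1 y2 table) * additivity x1 x2 y1 y2 u.

Definition one_equation x1 x2 (u : nat -> R) : R :=
  indicator (table (fidx x1 x2) - 1) * u (fidx x1 x2).

Lemma wrapped_idx_bound x1 x2 y1 y2 : (wrapped_idx x1 x2 y1 y2 < N)%N.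
Proof. by apply: fine_bound; rewrite ltn_mod /Q muln_gt0. Qed.

Lemma linear_additive_equation x1 x2 y1 y2 :
  (x1 < Q)%N -> (x2 < Q)%N -> (y1 < Q)%N -> (y2 < Q)%N ->
  linear_form N (additive_equation x1 x2 y1 y2).
Proof.
move=> x1Q x2Q y1Q y2Q; split=> [a u v|u v uv]; rewrite /additive_equation /additivity.
  by ring.
by rewrite !uv //; [exact: wrapped_idx_bound|exact: fine_bound..].
Qed.

Lemma linear_one_equation x1 x2 : (x1 < Q)%N -> (x2 < Q)%N ->
  linear_form N (one_equation x1 x2).
Proof.
move=> x1Q x2Q; split=> [a u v|u v uv]; rewrite /one_equation; first by ring.
by rewrite uv //; exact: fine_bound.
Qed.

Definition pair_cost : nat := eliminate_cost 600 + eliminate_cost 600.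

Definition solve_cost : nat :=
  for_cost Q (for_cost Q (for_cost Q (for_cost Q pair_cost 2) 2) 2) 2.

Definition solution (v : nat -> R) : Prop :=
  forall x1, (x1 < Q)%N -> forall x2, (x2 < Q)%N ->
  forall y1, (y1 < Q)%N -> forall y2, (y2 < Q)%N ->
    additive_equation x1 x2 y1 y2 v = 0 /\ one_equation x1 x2 v = 0.

Lemma pair_triple m x1 x2 y1 y2 S : (forall j, (j < 8)%N -> m j = lay q j) ->
  (x1 < Q)%N -> (x2 < Q)%N -> (y1 < Q)%N -> (y2 < Q)%N ->
  m 8%N = x1 -> m 9%N = x2 -> m 10%N = y1 -> m 11%N = y2 ->
  triple 12 m (solving S)
    (solving (fun v => S v /\ (additive_equation x1 x2 y1 y2 v = 0 /\ one_equation x1 x2 v = 0)))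
    (Seq (eliminate additive_form) (eliminate one_form)) pair_cost.
Proof.
move=> mE x1Q x2Q y1Q y2Q m8 m9 m10 m11.
have wrapQ a b : (a < Q)%N -> (b < Q)%N -> (a + b - Q * (1 - (Q - (a + b))))%N = ((a + b) %% Q)%N.
  by move=> aQ bQ; rewrite wrapE //; lia.
have readE m' : (forall j, (j < 12)%N -> m' j = m j) ->
  [/\ m' 1%N = Q, m' 4%N = B1, m' 8%N = x1, m' 9%N = x2 & m' 10%N = y1 /\ m' 11%N = y2].
  by move=> m'E; rewrite !m'E //; split=> //; exact: mE.
apply: (@triple_conseq _ 12 m _ (solving S) _ (solving (fun v =>
  (S v /\ additive_equation x1 x2 y1 y2 v = 0) /\ one_equation x1 x2 v = 0)) _ _ _ _ _ (leqnn _)) => //.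
  by move=> r; apply: solving_iff => v; tauto.
apply: triple_seq; apply: eliminate_triple => //.
- exact: linear_additive_equation.
- move=> d base d12 rb /=; rewrite rb.
  by rewrite !(leq_trans _ d12).
- move=> m' r base m'E rT; have [e1 e4 e8 e9 [e10 e11]] := readE m' m'E.
  rewrite /= e1 e4 e8 e9 e10 e11 !wrapQ //.
  by rewrite (rT _ (fine_bound x1Q x2Q)) (rT _ (fine_bound y1Q y2Q))
    (rT _ (wrapped_idx_bound x1 x2 y1 y2)).
- exact: linear_one_equation.
- move=> d base d12 rb /=; rewrite rb.
  by rewrite !(leq_trans _ d12).
- move=> m' r base m'E rT; have [e1 e4 e8 e9 [e10 e11]] := readE m' m'E.
  by rewrite /= e1 e4 e8 e9 rT //; exact: fine_bound.
Qed.

Lemma solve_triple m : (forall j, (j < 8)%N -> m j = lay q j) ->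
  triple 8 m (solving (fun=> True)) (solving solution) solve solve_cost.
Proof.
move=> mE; apply: (@triple_conseq _ 8 m _ (solving (fun=> True)) _
  (solving (fun v => True /\ solution v)) _ _ _ _ _ (leqnn _)) => //.
  by move=> r; apply: solving_iff => v; tauto.
rewrite /solve /solve_cost.
apply: solving_for => // [r|x1 S1 x1Q]; first by rewrite /= mE.
have mE1 := lay_upd x1 mE (leqnn 8).
apply: solving_for => // [r|x2 S2 x2Q]; first by rewrite /= mE1.
have mE2 := lay_upd x2 mE1 (leqnSn 8).
apply: solving_for => // [r|y1 S3 y1Q]; first by rewrite /= mE2.
have mE3 := lay_upd y1 mE2 (isT : 8 <= 10)%N.
apply: solving_for => // [r|y2 S4 y2Q]; first by rewrite /= mE3.
exact: (pair_triple (lay_upd y2 mE3 (isT : 8 <= 11)%N)).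
Qed.

Definition squares_cost : nat := for_cost N (for_cost N 60 2) 2.

Lemma squares_triple m V : (forall j, (j < 8)%N -> m j = lay q j) ->
  triple 8 m (fun r => matrix_loaded V r /\ r B4 = 0)
    (fun r => r B4 = \sum_(k < N) \sum_(i < N) V k i * V k i)
    (For 8 (Var 2) (For 9 (Var 2)
         (RSet (Var 7) (RAdd (RCell (Var 7))
           (RMul (RCell (IAdd (row 8) (Var 9))) (RCell (IAdd (row 8) (Var 9))))))))
    squares_cost.
Proof.
move=> mE; pose Inv k r := matrix_loaded V r /\
  r B4 = \sum_(k' < k) \sum_(i < N) V k' i * V k' i.
apply: (@triple_conseq _ 8 m _ (Inv 0%N) _ (Inv N) _ _ _ _ _ (leqnn _)) => //.
- by move=> r [rV r0]; split=> //; rewrite big_ord0.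
- by move=> r [].
apply: triple_for => // [r|k kN]; first by rewrite /= mE.
have mE1 := lay_upd k mE (leqnn 8).
pose Inv2 i r := matrix_loaded V r /\
  r B4 = \sum_(k' < k) \sum_(i < N) V k' i * V k' i + \sum_(i' < i) V k i' * V k i'.
apply: (@triple_conseq _ 9 _ _ (Inv2 0%N) _ (Inv2 N) _ _ _ _ _ (leqnn _)) => //.
- by move=> r [rV r0]; split=> //; rewrite big_ord0 addr0.
- by move=> r [rV r0]; split=> //; rewrite big_ord_recr.
apply: triple_for => // [r|i iN]; first by rewrite /= mE1.
have mE2 := lay_upd i mE1 (leqnSn 8); set m2 := upd _ 9 i in mE2 *.
have m8 : m2 8%N = k by []. have m9 : m2 9%N = i by [].
apply: (triple_conseq _ _ _ (triple_rset (P := Inv2 i) (Q := Inv2 i.+1) _ _ _)) => //.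
move=> r [rV r0] /=; rewrite m8 m9 !mE2 // !layE; split.
  by apply: matrix_loaded_upd => //; exact: B34.
by rewrite /upd eqxx r0 rV // big_ord_recr /= addrA.
Qed.

Lemma sum_squares_le0 (V : nat -> nat -> R) :
  \sum_(k < N) \sum_(i < N) V k i * V k i <= 0 :> R <->
  (forall k i, (k < N)%N -> (i < N)%N -> V k i = 0).
Proof.
split=> [|V0]; last first.
  by rewrite big1 // => k _; rewrite big1 // => i _; rewrite V0 // mul0r.
have sq_ge0 (x : R) : 0 <= x * x by rewrite -expr2 sqr_ge0.
move=> le0 k i kN iN.
have /eqP : \sum_(k < N) \sum_(i < N) V k i * V k i = 0 :> R.
  apply/le_anti; rewrite le0 /=; apply: sumr_ge0 => k' _; exact: sumr_ge0.
rewrite psumr_eq0 => [/allP H|k' _]; last exact: sumr_ge0.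
have /eqP/eqP := H (Ordinal kN) (mem_index_enum _); rewrite psumr_eq0 => [/allP H'|//].
have := H' (Ordinal iN) (mem_index_enum _).
by rewrite /= mulf_eq0 orbb => /eqP.
Qed.

Lemma decide_exec m S s : (forall j, (j < 8)%N -> m j = lay q j) ->
  agree 8 m s -> solving S (rmem s) ->
  exists t s', [/\ exec decide s t s', (t <= squares_cost + 60)%N &
    accepting s' <-> forall v, S v -> forall i, (i < N)%N -> v i = 0].
Proof.
move=> mE ag [_ _ [V [rV /spans_trivial SV]]].
have [t1 [s1 [ex1 t1T ag1 [rV1 r1]]]] : exists t s', [/\
    exec (RSet (Var 7) (RCst 0)) s t s', (t <= 4)%N, agree 8 m s' &
    matrix_loaded V (rmem s') /\ rmem s' B4 = 0].
  apply: (triple_rset (P := matrix_loaded V)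
    (Q := fun r => matrix_loaded V r /\ r B4 = 0) _ _ _ ag rV) => // r rV' /=.
  rewrite mE // layE; split; last by rewrite /upd eqxx.
  by apply: matrix_loaded_upd => //; exact: B34.
have [t2 [s2 [ex2 t2T ag2 r2]]] := squares_triple mE ag1 (conj rV1 r1).
pose c := BRle (RCell (Var 7)) (RCst 0).
have cE : beval s2 c = (\sum_(k < N) \sum_(i < N) V k i * V k i <= 0).
  by rewrite /= ag2 // mE // layE r2.
pose e := if beval s2 c then 1%N else 0%N.
exists (t1 + (t2 + (bcost c + 3).+1))%N.
exists (State (upd (imem s2) 0%N e) (rmem s2)); split.
- apply: exec_seq ex1 _; apply: exec_seq ex2 _; apply: exec_if; rewrite /e -/c.
  by case: (beval s2 c); [exact: (@exec_iset R s2 (ICst 0) (ICst 1))|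
                          exact: (@exec_iset R s2 (ICst 0) (ICst 0))].
- by rewrite /=; lia.
rewrite -SV -sum_squares_le0 /accepting /= /upd eqxx /e cE.
by case: (_ <= _); split.
Qed.

Lemma setup_exec (s : @state R) : imem s 0%N = q -> exists t (s' : @state R),
  [/\ exec setup s t s', (t <= 60)%N, rmem s' = rmem s &
      forall j, (j < 8)%N -> imem s' j = lay q j].
Proof.
case: s => m r /= m0.
have chain j e m' c t s' : exec c (State (upd m' j (ieval (State m' r) e)) r) t s' ->
    exec (Seq (ISet (ICst j) e) c) (State m' r) ((icost (ICst j) + icost e).+1 + t) s'.
  by apply: exec_seq; exact: exec_iset.
do 2 eexists; split.
- by rewrite /setup; do 6 eapply chain; exact: exec_iset.
- by [].
- by [].
by case=> [|[|[|[|[|[|[|[|//]]]]]]]] _; rewrite /= /upd /= ?m0.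
Qed.

Definition test_cost : nat :=
  60 + (24 + (refine_cost + (for_cost N 60 2 + (solve_cost + (squares_cost + 60))))).

Theorem extremality_test_exec (s : @state R) : imem s 0%N = q ->
  (forall i j, (i < q)%N -> (j < q)%N -> rmem s (2 + (i * q + j))%N = p i j) ->
  (forall a, (B0 <= a)%N -> rmem s a = 0) ->
  exists t s', [/\ exec extremality_test s t s', (t <= test_cost)%N &
    accepting s' <-> forall v, solution v -> forall i, (i < N)%N -> v i = 0].
Proof.
move=> sq sp s0; have [t1 [s1 [ex1 tT1 r1 l1]]] := setup_exec sq.
pose m := imem s1; have ag1 : agree 8 m s1 by [].
have mE j : (j < 8)%N -> m j = lay q j by exact: l1.
rewrite -r1 in sp s0.
have [t2 [s2 [ex2 tT2 ag2 r2]]] := casts_triple mE ag1 (conj sp s0).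
have [t3 [s3 [ex3 tT3 ag3 r3]]] := refine_triple mE ag2 r2.
have [t4 [s4 [ex4 tT4 ag4 [r4 V4]]]] := identity_triple mE ag3 r3.
have sol4 : solving (fun=> True) (rmem s4).
  by split=> //; exists (fun k i => (k == i)%:R); split=> //; exact: spans_identity.
have [t5 [s5 [ex5 tT5 ag5 r5]]] := solve_triple mE ag4 sol4.
have [t6 [s6 [ex6 tT6 acc]]] := decide_exec mE ag5 r5.
exists (t1 + (t2 + (t3 + (t4 + (t5 + t6)))))%N, s6; split=> //.
  by do 5 (apply: exec_seq; first by eassumption).
by rewrite /test_cost; do ?[apply: leq_add => //].
Qed.

End ProgramCorrectness.

(** * Grid solutions as vectors *)

Section GridVectors.
Context {R : realType}.
Variables (q : nat) (f1 f2 : int) (pi : plane R -> R).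
Hypothesis q0 : (0 < q)%N.
Let f : plane R := scaled q f1%:~R f2%:~R.
Hypotheses (pi_min : minimal Z2 f pi) (pi_pwl : pwl q pi).
Let P x y := pi (scaled q x y).
Let Q := (3 * q)%N.
Let N := (Q * Q)%N.
Let p (i j : nat) : R := pi (gridpt q (i%:Z, j%:Z)).

Let T (X1 X2 : int) : R := P (third X1) (third X2).

Local Notation residue := (residue Q).

Let Q0 : (0 < Q)%N. Proof. by rewrite muln_gt0. Qed.

(** Periodicity accounts for the wrap-around in [next], affinity on the lower or upper triangle for
    the weights. *)
Lemma refinedE (X1 X2 : nat) : (X1 < Q)%N -> (X2 < Q)%N -> refined q p X1 X2 = T X1 X2.
Proof.
move=> X1Q X2Q; rewrite /T /P /refined.
have a1q : (X1 %/ 3 < q)%N by rewrite ltn_divLR // mulnC.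
have a2q : (X2 %/ 3 < q)%N by rewrite ltn_divLR // mulnC.
have E (X : nat) : third X = (X %/ 3)%:R + (X %% 3)%:R / 3 :> R.
  by rewrite /third -pmulrn {1}(divn_eq X 3) natrD natrM; field.
rewrite !E.
have : (X1 %% 3 < 3)%N by rewrite ltn_mod.
have : (X2 %% 3 < 3)%N by rewrite ltn_mod.
move: (X1 %/ 3)%N (X2 %/ 3)%N (X1 %% 3)%N (X2 %% 3)%N a1q a2q => a1 a2 b1 b2 a1q a2q b23 b13.
have pE (i j : nat) : p i j = P i%:R j%:R by rewrite /p /P /gridpt /scaled -!pmulrn.
have nextP (a : nat) : (a < q)%N -> exists z : int, (next q a)%:R = a%:R + 1 + (z * q%:Z)%:~R :> R.
  move=> aq; have [aq'|aq'] := ltnP a.+1 q.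
    by exists 0; rewrite mul0r addr0 /next modn_small // -addn1 natrD.
  exists (-1); have -> : q = a.+1 by apply/eqP; rewrite eqn_leq aq' aq.
  by rewrite /next modnn mulN1r intrN -pmulrn -addn1 natrD subrr.
have [z1 n1] := nextP _ a1q; have [z2 n2] := nextP _ a2q.
have p10 : p (next q a1) a2 = P (a1%:R + 1) a2%:R.
  rewrite pE n1; have := scaled_periodic pi_min q0 (a1%:R + 1) a2%:R z1 0.
  by rewrite mul0r addr0.
have p01 : p a1 (next q a2) = P a1%:R (a2%:R + 1).
  rewrite pE n2; have := scaled_periodic pi_min q0 a1%:R (a2%:R + 1) 0 z2.
  by rewrite mul0r addr0.
have p11 : p (next q a1) (next q a2) = P (a1%:R + 1) (a2%:R + 1).
  by rewrite pE n1 n2; exact: (scaled_periodic pi_min q0).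
rewrite /refined_value p10 p01 p11 pE.
have Pa : cell_affine P by exact: pwl_cell_affine.
have [A [B [C lowE]]] := Pa a1%:Z a2%:Z false.
have [A' [B' [C' upE]]] := Pa a1%:Z a2%:Z true.
have low u v : 0 <= u -> 0 <= v -> u + v <= 1 ->
    P (a1%:R + u) (a2%:R + v) = A * (a1%:R + u) + B * (a2%:R + v) + C.
  move=> *; apply: lowE; rewrite /box /= !intrD -!pmulrn mulr0n mulr1n.
  by split; apply/andP; split; lra.
have up u v : u <= 1 -> v <= 1 -> 1 <= u + v ->
    P (a1%:R + u) (a2%:R + v) = A' * (a1%:R + u) + B' * (a2%:R + v) + C'.
  move=> *; apply: upE; rewrite /box /= !intrD -!pmulrn mulr1n.
  by split; apply/andP; split; lra.
have P00 : P a1%:R a2%:R = A * a1%:R + B * a2%:R + C.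
  by have := low 0 0; rewrite !addr0; apply; lra.
have P10 : P (a1%:R + 1) a2%:R = A * (a1%:R + 1) + B * a2%:R + C.
  by have := low 1 0; rewrite !addr0; apply; lra.
have P01 : P a1%:R (a2%:R + 1) = A * a1%:R + B * (a2%:R + 1) + C.
  by have := low 0 1; rewrite !addr0; apply; lra.
have P10' : P (a1%:R + 1) a2%:R = A' * (a1%:R + 1) + B' * a2%:R + C'.
  by have := up 1 0; rewrite !addr0; apply; lra.
have P01' : P a1%:R (a2%:R + 1) = A' * a1%:R + B' * (a2%:R + 1) + C'.
  by have := up 0 1; rewrite !addr0; apply; lra.
have P11' : P (a1%:R + 1) (a2%:R + 1) = A' * (a1%:R + 1) + B' * (a2%:R + 1) + C'.
  by apply: up; lra.
rewrite -/(P _ _).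
have b_le (b : nat) : (b < 3)%N -> 0 <= (b%:R / 3 : R) <= 1.
  by move=> b3; rewrite divr_ge0 //= ler_pdivrMr // mul1r ler_nat ltnW.
have /andP[u0 u1] := b_le _ b13; have /andP[v0 v1] := b_le _ b23.
have [le3|gt3] := leqP (b1 + b2) 3.
  have -> : (b1 + b2 - 3 = 0)%N by apply/eqP; rewrite subn_eq0.
  rewrite !subn0 natrB // natrD mul0r addr0 P00 P10 P01 low //; first by field.
  by rewrite -mulrDl -natrD ler_pdivrMr // mul1r ler_nat.
have -> : (3 - (b1 + b2) = 0)%N by apply/eqP; rewrite subn_eq0 ltnW.
rewrite !natrB; [|lia..]; rewrite natrD mul0r add0r P10' P01' P11' up //; first by field.
by rewrite -mulrDl -natrD ler_pdivlMr // mul1r ler_nat ltnW.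
Qed.

Lemma fidx_residueK X1 X2 : (fidx q (residue X1) (residue X2) %/ Q = residue X1)%N /\
  (fidx q (residue X1) (residue X2) %% Q = residue X2)%N.
Proof.
rewrite /fidx divnMDl // modnMDl modn_small ?(residue_lt Q0) // divn_small ?(residue_lt Q0) //.
by rewrite addn0.
Qed.

Lemma table_residue X1 X2 : table q p (fidx q (residue X1) (residue X2)) = T X1 X2.
Proof.
rewrite /table (fidx_residueK X1 X2).1 (fidx_residueK X1 X2).2.
rewrite refinedE ?(residue_lt Q0) // {2}(residueE Q0 X1) {2}(residueE Q0 X2).
by rewrite [RHS](grid_periodic pi_min q0).
Qed.

Lemma wrapped_residue X1 X2 Y1 Y2 :
  wrapped_idx q (residue X1) (residue X2) (residue Y1) (residue Y2) =
  fidx q (residue (X1 + Y1)) (residue (X2 + Y2)).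
Proof. by rewrite /wrapped_idx !(residueD Q0). Qed.

Lemma solutionE (v : nat -> R) : solution q p v <->
  forall X1 X2 Y1 Y2,
    (T X1 X2 + T Y1 Y2 = T (X1 + Y1) (X2 + Y2) ->
       v (fidx q (residue X1) (residue X2)) + v (fidx q (residue Y1) (residue Y2)) =
       v (fidx q (residue (X1 + Y1)) (residue (X2 + Y2)))) /\
    (T X1 X2 = 1 -> v (fidx q (residue X1) (residue X2)) = 0).
Proof.
split=> [sol X1 X2 Y1 Y2|sol x1 x1Q x2 x2Q y1 y1Q y2 y2Q].
  have [] := sol _ (residue_lt Q0 X1) _ (residue_lt Q0 X2) _ (residue_lt Q0 Y1) _ (residue_lt Q0 Y2).
  rewrite /additive_equation /one_equation !indicator_mul_eq0 /additivity.
  rewrite !wrapped_residue !table_residue => add one.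
  split=> [TE|TE]; last by apply: one; rewrite TE subrr.
  by apply/eqP; rewrite -subr_eq0; apply/eqP/add; rewrite TE subrr.
have := sol x1 x2 y1 y2.
rewrite -!table_residue -!wrapped_residue !(residue_nat (n := Q)) // => -[add one].
rewrite /additive_equation /one_equation !indicator_mul_eq0 /additivity.
split=> /eqP; rewrite subr_eq0 => /eqP; last exact: one.
by move/add ->; rewrite subrr.
Qed.

Lemma grid_target : T (3 * f1) (3 * f2) = 1.
Proof.
rewrite /T /P !third3; have := scaled_symmetric pi_min 0 0; rewrite !subr0.
by rewrite (scaled_00 pi_min) add0r.
Qed.

(* If P = 1 at X then P = 0 at W := 3 f - X, hence at all multiples of W. By
   additivity phi (k W) = k phi W, and k = Q gives phi W = 0. *)
Lemma grid_solution_at_one phi X1 X2 : grid_solution P f1 f2 q phi ->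
  T X1 X2 = 1 -> phi X1 X2 = 0.
Proof.
move=> [_ per phif add'] TX.
have add Y1 Y2 Z1 Z2 : T Y1 Y2 + T Z1 Z2 = T (Y1 + Z1) (Y2 + Z2) ->
  phi Y1 Y2 + phi Z1 Z2 = phi (Y1 + Z1) (Y2 + Z2) by exact: add'.
pose W1 := 3 * f1 - X1; pose W2 := 3 * f2 - X2.
have thirdW (a X : int) : third (3 * a - X) = a%:~R - third X :> R.
  by rewrite /third intrB intrM; field.
have TW : T W1 W2 = 0.
  have := scaled_symmetric pi_min (third X1) (third X2).
  rewrite -!thirdW => TE; move: TX; rewrite /T /P -/W1 -/W2 => TX.
  by move: TE; rewrite TX => TE; lra.
have T0 : T 0 0 = 0 by rewrite /T /third mul0r; exact: (scaled_00 pi_min).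
have T_ge0 Y1 Y2 : 0 <= T Y1 Y2 by exact: (scaled_ge0 pi_min).
have sub Y1 Y2 : T (W1 + Y1) (W2 + Y2) <= T W1 W2 + T Y1 Y2.
  by rewrite /T !thirdD; exact: (scaled_subadditive pi_min).
have phi0 : phi 0 0 = 0.
  by have := add 0 0 0 0; rewrite !addr0 T0 addr0 => /(_ erefl); lra.
have mulW (k : nat) : T (W1 *+ k) (W2 *+ k) = 0 /\ phi (W1 *+ k) (W2 *+ k) = k%:R * phi W1 W2.
  elim: k => [|k [Tk phik]]; first by rewrite !mulr0n mul0r.
  rewrite !mulrS; have Tk1 : T (W1 + W1 *+ k) (W2 + W2 *+ k) = 0.
    by apply/le_anti; rewrite T_ge0 andbT -[X in _ <= X](addr0 0) -{1}TW -Tk.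
  split=> //; have := add W1 W2 (W1 *+ k) (W2 *+ k).
  by rewrite Tk1 TW Tk addr0 => /(_ erefl) <-; rewrite phik; ring.
have phiW : phi W1 W2 = 0.
  have mulQ (W : int) : W *+ Q = 0 + W * (3 * q%:Z).
    by rewrite add0r -[LHS]mulr_natr [X in _ * X = _]natz.
  have [_] := mulW Q; rewrite !mulQ per phi0 => /esym/eqP.
  by rewrite mulf_eq0 pnatr_eq0 gtn_eqF // => /eqP.
have := add X1 X2 W1 W2; rewrite phiW TX TW !addr0 /W1 /W2 !subrKC phif.
by apply; rewrite grid_target.
Qed.

(** A grid solution satisfies the equations at all points where pi = 1 by [grid_solution_at_one];
    conversely f is one of these points. *)
Lemma trivial_solutionsP :
  (forall v, solution q p v -> forall i, (i < N)%N -> v i = 0) <->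
  ~ exists phi, grid_solution P f1 f2 q phi.
Proof.
split=> [triv [phi gs]|none v sol i iN].
  have [[W1 [W2 nz]] per _ add] := gs.
  pose v i := phi (i %/ Q)%N%:Z (i %% Q)%N%:Z.
  have vE X1 X2 : v (fidx q (residue X1) (residue X2)) = phi X1 X2.
    rewrite /v (fidx_residueK X1 X2).1 (fidx_residueK X1 X2).2.
    by rewrite {2}(residueE Q0 X1) {2}(residueE Q0 X2) per.
  have /triv v0 : solution q p v.
    apply/solutionE => X1 X2 Y1 Y2; rewrite !vE.
    by split; [exact: add|exact: grid_solution_at_one].
  have := v0 (fidx q (residue W1) (residue W2)); rewrite vE => z.
  by move: nz; rewrite z ?eqxx // fine_bound // residue_lt.
apply/eqP/negPn/negP => nz; apply: none.
move/solutionE: sol => sol.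
exists (fun X1 X2 => v (fidx q (residue X1) (residue X2))); split.
- exists (i %/ Q)%N, (i %% Q)%N.
  have iQ : (i %/ Q < Q)%N by rewrite ltn_divLR.
  by rewrite !(residue_nat (n := Q)) ?ltn_mod // /fidx -divn_eq.
- by move=> X1 X2 z1 z2; rewrite !(residue_period Q).
- have [_] := sol (3 * f1) (3 * f2) 0 0; apply; exact: grid_target.
by move=> X1 X2 Y1 Y2 TE; have [/(_ TE)] := sol X1 X2 Y1 Y2.
Qed.

End GridVectors.

(** * The polynomial time bound and the theorem *)

Definition polynomially_bounded (c : nat -> nat) : Prop :=
  exists p : {poly nat}, forall n, (c n <= p.[n])%N.

Lemma polynomially_bounded_id : polynomially_bounded id.
Proof. by exists 'X => n; rewrite hornerX. Qed.

Lemma polynomially_bounded_const k : polynomially_bounded (fun=> k).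
Proof. by exists k%:P => n; rewrite hornerC. Qed.

Lemma polynomially_boundedD c d : polynomially_bounded c -> polynomially_bounded d ->
  polynomially_bounded (fun n => c n + d n)%N.
Proof. by move=> [p cp] [r dr]; exists (p + r) => n; rewrite hornerD leq_add. Qed.

Lemma polynomially_boundedM c d : polynomially_bounded c -> polynomially_bounded d ->
  polynomially_bounded (fun n => c n * d n)%N.
Proof. by move=> [p cp] [r dr]; exists (p * r) => n; rewrite hornerM leq_mul. Qed.

Lemma test_cost_bounded : polynomially_bounded test_cost.
Proof.
rewrite /test_cost /refine_cost /solve_cost /squares_cost /pair_cost /eliminate_cost /for_cost.
repeat first [ match goal with |- polynomially_bounded (fun=> ?k) =>
                 exact: (polynomially_bounded_const k) end
             | exact: polynomially_bounded_id
             | apply: polynomially_boundedD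
             | apply: polynomially_boundedM ].
Qed.

Theorem theorem1p8 (R : realType) :
  exists (c : cmd) (p : {poly nat}),
  forall (q : nat) (f : plane R) (pi : plane R -> R),
    (0 < q)%N -> vert q f -> ~ Z2 f ->
    minimal Z2 f pi -> pwl q pi -> diagonally_constrained q pi ->
    exists (t : nat) (s : state),
      [/\ exec c (input q f pi) t s, (t <= (p.[q])%R)%N &
          accepting s <-> extreme Z2 f pi].
Proof.
have [p costp] := test_cost_bounded.
exists extremality_test, p => q f pi q0 [[f1 f2] _ fE] _ pi_min pi_pwl dc.
have f_scaled : f = scaled q f1%:~R f2%:~R by rewrite -fE.
have [||t [s [ex tT acc]]] := @extremality_test_exec R q
  (fun i j => pi (gridpt q (i%:Z, j%:Z))) q0 (input q f pi) erefl.
- move=> i j iq jq; rewrite /input /=; have -> : (2 + (i * q + j) - 2 = i * q + j)%N by lia.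
  have -> : (i * q + j < q * q)%N by nia.
  by rewrite divnMDl // modnMDl modn_small // divn_small // addn0.
- move=> a aB; rewrite /input /=.
  by do 2 (case: eqP => [?|_]; first by exfalso; lia); case: ltnP => //; lia.
exists t, s; split=> //; first exact: leq_trans tT (costp q).
rewrite f_scaled in pi_min *.
rewrite acc (trivial_solutionsP q0 pi_min pi_pwl); split=> [none|ext [phi gs]].
  apply: contrapT => next; apply: none.
  exact: (grid_solution_of_not_extreme q0 pi_min pi_pwl dc next).
exact: (not_extreme_of_grid_solution q0 pi_min pi_pwl gs ext).
Qed.
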